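(* Let $\mathcal{P}=(P,\preceq)$ be a finite poset and consider a poset-causal system with data $(A,B,C,D,F)$ such that $(A_{ii},B_{ii})$ is stabilizable for all $i\in P$. The optimal controller $$K^{*}=\left[\begin{array}{c|c} A_\Phi-B_\Phi C_\Phi & B_\Phi\\ \hline C_Q(\Pi_2-\Pi_1C_\Phi) & C_Q\Pi_1\end{array}\right],\qquad u=K^*x,$$ is of the form $$u(t)=-K_\Phi\Gamma\,x(t)=-\sum_{j\in P}\hat K(\downarrow j,\downarrow j)\,\Phi(j)\,(\Gamma x)_j(t),$$ where $\Phi,\Gamma,K_\Phi$ are the transfer matrices defined in the context.
   Context: Poset notation. $P=\{1,\dots,p\}$, $\downarrow j=\{q\in P: j\preceq q\}$. Elements of $P$ are indexed along a linear extension ($i\preceq j$ implies $i\le j$), and sets $\downarrow j$ are listed in increasing order, so that $j$ comes first. Block matrices. All matrices are partitioned into blocks indexed by $P$. A block matrix $M$ is in the (block) incidence algebra $\mathcal{I}(\mathcal{P})$ if $M_{ij}=0$ whenever $j\not\preceq i$. System. $\dot x=Ax+Fw+Bu$, $z=Cx+Du$, in continuous time, $x=(x_1,\dots,x_p)$, $x_i\in\mathbb{R}^{n_i}$, $u=(u_1,\dots,u_p)$, $u_i\in\mathbb{R}^{m_i}$, $z\in\mathbb{R}^l$; $C=[C_j]$, $D=[D_j]$ are partitioned into block columns. Poset-causal means $A,B\in\mathcal{I}(\mathcal{P})$. Standing assumptions: $C^TD=0$, $D^TD\succ0$, $F$ block diagonal with full column rank. $K^*$ is the controller solving: minimize $\|P_{11}+P_{12}K(I-P_{22}K)^{-1}P_{21}\|^2$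 ($\mathcal{H}_2$ norm) over stabilizing proper real-rational $K\in\mathcal{I}(\mathcal{P})$, where $P_{11}=C(sI-A)^{-1}F$, $P_{12}=C(sI-A)^{-1}B+D$, $P_{21}=(sI-A)^{-1}F$, $P_{22}=(sI-A)^{-1}B$. The notation $\left[\begin{array}{c|c}\mathcal{A}&\mathcal{B}\\ \hline \mathcal{C}&\mathcal{D}\end{array}\right]$ means $\mathcal{C}(sI-\mathcal{A})^{-1}\mathcal{B}+\mathcal{D}$. Expressions such as $\Gamma x$ denote the action of the transfer matrix on the signal; thus the claim is an identity of transfer matrices $K^*=-K_\Phi\Gamma$ together with its column expansion. $(\Gamma x)_j$ is the $j$-th block of $\Gamma x$. Submatrices. $M(j)$ is the $j$-th block column of $M$; $M(\downarrow j)$ consists of the block columns of $M$ indexed by $\downarrow j$; $M(\downarrow j,\downarrow j)=[M_{kl}]_{k,l\in\downarrow j}$. Riccati gains. For $j\in P$ put $A_j=A(\downarrow j,\downarrow j)$, $B_j=B(\downarrow j,\downarrow j)$, $C_j'=C(\downarrow j)$, $D_j'=D(\downarrow j)$. Let $X_j$ be the unique symmetric positive definite solution of $A_j^TX_j+X_jA_j-X_jB_j(D_j'^TD_j')^{-1}B_j^TX_j+C_j'^TC_j'=0$ (its existence is taken for granted throughout) and set $K(\downarrow j,\downarrow j)=(D_j'^TD_j')^{-1}B_j^TX_j$. $\hat K(\downarrow j,\downarrow j)$ is the block $p\times p$ matrix obtained from $K(\downarrow j,\downarrow j)$ by zero padding: its $(l,m)$ block is $K(\downarrow j,\downarrow j)_{lm}$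 if $l,m\in\downarrow j$ and $0$ otherwise. Constructed matrices. $\mathbf{A}=\mathrm{diag}_{j\in P}\big(A(\downarrow j,\downarrow j)-B(\downarrow j,\downarrow j)K(\downarrow j,\downarrow j)\big)$, $\mathbf{K}=\mathrm{diag}_{j\in P}\big(K(\downarrow j,\downarrow j)\big)$. $E_i$ denotes a tall block matrix with an identity in the $i$-th block row and zeros elsewhere. $\Pi_1$ is block diagonal with $j$-th diagonal block $E_1$ having $|\downarrow j|$ block rows, i.e. the $(\sum_{k\in\downarrow j}n_k)\times n_j$ matrix with identity in the first $n_j$ rows and zeros below. $\Pi_2$ is block diagonal with $j$-th diagonal block $[E_2\ \cdots\ E_{|\downarrow j|}]$ with $|\downarrow j|$ block rows (no columns if $\downarrow j=\{j\}$). For $S\subseteq P$, $E_S=[E_i]_{i\in S}$ with block rows indexed by $P$; $R=[E_{\downarrow1}\ \cdots\ E_{\downarrow p}]$. Then $A_\Phi=\Pi_2^T\mathbf{A}\Pi_2$, $B_\Phi=\Pi_2^T\mathbf{A}\Pi_1$, $C_\Phi=R\Pi_2$, $C_Q=-R\mathbf{K}$, where the blocks of $R$ have state dimensions $n_i$ in $C_\Phi$ and input dimensions $m_i$ in $C_Q$. Filters. The propagation filter $\Phi$ and the differential filter $\Gamma$ are the block $p\times p$ transfer matrices $$\Phi=\left[\begin{array}{c|c}A_\Phi&B_\Phi\\ \hline C_\Phi&I\end{array}\right],\qquad \Gamma=\left[\begin{array}{c|c}A_\Phi-B_\Phi C_\Phi&B_\Phi\\ \hline -C_\Phi&I\end{array}\right],$$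 which are inverses of each other. $K_\Phi$ is the block transfer matrix with $j$-th block column $K_\Phi(j)=\hat K(\downarrow j,\downarrow j)\Phi(j)$, $j\in P$. *)

(* Defs.v *)
From HB Require Import structures.
From mathcomp Require Export all_boot all_order all_algebra.
From mathcomp Require Export generic_quotient fraction.
From mathcomp Require Export complex.
From mathcomp Require Export all_classical all_reals all_analysis.

Set Implicit Arguments.
Unset Strict Implicit.
Unset Printing Implicit Defensive.

Import Order.TTheory GRing.Theory Num.Theory.

Local Open Scope ring_scope.

(* The field of real-rational functions of the Laplace variable. *)
Notation ratfun R := {fraction {poly R}}.

Section RationalFunctions.
Context {R : realType}.
Implicit Types (f : ratfun R).

Definition svar : ratfun R := FracField.tofrac 'X.

Definition lift_mx {a b} (M : 'M[R]_(a, b)) : 'M[ratfun R]_(a, b) :=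
  map_mx (fun c => FracField.tofrac c%:P) M.

(* [repr f] is an arbitrary fraction representing [f]; dividing by the gcd
   makes the zeros of [rden f] exactly the poles of [f]. *)
Definition rnum f : {poly R} :=
  (frac (repr f)).1 %/ gcdp (frac (repr f)).1 (frac (repr f)).2.
Definition rden f : {poly R} :=
  (frac (repr f)).2 %/ gcdp (frac (repr f)).1 (frac (repr f)).2.

Definition to_cpoly (q : {poly R}) : {poly R[i]} := map_poly (real_complex R) q.

Definition reval f (z : R[i]) : R[i] :=
  (to_cpoly (rnum f)).[z] / (to_cpoly (rden f)).[z].

Definition rproper f : Prop := (size (rnum f) <= size (rden f))%N.

Definition rstable f : Prop :=
  forall z : R[i], root (to_cpoly (rden f)) z -> complex.Re z < 0.

Definition proper_mx {a b} (G : 'M[ratfun R]_(a, b)) : Prop :=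
  forall i j, rproper (G i j).

Definition RHinfty {a b} (G : 'M[ratfun R]_(a, b)) : Prop :=
  forall i j, rproper (G i j) /\ rstable (G i j).

(* Squared H2 norm of a transfer matrix that is stable:
   1/(2 pi) * int tr (G(iw)^* G(iw)) dw, with value +oo when the integral
   diverges (e.g. when G is not strictly proper). *)
Definition H2norm_sq {a b} (G : 'M[ratfun R]_(a, b)) : \bar R :=
  (((2 * pi)^-1)%:E *
   \int[@lebesgue_measure R]_(w in setT)
     (\sum_i \sum_j
        ((complex.Re (reval (G i j) (Complex 0 w))) ^+ 2 +
         (complex.Im (reval (G i j) (Complex 0 w))) ^+ 2))%:E)%E.

Definition resolvent {k} (A : 'M[R]_k) : 'M[ratfun R]_k :=
  invmx (svar%:M - lift_mx A).

(* The transfer matrix [ A | B ; C | D ]. *)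
Definition tf {k a b} (A : 'M[R]_k) (B : 'M[R]_(k, b)) (C : 'M[R]_(a, k))
    (D : 'M[R]_(a, b)) : 'M[ratfun R]_(a, b) :=
  lift_mx C *m resolvent A *m lift_mx B + lift_mx D.

Definition Hurwitz {k} (A : 'M[R]_k) : Prop :=
  forall z : R[i], eigenvalue (map_mx (real_complex R) A) z -> complex.Re z < 0.

Definition stabilizable {k a} (A : 'M[R]_k) (B : 'M[R]_(k, a)) : Prop :=
  exists L : 'M[R]_(a, k), Hurwitz (A + B *m L).

Definition posdef {k} (M : 'M[R]_k) : Prop :=
  M^T = M /\ forall v : 'cV[R]_k, v != 0 -> 0 < (v^T *m M *m v) 0 0.

End RationalFunctions.

Section BlockMatrices.
Context {T : nzRingType}.

(* The tall block matrix with block rows of sizes d_0, ..., d_{q-1}, the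
   identity of size d_k in block row k, and zeros elsewhere. *)
Definition E_blk {q} (d : 'I_q -> nat) (k : 'I_q) : 'M[T]_(\sum_i d i, d k) :=
  \mxcol_i (if i == k then pid_mx (d k) else 0).

(* Block diagonal matrix with rectangular blocks (cf. [mxdiag]). *)
Definition bdiag {q} (r c : 'I_q -> nat) (M : forall i, 'M[T]_(r i, c i)) :
    'M[T]_(\sum_i r i, \sum_i c i) :=
  \mxblock_(i, j) (if i == j then conform_mx 0 (M i) else 0).

Definition is_bdiag {q} (r c : 'I_q -> nat)
    (M : 'M[T]_(\sum_i r i, \sum_i c i)) : Prop :=
  forall i j, i != j -> submxblock M i j = 0.

Definition incidence {q} (ple : rel 'I_q) (r c : 'I_q -> nat)
    (M : 'M[T]_(\sum_i r i, \sum_i c i)) : Prop :=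
  forall i j, ~~ ple j i -> submxblock M i j = 0.

(* Submatrices indexed by S; [enum_val] lists S in increasing order. *)
Definition sdim {q} (d : 'I_q -> nat) (S : {set 'I_q}) : 'I_#|S| -> nat :=
  fun k => d (enum_val k).

Definition sub_sq {q} (r c : 'I_q -> nat) (S : {set 'I_q})
    (M : 'M[T]_(\sum_i r i, \sum_i c i)) :
    'M[T]_(\sum_k sdim r (S := S) k, \sum_k sdim c (S := S) k) :=
  \mxblock_(k, l) submxblock M (enum_val k) (enum_val l).

Definition sub_cols {q a} (c : 'I_q -> nat) (S : {set 'I_q})
    (M : 'M[T]_(a, \sum_i c i)) : 'M[T]_(a, \sum_k sdim c (S := S) k) :=
  \mxrow_k submxrow M (enum_val k).

(* E_S = [E_i]_{i in S}, with block rows indexed by P. *)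
Definition E_set {q} (d : 'I_q -> nat) (S : {set 'I_q}) :
    'M[T]_(\sum_i d i, \sum_k sdim d (S := S) k) :=
  \mxrow_(k < #|S|) E_blk d (enum_val k).

(* Zero padding of a matrix with blocks indexed by S: the (i, j) block of the
   result is the corresponding block of M if i, j are in S, and 0 otherwise. *)
Definition zero_pad {q} (r c : 'I_q -> nat) (S : {set 'I_q})
    (M : 'M[T]_(\sum_k sdim r (S := S) k, \sum_k sdim c (S := S) k)) :
    'M[T]_(\sum_i r i, \sum_i c i) :=
  E_set r S *m M *m (E_set c S)^T.

Lemma succ_ord_subproof a (k : 'I_a.-1) : (k.+1 < a)%N.
Proof. by rewrite -ltn_predRL. Qed.

Definition succ_ord {a} (k : 'I_a.-1) : 'I_a := Ordinal (succ_ord_subproof k).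

(* [E_2 ... E_a], all blocks but the first. *)
Definition E_tail {a} (d : 'I_a -> nat) :
    'M[T]_(\sum_i d i, \sum_(k < a.-1) d (succ_ord k)) :=
  \mxrow_(k < a.-1) E_blk d (succ_ord k).

End BlockMatrices.

Arguments sdim {q} d S _ /.

Section Poset.
Context {p : nat} (ple : rel 'I_p).

Definition partial_order : Prop :=
  [/\ reflexive ple, antisymmetric ple & transitive ple].

Definition linear_extension_indexed : Prop :=
  forall i j : 'I_p, ple i j -> (i <= j)%N.

Definition down (j : 'I_p) : {set 'I_p} := [set q | ple j q].

End Poset.

(* Generalized plant z = P11 w + P12 u, x = P21 w + P22 u with full state x
   measured, and the H2 problem over it. *)
Section H2Problem.
Context {R : realType} {p : nat} (ple : rel 'I_p).
Context {n m r : 'I_p -> nat} {l : nat}.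
Context (A : 'M[R]_(\sum_i n i)) (B : 'M[R]_(\sum_i n i, \sum_i m i)).
Context (C : 'M[R]_(l, \sum_i n i)) (D : 'M[R]_(l, \sum_i m i)).
Context (F : 'M[R]_(\sum_i n i, \sum_i r i)).
Implicit Type K : 'M[ratfun R]_(\sum_i m i, \sum_i n i).

Definition P11 := lift_mx C *m resolvent A *m lift_mx F.
Definition P12 := lift_mx C *m resolvent A *m lift_mx B + lift_mx D.
Definition P21 := resolvent A *m lift_mx F.
Definition P22 := resolvent A *m lift_mx B.

Definition sens K := invmx (1%:M - P22 *m K).

Definition closed_loop K := P11 + P12 *m K *m sens K *m P21.

(* Internal stability: with u = K x + v1 and measurement x = P21 w + P22 u + v2,
   the nine transfer matrices (w, v1, v2) -> (z, u, x) are stable and proper. *)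
Definition stabilizing K : Prop :=
  [/\ 1%:M - P22 *m K \in unitmx,
      [/\ RHinfty (closed_loop K),
          RHinfty (P12 *m (1%:M + K *m sens K *m P22))
        & RHinfty (P12 *m K *m sens K)],
      [/\ RHinfty (K *m sens K *m P21),
          RHinfty (1%:M + K *m sens K *m P22)
        & RHinfty (K *m sens K)]
    & [/\ RHinfty (sens K *m P21),
          RHinfty (sens K *m P22)
        & RHinfty (sens K)]].

Definition admissible K : Prop :=
  [/\ incidence ple K, proper_mx K & stabilizing K].

Definition H2_optimal K : Prop :=
  admissible K /\
  forall K', admissible K' ->
    (H2norm_sq (closed_loop K) <= H2norm_sq (closed_loop K'))%E.

End H2Problem.

Section Controller.
Context {R : realType} {p : nat} (ple : rel 'I_p).
Context {n m : 'I_p -> nat} {l : nat}.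
Context (A : 'M[R]_(\sum_i n i)) (B : 'M[R]_(\sum_i n i, \sum_i m i)).
Context (C : 'M[R]_(l, \sum_i n i)) (D : 'M[R]_(l, \sum_i m i)).

Notation dn := (down ple).
(* Total dimensions of the blocks indexed by the downset of j. *)
Notation N j := (\sum_k sdim n (dn j) k)%N.
Notation M j := (\sum_k sdim m (dn j) k)%N.

Definition A_ j : 'M[R]_(N j) := sub_sq (dn j) A.
Definition B_ j : 'M[R]_(N j, M j) := sub_sq (dn j) B.
Definition C_ j : 'M[R]_(l, N j) := sub_cols (dn j) C.
Definition D_ j : 'M[R]_(l, M j) := sub_cols (dn j) D.

Definition riccati_sol j (X : 'M[R]_(N j)) : Prop :=
  posdef X /\
  (A_ j)^T *m X + X *m A_ j
    - X *m B_ j *m invmx ((D_ j)^T *m D_ j) *m (B_ j)^T *m X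
    + (C_ j)^T *m C_ j = 0.

Context (X : forall j, 'M[R]_(N j)).

Definition Kgain j : 'M[R]_(M j, N j) :=
  invmx ((D_ j)^T *m D_ j) *m (B_ j)^T *m X j.

Definition Khat j : 'M[R]_(\sum_i m i, \sum_i n i) := zero_pad (Kgain j).

Definition bigA : 'M[R]_(\sum_j N j) := \mxdiag_j (A_ j - B_ j *m Kgain j).

Definition bigK : 'M[R]_(\sum_j M j, \sum_j N j) := bdiag Kgain.

(* Since j is the first element of its downset, E_1 is the partial identity. *)
Definition Pi1 : 'M[R]_(\sum_j N j, \sum_j n j) :=
  bdiag (fun j => pid_mx (n j) : 'M[R]_(N j, n j)).

(* Dimension of the downset of j without its first element j. *)
Notation N' j := (\sum_(k < #|dn j|.-1) sdim n (dn j) (succ_ord k))%N.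

Definition Pi2 : 'M[R]_(\sum_j N j, \sum_j N' j) :=
  bdiag (fun j => E_tail (sdim n (dn j))).

(* R = [E_{down 1} ... E_{down p}] for block rows of dimensions d. *)
Definition Rmx (d : 'I_p -> nat) :
    'M[R]_(\sum_i d i, \sum_j \sum_k sdim d (dn j) k) :=
  \mxrow_j E_set d (dn j).

Definition A_Phi := Pi2^T *m bigA *m Pi2.
Definition B_Phi := Pi2^T *m bigA *m Pi1.
Definition C_Phi := Rmx n *m Pi2.
Definition C_Q := - Rmx m *m bigK.

Definition Phi := tf A_Phi B_Phi C_Phi 1%:M.
Definition Gamma := tf (A_Phi - B_Phi *m C_Phi) B_Phi (- C_Phi) 1%:M.

Definition K_Phi : 'M[ratfun R]_(\sum_i m i, \sum_i n i) :=
  \mxrow_j (lift_mx (Khat j) *m submxrow Phi j).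

Definition Kstar : 'M[ratfun R]_(\sum_i m i, \sum_i n i) :=
  tf (A_Phi - B_Phi *m C_Phi) B_Phi
     (C_Q *m (Pi2 - Pi1 *m C_Phi)) (C_Q *m Pi1).

End Controller.

(* Main.v *)
Require Import Defs.
From mathcomp Require Import measurable_realfun.
From mathcomp Require Import ring lra zify.
Set Implicit Arguments.
Unset Strict Implicit.
Unset Printing Implicit Defensive.
Import Order.TTheory GRing.Theory Num.Theory.
Local Open Scope ring_scope.

(** The controller separates over the elements j of the poset.  A disturbance
    entering block j of a causal closed loop only excites the blocks of the
    downset of j, so block column j of the problem is an ordinary state-feedback
    problem for the subsystem (A_j, B_j, C_j, D_j), whose best possible value is
    reached by the Riccati gain K_j.  K* reaches all these values at once: it
    keeps one copy q_j of the state of each subsystem and stacks them in a vector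
    q with q' = bold-A q.

    Realization.  The selection matrices satisfy R Pi1 = 1 and
    Pi1 Pi1^T + Pi2 Pi2^T = 1, and causality of A and B gives the intertwining
    A R - B R bold-K = R bold-A ([R_intertwine]).  Hence x = R q splits into the
    components Pi1^T q = Gamma x and Pi2^T q (the controller state), and every
    closed-loop transfer matrix has the form M (s - bold-A)^-1 N + const
    ([ctrl_tf_solution], [ctrl_tf_internally_stable]).  The same algebra shows
    K* = C_Q (Pi2 (s - A_Phi)^-1 B_Phi + Pi1) Gamma ([ctrl_tf_factor]).  The
    middle factor is block diagonal, which identifies C_Q times it with - K_Phi
    ([K_Phi_prop_lift]); this is the factorization K* = - K_Phi Gamma.  Since Phi
    and K_Phi are in the incidence algebra and Gamma is the inverse of Phi, K*
    is in the incidence algebra too.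

    Stability.  bold-A is block diagonal with blocks A_j - B_j K_j, and these are
    Hurwitz: the Riccati equation with X_j > 0 excludes eigenvalues of positive
    real part, and an eigenvalue on the imaginary axis would yield a left
    eigenvector of A_j killed by B_j ([riccati_Hurwitz]), which stabilizability
    of the diagonal pairs forbids because A_j and B_j are block triangular
    ([hautus_block]).

    Optimality.  Let z* and z' be the closed loops of K* and of a competitor.
    Pointwise on the imaginary axis,
    |z'|^2 >= |z*|^2 + 2 Re <z*, z' - z*>.  The Riccati equation turns the cross
    term into the real part of the rational function
    g = sum_j tr (F_j^T X_j (x'_j - x*_j)) ([riccati_cross_term]).  If z' has
    finite norm, then it is strictly proper, hence so is the input, and g and s g
    are stable and strictly proper; the integral of Re g over the imaginary axis
    is then 0 ([integral_Re_reval_eq0]), so the norm of z' is at least that of z*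
    ([H2_compare]).  The vanishing of the integral is obtained from partial
    fractions and explicit primitives, in place of a contour integral. *)

(** * Stable rational functions *)

Notation tofr := (@FracField.tofrac _).

Lemma field_cross (K : fieldType) (a b c d : K) : b != 0 -> d != 0 ->
  a / b = c / d -> a * d = c * b.
Proof. by move=> b0 d0 /eqP; rewrite eqr_div // => /eqP. Qed.

Section StableFractions.
Context {R : realType}.
Implicit Types (f g : ratfun R) (N d : {poly R}).

Definition Hurwitz_poly d := forall z : R[i], root (to_cpoly d) z -> complex.Re z < 0.

Lemma Hurwitz_polyM d d' : Hurwitz_poly d -> Hurwitz_poly d' -> Hurwitz_poly (d * d').
Proof. by move=> hd hd' z; rewrite /to_cpoly rmorphM rootM => /orP[/hd|/hd']. Qed.

Lemma Hurwitz_poly1 : Hurwitz_poly 1.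
Proof. by move=> z; rewrite /to_cpoly rmorph1 (negPf (root1 _)). Qed.

Lemma Hurwitz_poly_im d (w : R) : Hurwitz_poly d -> (to_cpoly d).[Complex 0 w] != 0.
Proof. by move=> hd; apply/negP => /hd; rewrite ltxx. Qed.

Lemma ratfunE f : f = tofr (frac (repr f)).1 / tofr (frac (repr f)).2.
Proof.
have dn0 := denom_ratioP (repr f).
have t0 : tofr (frac (repr f)).2 != 0 by rewrite tofrac_eq0.
apply: (mulIf t0); rewrite mulfVK //.
rewrite -{1}[f]reprK; unlock FracField.tofrac; rewrite -[LHS]FracField.pi_mul.
apply/eqmodP; rewrite /= FracField.equivfE /FracField.mulf !numden_Ratio ?mulr1 ?oner_neq0 //.
by rewrite mulrC.
Qed.

Lemma rden_neq0 f : rden f != 0.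
Proof.
rewrite /rden; have dn0 := denom_ratioP (repr f).
by rewrite dvdp_div_eq0 ?dvdp_gcdr.
Qed.

(** The pair (rnum f, rden f) represents f because the canonical representative
    of f does and the gcd cancels. *)
Lemma ratfunE_red f : f = tofr (rnum f) / tofr (rden f).
Proof.
rewrite {1}[f]ratfunE /rnum /rden.
set a := _.1; set b := _.2; have b0 : b != 0 := denom_ratioP (repr f).
have g0 : gcdp a b != 0 by rewrite gcdp_eq0 (negPf b0) andbF.
have t0 : tofr (gcdp a b) != 0 by rewrite tofrac_eq0.
have aE : tofr a = tofr (a %/ gcdp a b) * tofr (gcdp a b).
  by rewrite -tofracM divpK ?dvdp_gcdl.
have bE : tofr b = tofr (b %/ gcdp a b) * tofr (gcdp a b).
  by rewrite -tofracM divpK ?dvdp_gcdr.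
by rewrite aE bE -mulf_div divff ?mulr1.
Qed.

Lemma coprime_rnum_rden f : coprimep (rnum f) (rden f).
Proof.
rewrite /rnum /rden; set a := _.1; set b := _.2.
have b0 : b != 0 := denom_ratioP (repr f).
by apply: coprimep_div_gcd; rewrite b0 orbT.
Qed.

(** By Gauss, rden f divides the denominator of every representation of f. Poles,
    properness and values of f can thus be read off any representation. *)
Lemma frac_reduced f N d : d != 0 -> f = tofr N / tofr d ->
  exists2 e, e != 0 & N = rnum f * e /\ d = rden f * e.
Proof.
move=> d0 fE.
have td0 : tofr d != 0 by rewrite tofrac_eq0.
have tr0 : tofr (rden f) != 0 by rewrite tofrac_eq0 rden_neq0.
have /(field_cross td0 tr0) : tofr N / tofr d = tofr (rnum f) / tofr (rden f).
  by rewrite -fE -ratfunE_red.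
rewrite -!tofracM => /eqP; rewrite tofrac_eq => /eqP eqN.
have rd : rden f %| d.
  have cop : coprimep (rden f) (rnum f) by rewrite coprimep_sym coprime_rnum_rden.
  by rewrite -(Gauss_dvdpr _ cop) -eqN dvdp_mull.
exists (d %/ rden f).
  by rewrite dvdp_div_eq0.
have dE : d = rden f * (d %/ rden f) by rewrite mulrC divpK.
split=> //; apply: (mulIf (rden_neq0 f)).
by rewrite eqN {1}dE mulrA mulrAC.
Qed.

Lemma revalE f N d z : (to_cpoly d).[z] != 0 -> f = tofr N / tofr d ->
  reval f z = (to_cpoly N).[z] / (to_cpoly d).[z].
Proof.
move=> dz fE.
have d0 : d != 0 by apply: contraNneq dz => ->; rewrite /to_cpoly rmorph0 horner0.
have [e e0 [-> dE]] := frac_reduced d0 fE.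
move: dz; rewrite dE /to_cpoly !rmorphM /= !hornerM mulf_eq0 negb_or => /andP[h1 h2].
by rewrite invfM mulrACA divff ?mulr1.
Qed.

(** The flag asks for stability: with [b = false] only properness is recorded.
    The two cases share all closure properties, and properness alone is what is
    known of the controller itself, which may be unstable. *)
Definition den_ok (b : bool) d := d != 0 /\ (b -> Hurwitz_poly d).

Definition rel_degree (b : bool) (k : nat) f :=
  exists N d, [/\ f = tofr N / tofr d, den_ok b d & (size N + k <= size d)%N].

Notation stable_frac := (rel_degree true).

Lemma den_okM b d d' : den_ok b d -> den_ok b d' -> den_ok b (d * d').
Proof.
move=> [d0 hd] [d0' hd']; split; first by rewrite mulf_neq0.
by move=> bt; apply: Hurwitz_polyM; [exact: hd|exact: hd'].
Qed.

Lemma rproper_frac f N d : d != 0 -> f = tofr N / tofr d ->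
  (size N <= size d)%N -> rproper f.
Proof.
move=> d0 fE; have [e e0 [-> dE]] := frac_reduced d0 fE; rewrite dE /rproper.
have [->|n0] := eqVneq (rnum f) 0; first by rewrite size_poly0.
rewrite !size_mul ?rden_neq0 // -!subn1 leq_subLR subnKC; last first.
  by apply: leq_trans (leq_addl _ _); rewrite size_poly_gt0.
by rewrite leq_add2r.
Qed.

(** Any stable proper representation witnesses stability and properness of the
    reduced fraction, which is what RHinfty looks at. *)
Lemma stable_fracP f : stable_frac 0 f <-> rproper f /\ rstable f.
Proof.
split=> [[N [d [fE [d0 /(_ isT) hd] sz]]]|[pf sf]]; last first.
  by exists (rnum f), (rden f); split; rewrite ?addn0 //; [exact: ratfunE_red|split=> //;
    exact: rden_neq0].
rewrite addn0 in sz.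
split; first exact: rproper_frac sz.
have [e e0 [_ dE]] := frac_reduced d0 fE.
by move=> z rz; apply: hd; rewrite dE /to_cpoly rmorphM rootM; apply/orP; left.
Qed.

Lemma rel_degree_proper b k f : rel_degree b k f -> rproper f.
Proof.
move=> [N [d [fE [d0 hd] sz]]]; apply: rproper_frac d0 fE _.
by apply: leq_trans sz; rewrite leq_addr.
Qed.

Lemma rel_degree_sub b f k : rel_degree b k f -> rel_degree b 0 f.
Proof.
move=> [N [d [fE hd sz]]]; exists N, d; split=> //.
by apply: leq_trans sz; rewrite addn0 leq_addr.
Qed.

Lemma rel_degree0 b k : rel_degree b k (0 : ratfun R).
Proof.
have m : ('X + 1 : {poly R}) \is monic by rewrite -polyC1 monicXaddC.
exists 0, (('X + 1) ^+ k); rewrite rmorph0 mul0r; split=> //.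
  split=> [|_]; first by rewrite monic_neq0 // monic_exp.
  elim: k => [|k IH]; first by rewrite expr0; exact: Hurwitz_poly1.
  rewrite exprS; apply: Hurwitz_polyM IH => z.
  rewrite /to_cpoly rmorphD /= map_polyX rmorph1 /root !hornerE addr_eq0 => /eqP -> /=.
  by rewrite ltrN10.
rewrite size_poly0 add0n.
have := size_exp ('X + 1 : {poly R}) k.
rewrite -polyC1 size_XaddC mul1n => sz; rewrite -{1}sz; exact: leq_pred.
Qed.

(** The zero numerator is treated apart: the size of 0 does not follow the
    degree formula for products. *)
Lemma rel_degreeM b k k' f g : rel_degree b k f -> rel_degree b k' g ->
  rel_degree b (k + k') (f * g).
Proof.
move=> [N [d [-> hd sz]]] [N' [d' [-> hd' sz']]].
have [->|n0] := eqVneq N 0; first by rewrite tofrac0 !mul0r; exact: rel_degree0.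
have [->|n0'] := eqVneq N' 0; first by rewrite tofrac0 mul0r mulr0; exact: rel_degree0.
exists (N * N'), (d * d'); split; first by rewrite !tofracM invfM mulrACA.
  exact: den_okM.
have [[d0 _] [d0' _]] := (hd, hd').
rewrite !size_mul //.
move: n0 n0' d0 d0' sz sz'; rewrite -!size_poly_gt0.
move: (size N) (size N') (size d) (size d') => a c e h; lia.
Qed.

Lemma rel_degreeD b k f g : rel_degree b k f -> rel_degree b k g -> rel_degree b k (f + g).
Proof.
move=> [N [d [-> hd sz]]] [N' [d' [-> hd' sz']]].
have [[d0 _] [d0' _]] := (hd, hd').
have [->|n0] := eqVneq N 0; first by rewrite tofrac0 mul0r add0r; exists N', d'.
have [->|n0'] := eqVneq N' 0; first by rewrite tofrac0 mul0r addr0; exists N, d.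
exists (N * d' + N' * d), (d * d'); split.
- by rewrite tofracD !tofracM -addf_div // tofrac_eq0.
- exact: den_okM.
have := size_polyD (N * d') (N' * d); rewrite leq_max !size_mul //.
move: n0 n0' d0 d0' sz sz'; rewrite -!size_poly_gt0.
move: (size (N * d' + N' * d)%R) (size N) (size N') (size d) (size d') => h a c e i.
lia.
Qed.

Lemma rel_degree_const b c : rel_degree b 0 (tofr c%:P : ratfun R).
Proof.
exists c%:P, 1; rewrite rmorph1 divr1; split=> //.
  by split=> [|_]; [exact: oner_neq0|exact: Hurwitz_poly1].
by rewrite addn0 size_poly1 size_polyC; case: (c != 0).
Qed.

(** Evaluation is additive only away from the poles; at a pole both sides are
    junk values of the division. *)
Lemma revalD f g w : stable_frac 0 f -> stable_frac 0 g ->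
  reval (f + g) (Complex 0 w) = reval f (Complex 0 w) + reval g (Complex 0 w).
Proof.
move=> [N [d [fE [d0 /(_ isT) hd] _]]] [N' [d' [gE [d0' /(_ isT) hd'] _]]].
rewrite (revalE (Hurwitz_poly_im w hd) fE) (revalE (Hurwitz_poly_im w hd') gE).
rewrite (@revalE _ (N * d' + N' * d) (d * d')).
- rewrite /to_cpoly rmorphD !rmorphM /= !hornerE.
  by rewrite -addf_div //; apply: Hurwitz_poly_im.
- by apply: Hurwitz_poly_im; apply: Hurwitz_polyM.
by rewrite fE gE tofracD !tofracM -addf_div // ?tofrac_eq0.
Qed.

Lemma revalM f g w : stable_frac 0 f -> stable_frac 0 g ->
  reval (f * g) (Complex 0 w) = reval f (Complex 0 w) * reval g (Complex 0 w).
Proof.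
move=> [N [d [fE [_ /(_ isT) hd] _]]] [N' [d' [gE [_ /(_ isT) hd'] _]]].
rewrite (revalE (Hurwitz_poly_im w hd) fE) (revalE (Hurwitz_poly_im w hd') gE).
rewrite (@revalE _ (N * N') (d * d')).
- by rewrite /to_cpoly !rmorphM /= !hornerM mulf_div.
- by apply: Hurwitz_poly_im; apply: Hurwitz_polyM.
by rewrite fE gE !tofracM mulf_div.
Qed.

Lemma reval_const (c : R) z : reval (tofr c%:P) z = real_complex R c.
Proof.
rewrite (@revalE _ c%:P 1) ?rmorph1 ?divr1 //; last first.
  by rewrite /to_cpoly rmorph1 hornerC oner_neq0.
by rewrite /to_cpoly rmorph1 hornerC divr1 map_polyC hornerC.
Qed.

Lemma reval0 z : reval (0 : ratfun R) z = 0.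
Proof. by have := reval_const 0 z; rewrite polyC0 rmorph0 => ->; rewrite rmorph0. Qed.

(** The function s f need not be proper, so this is not an instance of
    [revalM]. *)
Lemma revalsM f w : stable_frac 0 f ->
  reval (svar * f) (Complex 0 w) = Complex 0 w * reval f (Complex 0 w).
Proof.
move=> [N [d [fE [_ /(_ isT) hd] _]]].
rewrite (revalE (Hurwitz_poly_im w hd) fE).
rewrite (@revalE _ ('X * N) d) ?Hurwitz_poly_im //.
  by rewrite /to_cpoly rmorphM /= map_polyX hornerM hornerX mulrA.
by rewrite fE tofracM mulrA.
Qed.

End StableFractions.

Notation stable_frac := (rel_degree true).

(** * Partial fractions on the imaginary axis *)

Section ImaginaryAxis.
Import numFieldNormedType.Exports.
Local Open Scope classical_set_scope.
Local Open Scope ring_scope.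
Context {R : realType}.
Notation C := R[i].
Implicit Types (p q c : C) (w : R) (g G : R -> C).

Definition iw w : C := Complex 0 w.
Definition normsq (z : C) : R := complex.Re z ^+ 2 + complex.Im z ^+ 2.

Lemma cReD (x y : C) : complex.Re (x + y) = complex.Re x + complex.Re y.
Proof. by case: x y => [a b] [c d]. Qed.
Lemma cImD (x y : C) : complex.Im (x + y) = complex.Im x + complex.Im y.
Proof. by case: x y => [a b] [c d]. Qed.
Lemma cReM (x y : C) :
  complex.Re (x * y) = complex.Re x * complex.Re y - complex.Im x * complex.Im y.
Proof. by case: x y => [a b] [c d]. Qed.
Lemma cImM (x y : C) :
  complex.Im (x * y) = complex.Re x * complex.Im y + complex.Im x * complex.Re y.
Proof. by case: x y => [a b] [c d]. Qed.

Lemma normsq_ge0 z : 0 <= normsq z.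
Proof. by rewrite addr_ge0 ?sqr_ge0. Qed.

Lemma normsqM (x y : C) : normsq (x * y) = normsq x * normsq y.
Proof. rewrite /normsq cReM cImM; ring. Qed.

Lemma normsqD (x y : C) : normsq (x + y) <= 2 * (normsq x + normsq y).
Proof.
rewrite /normsq cReD cImD -subr_ge0.
have -> : 2 * (complex.Re x ^+ 2 + complex.Im x ^+ 2 + (complex.Re y ^+ 2 + complex.Im y ^+ 2)) -
   ((complex.Re x + complex.Re y) ^+ 2 + (complex.Im x + complex.Im y) ^+ 2) =
   (complex.Re x - complex.Re y) ^+ 2 + (complex.Im x - complex.Im y) ^+ 2 by ring.
by rewrite addr_ge0 ?sqr_ge0.
Qed.

Lemma one_plus_sqr_gt0 w : 0 < 1 + w ^+ 2 :> R.
Proof. by rewrite ltr_pwDl ?sqr_ge0. Qed.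

(** Decay of the squared modulus, so that a product of two such functions is
    integrable. *)
Definition decay g := exists M : R, forall w, normsq (g w) <= M / (1 + w ^+ 2).

(** Complex-valued functions of a real variable are handled through their real
    and imaginary parts, to which the theory of real derivatives and integrals applies. *)
Definition Cderive G g := forall w,
  is_derive w 1 (fun w => complex.Re (G w)) (complex.Re (g w)) /\
  is_derive w 1 (fun w => complex.Im (G w)) (complex.Im (g w)).

Definition Ccont g := continuous (fun w => complex.Re (g w)) /\
                      continuous (fun w => complex.Im (g w)).

(** The symmetric improper integral of g equals pi c. It is witnessed by a
    primitive G and the limit of G(w) - G(-w), a notion that covers each
    1/(i w - p), whose imaginary part is not integrable. *)
Definition principal_value g c := exists2 G, Cderive G g &
  (fun w => complex.Re (G w) - complex.Re (G (- w))) @ +oo --> pi * complex.Re c /\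
  (fun w => complex.Im (G w) - complex.Im (G (- w))) @ +oo --> pi * complex.Im c.

Lemma Cderive_cont G g : Cderive G g -> Ccont G.
Proof.
move=> dG; split=> w; apply: differentiable_continuous; apply/derivable1_diffP;
  have [h1 h2] := dG w; exact: ex_derive.
Qed.

Lemma CcontD g g' : Ccont g -> Ccont g' -> Ccont (fun w => g w + g' w).
Proof.
move=> [h1 h2] [h3 h4]; split=> w.
  under eq_fun do rewrite cReD; exact: continuousD (h1 w) (h3 w).
under eq_fun do rewrite cImD; exact: continuousD (h2 w) (h4 w).
Qed.

Lemma CcontM g g' : Ccont g -> Ccont g' -> Ccont (fun w => g w * g' w).
Proof.
move=> [h1 h2] [h3 h4]; split=> w.
  under eq_fun do rewrite cReM.
  exact: (cvgB (cvgM (h1 w) (h3 w)) (cvgM (h2 w) (h4 w))).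
under eq_fun do rewrite cImM.
exact: (cvgD (cvgM (h1 w) (h4 w)) (cvgM (h2 w) (h3 w))).
Qed.

Lemma Ccont_cst c : Ccont (fun=> c).
Proof. by split=> w; exact: cst_continuous. Qed.

Lemma CderiveM G g G' g' : Cderive G g -> Cderive G' g' ->
  Cderive (fun w => G w * G' w) (fun w => g w * G' w + G w * g' w).
Proof.
move=> dG dG' w; have [h1 h2] := dG w; have [h3 h4] := dG' w; split.
  under eq_fun do rewrite cReM.
  rewrite cReD !cReM; apply: is_derive_eq; rewrite /= /GRing.scale /=.
  ring.
under eq_fun do rewrite cImM.
rewrite cImD !cImM; apply: is_derive_eq; rewrite /= /GRing.scale /=.
ring.
Qed.

Lemma CderiveD G g G' g' : Cderive G g -> Cderive G' g' ->
  Cderive (fun w => G w + G' w) (fun w => g w + g' w).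
Proof.
move=> dG dG' w; have [h1 h2] := dG w; have [h3 h4] := dG' w; split.
  under eq_fun do rewrite cReD.
  by rewrite cReD; apply: is_derive_eq.
under eq_fun do rewrite cImD.
by rewrite cImD; apply: is_derive_eq.
Qed.

Lemma Cderive_cst c : Cderive (fun=> c) (fun=> 0).
Proof. by move=> w; split; exact: is_derive_cst. Qed.

Lemma CderiveZ c G g : Cderive G g -> Cderive (fun w => c * G w) (fun w => c * g w).
Proof.
move=> dG; have := CderiveM (Cderive_cst c) dG.
by congr Cderive; apply/funext => w; rewrite mul0r add0r.
Qed.

Lemma principal_valueD g c g' c' : principal_value g c -> principal_value g' c' ->
  principal_value (fun w => g w + g' w) (c + c').
Proof.
move=> [G dG [l1 l2]] [G' dG' [l1' l2']].
exists (fun w => G w + G' w); first exact: CderiveD.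
rewrite cReD cImD !mulrDr; split.
  under eq_fun do rewrite !cReD opprD addrACA.
  exact: cvgD.
under eq_fun do rewrite !cImD opprD addrACA.
exact: cvgD.
Qed.

(** Scaling by a complex number mixes real and imaginary parts, which is why
    both limits are part of the definition. *)
Lemma principal_valueZ k g c : principal_value g c -> principal_value (fun w => k * g w) (k * c).
Proof.
move=> [G dG [l1 l2]].
exists (fun w => k * G w); first exact: CderiveZ.
split.
  rewrite (_ : pi * _ = complex.Re k * (pi * complex.Re c) - complex.Im k * (pi * complex.Im
    c)); last first.
    by rewrite cReM; ring.
  rewrite (_ : (fun w => _) = (fun w => complex.Re k * (complex.Re (G w) - complex.Re (G (- w)))
    - complex.Im k * (complex.Im (G w) - complex.Im (G (- w))))); last first.
    by apply/funext => w; rewrite !cReM; ring.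
  by apply: cvgB; apply: cvgMr.
rewrite (_ : pi * _ = complex.Re k * (pi * complex.Im c) + complex.Im k * (pi * complex.Re c));
  last first.
  by rewrite cImM; ring.
rewrite (_ : (fun w => _) = (fun w => complex.Re k * (complex.Im (G w) - complex.Im (G (- w)))
    + complex.Im k * (complex.Re (G w) - complex.Re (G (- w))))); last first.
  by apply/funext => w; rewrite !cImM; ring.
by apply: cvgD; apply: cvgMr.
Qed.

Lemma decayD g g' : decay g -> decay g' -> decay (fun w => g w + g' w).
Proof.
move=> [M hM] [M' hM']; exists (2 * (M + M')) => w.
apply: le_trans (normsqD _ _) _; rewrite -mulrA ler_pM2l // mulrDl.
exact: lerD.
Qed.

Lemma decayZ c g : decay g -> decay (fun w => c * g w).
Proof.
move=> [M hM]; exists (normsq c * M) => w.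
by rewrite normsqM -mulrA ler_wpM2l // normsq_ge0.
Qed.

Lemma decay_cvg0 (f : R -> R) (M : R) :
  (forall w, f w ^+ 2 <= M / (1 + w ^+ 2)) -> f @ +oo --> (0 : R).
Proof.
move=> hf; apply/cvgrPdist_le => e e0; near=> w.
rewrite sub0r normrN -(@ler_pXn2r _ 2) ?nnegrE ?normr_ge0 ?(ltW e0) //.
rewrite real_normK ?num_real //. apply: (le_trans (hf w)).
rewrite ler_pdivrMr ?one_plus_sqr_gt0 //.
have w0 : `|M| / e ^+ 2 + 1 <= w by near: w; apply: nbhs_pinfty_ge; rewrite num_real.
have e2 : 0 < e ^+ 2 by rewrite exprn_gt0.
have : `|M| / e ^+ 2 <= w ^+ 2.
  have q0 : 0 <= `|M| / e ^+ 2 by rewrite divr_ge0 // ltW.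
  by move: (_ / _) w0 q0 => x; nra.
rewrite ler_pdivrMr // => h; have := ler_norm M; nra.
Unshelve. all: by end_near. Qed.

Definition simple_pole p w : C := (iw w - p)^-1.

Lemma normsq_simple_pole p w : complex.Re p < 0 ->
  normsq (simple_pole p w) = (complex.Re p ^+ 2 + (w - complex.Im p) ^+ 2)^-1.
Proof.
case: p => a b /= a0; rewrite /normsq /simple_pole /iw /= sub0r sqrrN.
have : a ^+ 2 + (w - b) ^+ 2 != 0.
  by rewrite gt_eqF // ltr_pwDl ?sqr_ge0 // exprn_even_gt0 //= lt_eqF.
set n := _ + _ => n0.
rewrite /n in n0 *; field; exact: n0.
Qed.

Lemma simple_pole_bound p : complex.Re p < 0 ->
  exists M : R, forall w, (complex.Re p ^+ 2 + (w - complex.Im p) ^+ 2)^-1 <= M / (1 + w ^+ 2).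
Proof.
case: p => a b /= a0; exists (2 + (1 + 2 * b ^+ 2) / a ^+ 2) => w.
have a2 : 0 < a ^+ 2 by rewrite exprn_even_gt0 //= lt_eqF.
have n0 : 0 < a ^+ 2 + (w - b) ^+ 2 by rewrite ltr_pwDl ?sqr_ge0.
rewrite ler_pdivlMr ?one_plus_sqr_gt0 // mulrC ler_pdivrMr //.
have -> : (2 + (1 + 2 * b ^+ 2) / a ^+ 2) * (a ^+ 2 + (w - b) ^+ 2) =
  2 * a ^+ 2 + 2 * (w - b) ^+ 2 + 1 + 2 * b ^+ 2 + ((1 + 2 * b ^+ 2) / a ^+ 2) * (w - b) ^+ 2.
  by field; rewrite lt_eqF.
have h1 : 0 <= (1 + 2 * b ^+ 2) / a ^+ 2 * (w - b) ^+ 2.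
  by rewrite mulr_ge0 ?sqr_ge0 // divr_ge0 ?sqr_ge0 // addr_ge0 // mulr_ge0 // sqr_ge0.
have h2 : 0 <= (w - 2 * b) ^+ 2 by exact: sqr_ge0.
lra.
Qed.

Lemma decay_simple_pole p : complex.Re p < 0 -> decay (simple_pole p).
Proof.
move=> hp; have [M hM] := simple_pole_bound hp; exists M => w; by rewrite normsq_simple_pole.
Qed.

Lemma decay_simple_poleX p m : complex.Re p < 0 -> decay (fun w => simple_pole p w ^+ m.+1).
Proof.
move=> hp; have [M hM] := decay_simple_pole hp.
have a2 : 0 < complex.Re p ^+ 2 by rewrite exprn_even_gt0 //= lt_eqF.
elim: m => [|m [M' IH]]; first by exists M => w; rewrite expr1.
exists (((complex.Re p) ^+ 2)^-1 * M') => w; rewrite exprS normsqM -mulrA.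
apply: ler_pM (IH w); rewrite ?normsq_ge0 // normsq_simple_pole //.
by rewrite lef_pV2 ?posrE // ?lerDl ?sqr_ge0 // ltr_pwDl ?sqr_ge0.
Qed.

Lemma Cderive_simple_pole p : complex.Re p < 0 ->
  Cderive (simple_pole p) (fun w => - (Complex 0 1) * simple_pole p w ^+ 2).
Proof.
case: p => a b /= a0 w; rewrite /simple_pole /iw /=.
have n0 t : (0 - a) ^+ 2 + (t - b) ^+ 2 != 0.
  by rewrite gt_eqF // ltr_pwDl ?sqr_ge0 // exprn_even_gt0 //= sub0r oppr_eq0 lt_eqF.
have d0 : is_derive w 1 (fun t : R => ((0 - a) ^+ 2 + (t - b) ^+ 2)^-1)
   (- ((0 - a) ^+ 2 + (w - b) ^+ 2) ^- 2 * (2 * (w - b))).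
  have d1 : is_derive w 1 (fun t : R => ((0 - a) ^+ 2 + (t - b) ^+ 2)) (2 * (w - b)).
    apply: is_derive_eq; rewrite /= /GRing.scale /=; ring.
  exact: (@is_deriveV _ (fun t : R => (0 - a) ^+ 2 + (t - b) ^+ 2) w _ 1 (n0 w) d1).
split.
  apply: is_derive_eq; rewrite /= /GRing.scale /=; field.
  have := n0 w; congr (is_true (_ != 0)); ring.
apply: is_derive_eq; rewrite /= /GRing.scale /=; field.
  have := n0 w; congr (is_true (_ != 0)); ring.
Qed.

Lemma Cderive_simple_poleX p m : complex.Re p < 0 ->
  Cderive (fun w => simple_pole p w ^+ m.+1)
          (fun w => - (Complex 0 1) * (m.+1)%:R * simple_pole p w ^+ m.+2).
Proof.
move=> hp; elim: m => [|m IH].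
  rewrite (_ : (fun w => simple_pole p w ^+ 1) = simple_pole p); last by apply/funext => w;
    rewrite expr1.
  have := Cderive_simple_pole hp; congr Cderive; apply/funext => w; by rewrite mulr1.
have := CderiveM (Cderive_simple_pole hp) IH.
rewrite (_ : (fun w => simple_pole p w * _) = (fun w => simple_pole p w ^+ m.+2)); last first.
  by apply/funext => w; rewrite -exprS.
congr Cderive; apply/funext => w.
rewrite -[m.+2]addn1 natrD; move: (simple_pole p w) (- _) => r j.
by rewrite addn1 !exprS; ring.
Qed.

Lemma Ccont_simple_poleX p m : complex.Re p < 0 -> Ccont (fun w => simple_pole p w ^+ m.+1).
Proof. by move=> hp; apply: Cderive_cont (Cderive_simple_poleX m hp). Qed.

Lemma decay_cvg g : decay g ->
  (fun w => complex.Re (g w) - complex.Re (g (- w))) @ +oo --> (0 : R) /\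
  (fun w => complex.Im (g w) - complex.Im (g (- w))) @ +oo --> (0 : R).
Proof.
move=> [M hM].
have sub2 (x y : R) : (x - y) ^+ 2 <= 2 * (x ^+ 2 + y ^+ 2).
  rewrite -subr_ge0 (_ : _ - _ = (x + y) ^+ 2) ?sqr_ge0 //; ring.
split; apply: (@decay_cvg0 _ (2 * (M + M))) => w;
  apply: (le_trans (sub2 _ _)); rewrite -mulrA ler_pM2l // mulrDl; apply: lerD.
- by apply: le_trans (hM w); rewrite lerDl sqr_ge0.
- by rewrite -(sqrrN w); apply: le_trans (hM (- w)); rewrite lerDl sqr_ge0.
- by apply: le_trans (hM w); rewrite lerDr sqr_ge0.
- by rewrite -(sqrrN w); apply: le_trans (hM (- w)); rewrite lerDr sqr_ge0.
Qed.

(** The primitive is again a power of the pole factor, which vanishes at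
    infinity. *)
Lemma principal_value_simple_poleX p m : complex.Re p < 0 ->
  principal_value (fun w => simple_pole p w ^+ m.+2) 0.
Proof.
move=> hp; set k : C := (- (Complex 0 1) * (m.+1)%:R)^-1.
have k0 : - (Complex 0 1) * (m.+1)%:R != 0 :> C.
  rewrite mulf_neq0 ?pnatr_eq0 // oppr_eq0.
  by apply/eqP => -[/eqP]; rewrite oner_eq0.
exists (fun w => k * simple_pole p w ^+ m.+1).
  have := CderiveZ k (Cderive_simple_poleX m hp); congr Cderive; apply/funext => w.
  by rewrite mulrA mulVf ?mul1r.
by rewrite /= mulr0; apply/decay_cvg/decayZ/decay_simple_poleX.
Qed.

(** With p = a + i b the real part has primitive atan((w - b) / - a), which
    gains pi over the line, and the imaginary part has the primitive
    - ln(a^2 + (w - b)^2) / 2, whose values at w and - w get close. *)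
Lemma principal_value_simple_pole p : complex.Re p < 0 -> principal_value (simple_pole p) 1.
Proof.
case: p => a b /= a0.
have na0 : 0 < - a by rewrite oppr_gt0.
have n0 t : 0 < a ^+ 2 + (t - b) ^+ 2.
  by rewrite ltr_pwDl ?sqr_ge0 // exprn_even_gt0 //= lt_eqF.
exists (fun w => Complex (atan ((w - b) / - a)) (- 2^-1 * ln (a ^+ 2 + (w - b) ^+ 2))).
  move=> w; rewrite /simple_pole /iw /=; split.
    have d1 : is_derive w 1 (fun t : R => (t - b) / - a) (- a)^-1.
      apply: is_derive_eq; rewrite /= /GRing.scale /=; ring.
    have d2 := @is_derive1_comp _ atan (fun t : R => (t - b) / - a) w _ _ (is_derive1_atan _) d1.
    apply: (is_derive_eq d2); rewrite sub0r sqrrN; field.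
    by rewrite gt_eqF ?n0 // lt_eqF.
  have d1 : is_derive w 1 (fun t : R => (a ^+ 2 + (t - b) ^+ 2)) (2 * (w - b)).
    apply: is_derive_eq; rewrite /= /GRing.scale /=; ring.
  have d2 := @is_derive1_comp _ (@ln R) (fun t :
    R => a ^+ 2 + (t - b) ^+ 2) w _ _ (is_derive1_ln (n0 w)) d1.
  have d3 := @is_deriveZ _ _ _ _ (- 2^-1 : R) _ _ _ d2.
  apply: (is_derive_eq d3); rewrite /= /GRing.scale /= sub0r sqrrN; field.
  by rewrite gt_eqF ?n0.
rewrite /= mulr1 mulr0; split.
  have atl (c : R) : (fun w => atan ((w + c) / - a)) @ +oo --> (pi / 2 : R).
    apply: (@cvg_comp _ _ _ (fun w => (w + c) / - a) (@atan R) _ _ _ _ (@cvgy_atan R)).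
    apply/cvgryPge => A; near=> w.
    rewrite ler_pdivlMr // -lerBlDr.
    by near: w; apply: nbhs_pinfty_ge; rewrite num_real.
  rewrite (_ : (fun w => _) = (fun w => atan ((w + - b) / - a) + atan ((w + b) / - a))); last first.
    apply/funext => w; rewrite -atanN; congr (_ + atan _).
    by rewrite -mulNr; congr (_ / _); ring.
  rewrite [X in _ --> X](_ : _ = pi / 2 + pi / 2); last by field.
  by apply: cvgD; exact: atl.
have [M hM] := simple_pole_bound (p := Complex a b) a0; rewrite /= in hM.
have lnsub (x y : R) : 0 < x -> 0 < y -> ln x - ln y <= (x - y) / y.
  move=> x0 y0; rewrite -ln_div ?posrE //.
  have e : x / y = 1 + (x - y) / y by field; rewrite gt_eqF.
  rewrite {1}e; apply: le_ln1Dx.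
  by rewrite -subr_gt0 opprK addrC -e divr_gt0.
have key w : `|ln (a ^+ 2 + (w - b) ^+ 2) - ln (a ^+ 2 + (- w - b) ^+ 2)|
    <= `|4 * w * b| * (M / (1 + w ^+ 2)).
  have h1 := hM w; have := hM (- w); rewrite sqrrN => h2.
  have [n1 n2] := (n0 w, n0 (- w)).
  have e : a ^+ 2 + (- w - b) ^+ 2 - (a ^+ 2 + (w - b) ^+ 2) = 4 * w * b by ring.
  have l1 := lnsub _ _ n1 n2; have l2 := lnsub _ _ n2 n1.
  rewrite ler_norml; apply/andP; split.
    rewrite lerNl opprB; apply: le_trans l2 _; apply: le_trans (ler_norm _) _.
    rewrite normrM ler_pM ?normr_ge0 //.
      by rewrite e.
    by rewrite ger0_norm // invr_ge0 ltW.
  apply: le_trans l1 _; apply: le_trans (ler_norm _) _.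
  rewrite normrM ler_pM ?normr_ge0 //.
    by rewrite -normrN opprB e.
  by rewrite ger0_norm // invr_ge0 ltW.
rewrite -[X in _ --> X](mulr0 (- 2^-1)).
rewrite (_ : (fun w => _) = (fun w => - 2^-1 * (ln (a ^+ 2 + (w - b) ^+ 2) - ln (a ^+ 2 + (- w -
  b) ^+ 2)))); last first.
  by apply/funext => w; rewrite mulrBr.
apply: cvgMr; apply: (@decay_cvg0 _ (16 * b ^+ 2 * M ^+ 2)) => w.
rewrite -real_normK ?num_real //.
apply: (@le_trans _ _ ((`|4 * w * b| * (M / (1 + w ^+ 2))) ^+ 2)).
  by rewrite ler_pXn2r ?nnegrE ?normr_ge0 // (le_trans _ (key w)) ?normr_ge0.
rewrite exprMn real_normK ?num_real //.
have p1 := one_plus_sqr_gt0 w.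
rewrite ler_pdivlMr //.
rewrite [leLHS](_ : _ = 16 * b ^+ 2 * M ^+ 2 * (w ^+ 2 / (1 + w ^+ 2))); last first.
  by field; rewrite gt_eqF.
rewrite ler_piMr //; first by rewrite mulr_ge0 ?sqr_ge0 // mulr_ge0 ?sqr_ge0.
by rewrite ler_pdivrMr // mul1r lerDr.
Unshelve. all: by end_near. Qed.

(** Linear combinations of (i w - p)^-m with Re p < 0 and m > 0. Defining the
    span inductively on functions avoids computing residues. *)
Inductive partial_fractions : (R -> C) -> Prop :=
| partial_fractions_0 : partial_fractions (fun=> 0)
| partial_fractions_S c p m g : complex.Re p < 0 -> partial_fractions g ->
    partial_fractions (fun w => c * simple_pole p w ^+ m.+1 + g w).

Lemma partial_fractionsD g g' : partial_fractions g -> partial_fractions g' ->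
  partial_fractions (fun w => g w + g' w).
Proof.
move=> hg hg'; elim: hg => [|c p m {}g hp _ IH].
  by rewrite (_ : (fun w => _) = g') //; apply/funext => w; rewrite add0r.
rewrite (_ : (fun w => _) = (fun w => c * simple_pole p w ^+ m.+1 + (g w + g' w))).
  exact: partial_fractions_S.
by apply/funext => w; rewrite addrA.
Qed.

Lemma partial_fractionsZ k g : partial_fractions g -> partial_fractions (fun w => k * g w).
Proof.
elim=> [|c p m {}g hp _ IH].
  by rewrite (_ : (fun w => _) = (fun=> 0)); [exact: partial_fractions_0|apply/funext => w;
    rewrite mulr0].
rewrite (_ : (fun w => _) = (fun w => k * c * simple_pole p w ^+ m.+1 + k * g w)).
  exact: partial_fractions_S.
by apply/funext => w; rewrite mulrDr mulrA.
Qed.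

Lemma partial_fractions1 p m : complex.Re p < 0 ->
  partial_fractions (fun w => simple_pole p w ^+ m.+1).
Proof.
move=> hp; have := partial_fractions_S 1 m hp partial_fractions_0; congr partial_fractions.
by apply/funext => w; rewrite mul1r addr0.
Qed.

Lemma iw_sub_neq0 p w : complex.Re p < 0 -> iw w - p != 0.
Proof.
case: p => a b /= a0; apply/eqP => -[/eqP]; rewrite sub0r oppr_eq0 => /eqP ae.
by move: a0; rewrite ae ltxx.
Qed.

(** The partial fraction identity for two distinct poles; it drives the
    reduction of products to the span. *)
Lemma simple_pole_mul p q w : complex.Re p < 0 -> complex.Re q < 0 -> p != q ->
  simple_pole p w * simple_pole q w = (p - q)^-1 * (simple_pole p w - simple_pole q w).
Proof.
move=> hp hq pq; rewrite /simple_pole; have := iw_sub_neq0 w hp; have := iw_sub_neq0 w hq.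
have : p - q != 0 by rewrite subr_eq0.
move: (iw w) => s h1 h2 h3; field.
by rewrite h1 h2 h3.
Qed.

(** Multiplying a pole factor by another one raises the relative degree to two;
    the pi contributions of the simple poles then cancel. *)
Lemma partial_fractions_div q m p : complex.Re p < 0 -> complex.Re q < 0 ->
  partial_fractions (fun w => simple_pole p w ^+ m.+1 * simple_pole q w) /\
  principal_value (fun w => simple_pole p w ^+ m.+1 * simple_pole q w) 0.
Proof.
move=> hp hq; have [->|pq] := eqVneq p q.
  rewrite (_ : (fun w => _) = (fun w => simple_pole q w ^+ m.+2)); last first.
    by apply/funext => w; rewrite -exprSr.
  by split; [exact: partial_fractions1|exact: principal_value_simple_poleX].
elim: m => [|m [IH1 IH2]].
  rewrite (_ : (fun w => _) = (fun w => (p - q)^-1 * (simple_pole p w + (-1) * simple_pole q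
    w))); last first.
    by apply/funext => w; rewrite expr1 simple_pole_mul // mulN1r.
  split.
    apply/partial_fractionsZ/partial_fractionsD; last apply/partial_fractionsZ.
      exact: (partial_fractions1 0).
    exact: (partial_fractions1 0).
  rewrite -[X in principal_value _ X](mulr0 (p - q)^-1) -[X in principal_value _ (_ * X)](subrr
    1) -[X in principal_value _ (_ * (_ + X))]mulN1r.
  by apply/principal_valueZ/principal_valueD;
    [exact: principal_value_simple_pole|apply: principal_valueZ;
    exact: principal_value_simple_pole].
rewrite (_ : (fun w => _) = (fun w => (p - q)^-1 * (simple_pole p w ^+ m.+2 + (-1) *
  (simple_pole p w ^+ m.+1 * simple_pole q w)))); last first.
  apply/funext => w; rewrite exprSr -mulrA simple_pole_mul // mulrCA; congr (_ * _).
  by rewrite mulN1r mulrBr -exprSr.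
split.
  by apply/partial_fractionsZ/partial_fractionsD;
    [exact: partial_fractions1|apply: partial_fractionsZ].
rewrite -[X in principal_value _ X](mulr0 (p - q)^-1) -[X in principal_value _ (_ * X)](addr0 0)
  -[X in principal_value _ (_ * (_ + X))](mulr0 (-1)).
by apply/principal_valueZ/principal_valueD;
  [exact: principal_value_simple_poleX|apply: principal_valueZ].
Qed.

Lemma partial_fractions_divr q g : complex.Re q < 0 -> partial_fractions g ->
  partial_fractions (fun w => g w * simple_pole q w) /\ principal_value (fun w => g w *
    simple_pole q w) 0.
Proof.
move=> hq; elim=> [|c p m {}g hp _ [IH1 IH2]].
  rewrite (_ : (fun w => _) = (fun=> 0)); last by apply/funext => w; rewrite mul0r.
  split; first exact: partial_fractions_0.
  have := principal_valueZ 0 (principal_value_simple_pole hq); rewrite mul0r;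
    congr principal_value; apply/funext => w; by rewrite mul0r.
rewrite (_ : (fun w => _) = (fun w => c * (simple_pole p w ^+ m.+1 * simple_pole q w) + g w *
  simple_pole q w)); last first.
  by apply/funext => w; rewrite mulrDl mulrA.
have [h1 h2] := partial_fractions_div m hp hq.
split; first by apply: partial_fractionsD => //; apply: partial_fractionsZ.
by rewrite -[X in principal_value _ X]addr0 -[X in principal_value _ (X + _)](mulr0 c);
  apply/principal_valueD => //; apply: principal_valueZ.
Qed.

Lemma partial_fractions_nice g : partial_fractions g -> Ccont g /\ decay g.
Proof.
elim=> [|c p m {}g hp _ [IH1 IH2]].
  split; first exact: Ccont_cst.
  by exists 0 => w; rewrite /normsq /= expr0n addr0 mul0r.
split.
  by apply: CcontD IH1; apply: CcontM; [exact: Ccont_cst|exact: Ccont_simple_poleX].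
by apply: decayD IH2; apply/decayZ/decay_simple_poleX.
Qed.

(** Induction on the poles: subtracting a multiple of the product h of the
    remaining factors makes the numerator one degree smaller, so that division
    by h falls under the induction hypothesis, and the subtracted part is a
    single simple pole. *)
Lemma partial_fractions_prod (ps : seq C) (N : {poly C}) :
  {in ps, forall p, complex.Re p < 0} -> (size N <= size ps)%N ->
  partial_fractions (fun w => N.[iw w] / (\prod_(p <- ps) ('X - p%:P)).[iw w]).
Proof.
elim: ps N => [|q ps IH] N hps sz.
  rewrite (_ : (fun w => _) = (fun=> 0)); first exact: partial_fractions_0.
  move: sz; rewrite leqn0 size_poly_eq0 => /eqP ->.
  by apply/funext => w; rewrite horner0 mul0r.
have hq : complex.Re q < 0 by apply: hps; rewrite mem_head.
have hps' : {in ps, forall p, complex.Re p < 0}.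
  by move=> p pin; apply: hps; rewrite in_cons pin orbT.
set h := \prod_(p <- ps) ('X - p%:P).
have hm : h \is monic by exact: monic_prod_XsubC.
have hs : size h = (size ps).+1 by rewrite size_prod_XsubC.
set c := N`_(size ps).
have hz w : h.[iw w] != 0.
  apply/negP => rt; have : root h (iw w) by [].
  by rewrite root_prod_XsubC => /hps'; rewrite ltxx.
have szN : (size (N - c *: h)%R <= size ps)%N.
  apply/leq_sizeP => j; rewrite leq_eqVlt => /orP[/eqP <-|lt].
    rewrite coefB coefZ; have /eqP := hm; rewrite lead_coefE hs /= => ->.
    by rewrite mulr1 subrr.
  rewrite coefB coefZ [N`_j]nth_default ?[h`_j]nth_default ?mulr0 ?subr0 ?hs //.
  exact: leq_trans sz _.
have [pf _] := partial_fractions_divr hq (IH _ hps' szN).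
have := partial_fractionsD (partial_fractionsZ c (partial_fractions1 0 hq)) pf.
congr partial_fractions; apply/funext => w.
rewrite big_cons -/h hornerM hornerXsubC hornerD hornerN hornerZ expr1 /simple_pole.
have := hz w; have := iw_sub_neq0 w hq.
move: (iw w - q) (h.[_]) (N.[_]) => x y z x0 y0; field.
by rewrite x0 y0.
Qed.

Lemma stable_frac_partial_fractions (f : ratfun R) : stable_frac 1 f ->
  partial_fractions (fun w => reval f (iw w)).
Proof.
move=> [N [d [fE [d0 /(_ isT) hd] sz]]].
have [rs dE] := closed_field_poly_normal (to_cpoly d).
have dc0 : to_cpoly d != 0 by rewrite map_poly_eq0.
have l0 : lead_coef (to_cpoly d) != 0 by rewrite lead_coef_eq0.
have szd : size (to_cpoly d) = size d by rewrite size_map_poly.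
have hrs : {in rs, forall p, complex.Re p < 0}.
  move=> p pin; apply: hd; rewrite dE rootZ // root_prod_XsubC //.
have szN : (size ((lead_coef (to_cpoly d))^-1 *: to_cpoly N)%R <= size rs)%N.
  apply: leq_trans (size_scale_leq _ _) _; rewrite size_map_poly.
  move: sz; rewrite -szd dE size_scale // size_prod_XsubC addn1 ltnS //.
have := partial_fractions_prod hrs szN; congr partial_fractions.
apply/funext => w; rewrite (revalE _ fE) ?Hurwitz_poly_im //.
by rewrite [in RHS]dE !hornerZ invfM [RHS]mulrCA mulrA.
Qed.

End ImaginaryAxis.

(** * Integrals over the imaginary axis *)

Section LineIntegrals.
Import numFieldNormedType.Exports.
Local Open Scope classical_set_scope.
Local Open Scope ring_scope.
Context {R : realType}.
Notation mu := (@lebesgue_measure R).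
Implicit Types (f : R -> R) (g : R -> R[i]).

Lemma continuous_EFin_measurable f : continuous f -> measurable_fun setT (EFin \o f).
Proof. by move=> cf; apply/measurable_EFinP; exact: continuous_measurable_fun. Qed.

Lemma oneDsqrV_integrable : mu.-integrable setT (EFin \o (fun w : R => (1 + w ^+ 2)^-1)).
Proof.
have c : continuous (fun w : R => (1 + w ^+ 2)^-1) by exact: continuous_oneDsqrV.
apply/integrableP; split; first exact: continuous_EFin_measurable.
under eq_integral do rewrite /= ger0_norm ?invr_ge0 ?(ltW (one_plus_sqr_gt0 _)) //.
rewrite ge0_symfun_integralT //; last 2 first.
- by move=> w; rewrite invr_ge0 ltW ?one_plus_sqr_gt0.
- by move=> w /=; rewrite sqrrN.
rewrite -set_itvcy (@integral0y_oneDsqr R).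
by rewrite -EFinM ltry.
Qed.

Lemma decay_integrable f (M : R) : continuous f ->
  (forall w, `|f w| <= M / (1 + w ^+ 2)) -> mu.-integrable setT (EFin \o f).
Proof.
move=> cf hf.
have h : mu.-integrable setT (fun w : R => M%:E * ((1 + w ^+ 2)^-1)%R%:E)%E.
  by apply: integrableZl => //; exact: oneDsqrV_integrable.
apply: le_integrable h => //; first exact: continuous_EFin_measurable.
move=> w _; change ((`|f w|)%:E <= (`|M * (1 + w ^+ 2)^-1|)%:E)%E.
by rewrite lee_fin; apply: le_trans (hf w) (ler_norm _).
Qed.

(** Dominated convergence applied to the restrictions to [-n, n], whose
    integrals are given by the fundamental theorem of calculus. *)
Lemma symmetric_primitive_integral f (M : R) (G : R -> R) : continuous f ->
  (forall w, `|f w| <= M / (1 + w ^+ 2)) ->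
  (forall w : R, is_derive w 1 G (f w)) ->
  (fun w : R => G w - G (- w)) @ +oo --> (0 : R) ->
  (\int[mu]_(w in setT) (f w)%:E = 0)%E.
Proof.
move=> cf hf dG limG.
have intf := decay_integrable cf hf.
pose F n : R -> \bar R := (EFin \o f) \_ `[- n%:R, n%:R].
have cG : continuous G.
  move=> w; apply: differentiable_continuous; apply/derivable1_diffP.
  by have h := dG w; exact: ex_derive.
have FE n : (\int[mu]_(w in setT) F n.+1 w = (G n.+1%:R - G (- n.+1%:R))%:E)%E.
  rewrite /F -integral_mkcond (@continuous_FTC2 _ f G) ?EFinB //.
  - by rewrite gtrN ?ltr0n.
  - by apply: continuous_subspaceT => x; exact: cf.
  - split.
    + by move=> x _; have h := dG x; exact: ex_derive.
    + by apply: cvg_at_right_filter; exact: cG.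
    + by apply: cvg_at_left_filter; exact: cG.
  - by move=> x _; rewrite derive1E; have h := dG x; exact: derive_val.
have mF n : measurable_fun setT (F n).
  apply/(measurable_restrictT _ _).1 => //.
  by apply: measurable_funTS; exact: continuous_EFin_measurable.
have cvF : {ae mu, forall w, setT w -> F ^~ w @ \oo --> (EFin \o f) w}.
  apply/aeW => w _; apply: cvg_near_cst.
  near=> n; rewrite /F patchE mem_set //= in_itv /= -ler_norml.
  by near: n; exact: nbhs_infty_ger.
have intnf : mu.-integrable setT (fun w => (`|f w|)%:E).
  by have := integrable_abse intf.
have leF : {ae mu, forall w n, setT w -> (`|F n w| <= (`|f w|)%:E)%E}.
  apply/aeW => w n _; rewrite /F patchE; case: ifP => _ //=.
  by rewrite normr0 lee_fin.
have [_ _ cv] := @dominated_convergence _ _ _ mu setT measurableT F (EFin \o f) _ mF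
  (continuous_EFin_measurable cf) cvF intnf leF.
have cv2 : (\int[mu]_(w in setT) F n.+1 w)%E @[n --> \oo] --> (0%:E : \bar R).
  under eq_fun do rewrite FE.
  apply: cvg_EFin; first by apply: nearW.
  apply: (@cvg_comp _ _ _ (fun n : nat => n.+1%:R : R) (fun w => G w - G (- w)) _ _ _ _ limG).
  apply/cvgryPge => A; near=> n.
  apply: (@le_trans _ _ n%:R); last by rewrite ler_nat.
  by near: n; exact: nbhs_infty_ger.
have cv1 : (\int[mu]_(w in setT) F n.+1 w)%E @[n --> \oo] --> (\int[mu]_(w in setT) (f w)%:E)%E.
  by have := cv; rewrite -(cvg_shiftS).
exact: (cvg_unique _ cv1 cv2).
Unshelve. all: by end_near. Qed.

Lemma integral_pos_cst_infty (c : R) : 0 < c -> (\int[mu]_(w in setT) c%:E = +oo)%E.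
Proof.
move=> c0; rewrite integral_cst //.
have e : (lebesgue_measure [set: R] = +oo)%E.
  by have := lebesgue_measure_itv (`]-oo, +oo[ : interval R); rewrite set_itvNyy /= => ->.
by rewrite [X in (_ * X)%E]e gt0_muley.
Qed.

(** Writing f as (s + 1) f divided by s + 1 exhibits the relative degree two of
    f as a product of two decaying factors. *)
Lemma partial_fractions_svar (f : ratfun R) :
  stable_frac 1 f -> stable_frac 1 (svar * f) ->
  partial_fractions (fun w => reval ((svar + 1) * f) (iw w)) /\
  forall w, reval f (iw w) = reval ((svar + 1) * f) (iw w) * simple_pole (-1) w.
Proof.
move=> sf ssf.
have s1 : stable_frac 1 ((svar + 1) * f) by rewrite mulrDl mul1r; exact: rel_degreeD.
split; first exact: stable_frac_partial_fractions.
move=> w; rewrite mulrDl mul1r revalD; last 2 first.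
- exact: rel_degree_sub ssf.
- exact: rel_degree_sub sf.
rewrite revalsM; last exact: rel_degree_sub sf.
rewrite -[X in _ + X]mul1r -mulrDl /simple_pole opprK mulrAC divff ?mul1r //.
by rewrite -[1]opprK; apply: iw_sub_neq0; rewrite /= ltrN10.
Qed.

Lemma ReM_le_normsq (x y : R[i]) : `|complex.Re (x * y)| <= normsq x + normsq y.
Proof.
rewrite cReM /normsq ler_norml; apply/andP.
case: x y => [a b] [c d] /=.
have := (sqr_ge0 (a + c), sqr_ge0 (a - c), sqr_ge0 (b + d), sqr_ge0 (b - d)).
case=> [[[h1 h2] h3] h4]; split; nra.
Qed.

(** Cauchy's theorem for a stable function of relative degree at least two. *)
Lemma integral_Re_reval_eq0 (f : ratfun R) :
  stable_frac 1 f -> stable_frac 1 (svar * f) ->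
  mu.-integrable setT (EFin \o (fun w => complex.Re (reval f (iw w)))) /\
  (\int[mu]_(w in setT) (complex.Re (reval f (iw w)))%:E = 0)%E.
Proof.
move=> sf ssf.
have [[cf _] _] := partial_fractions_nice (stable_frac_partial_fractions sf).
have [pf fE] := partial_fractions_svar sf ssf.
have h1 : complex.Re (-1 : R[i]) < 0 by rewrite /= ltrN10.
have [_ [M1 hM1]] := partial_fractions_nice pf.
have [M2 hM2] := decay_simple_pole h1.
have bd w : `|complex.Re (reval f (iw w))| <= (M1 + M2) / (1 + w ^+ 2).
  by rewrite fE; apply: le_trans (ReM_le_normsq _ _) _; rewrite [leRHS]mulrDl lerD.
have [_ [G dG [limG _]]] := partial_fractions_divr h1 pf.
split; first exact: decay_integrable bd.
apply: (symmetric_primitive_integral cf bd (G := fun w => complex.Re (G w))).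
  by move=> w; rewrite fE; have [] := dG w.
by move: limG; rewrite /= mulr0.
Qed.

Lemma continuous_normsq g : Ccont g -> continuous (fun w => normsq (g w)).
Proof.
move=> [c1 c2] w; rewrite /normsq; under eq_fun do rewrite !expr2.
exact: (cvgD (cvgM (c1 w) (c1 w)) (cvgM (c2 w) (c2 w))).
Qed.

Lemma integrable_normsq_reval (f : ratfun R) : stable_frac 1 f ->
  mu.-integrable setT (EFin \o (fun w => normsq (reval f (iw w)))).
Proof.
move=> sf.
have [cf [M hM]] := partial_fractions_nice (stable_frac_partial_fractions sf).
apply: (@decay_integrable _ M); last by move=> w; rewrite ger0_norm ?normsq_ge0.
exact: continuous_normsq.
Qed.

(** The constant is the value at infinity. *)
Lemma stable_frac_const_part (f : ratfun R) : stable_frac 0 f ->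
  exists (c : R) (f1 : ratfun R), stable_frac 1 f1 /\ f = tofr c%:P + f1.
Proof.
move=> [N [d [fE [d0 hd] sz]]].
set c := N`_(size d).-1 / lead_coef d.
have l0 : lead_coef d != 0 by rewrite lead_coef_eq0.
exists c, (tofr (N - c *: d) / tofr d); split.
  exists (N - c *: d), d; split=> //; rewrite addn1.
  have sd : (0 < size d)%N by rewrite size_poly_gt0.
  rewrite -(prednK sd) ltnS; apply/leq_sizeP => j.
  rewrite leq_eqVlt => /orP[/eqP <-|lt].
    by rewrite coefB coefZ -lead_coefE /c divfK // subrr.
  rewrite addn0 in sz; rewrite prednK // in lt.
  rewrite coefB coefZ [N`_j]nth_default ?[d`_j]nth_default ?mulr0 ?subr0 //.
  exact: leq_trans sz _.
rewrite fE tofracB -mul_polyC tofracM mulrBl mulfK ?tofrac_eq0 //.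
by rewrite addrC subrK.
Qed.

Lemma continuous_normsq_reval (f : ratfun R) : stable_frac 0 f ->
  continuous (fun w => normsq (reval f (iw w))).
Proof.
move=> /stable_frac_const_part[c [f1 [sf1 ->]]].
have [pc _] := partial_fractions_nice (stable_frac_partial_fractions sf1).
have cf := CcontD (Ccont_cst (real_complex R c)) pc.
rewrite (_ : (fun w => _) = (fun w => normsq (real_complex R c + reval f1 (iw w)))).
  exact: continuous_normsq.
apply/funext => w; rewrite revalD ?reval_const //.
  exact: rel_degree_const.
exact: rel_degree_sub sf1.
Qed.

(** A nonzero value c at infinity would make c^2, which is at most twice the
    sum of the squared moduli of f and of its strictly proper part, integrable
    over the line. *)
Lemma finite_energy_strictly_proper (f : ratfun R) : stable_frac 0 f ->
  (\int[mu]_(w in setT) (normsq (reval f (iw w)))%:E < +oo)%E -> stable_frac 1 f.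
Proof.
move=> sf0 fin.
have mf := continuous_EFin_measurable (continuous_normsq_reval sf0).
have [c [f1 [sf1 fE]]] := stable_frac_const_part sf0.
have [c0|c0] := eqVneq c 0.
  by rewrite fE c0 polyC0 tofrac0 add0r.
exfalso.
have sf1' := rel_degree_sub sf1.
have /integrableP[m1 fin1] := integrable_normsq_reval sf1.
have le w : ((c ^+ 2)%:E <= 2%:E * ((normsq (reval f (iw w)))%:E + (normsq (reval f1 (iw
  w)))%:E))%E.
  rewrite -EFinD -EFinM lee_fin fE revalD //; last exact: rel_degree_const.
  rewrite reval_const; case: (reval f1 _) => [a b]; rewrite /normsq /=.
  rewrite add0r; have := sqr_ge0 (c + 2 * a); have := sqr_ge0 b; nra.
have c2 : 0 < c ^+ 2 by rewrite exprn_even_gt0.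
have := integral_pos_cst_infty c2.
apply/eqP; rewrite lt_eqF //.
apply: le_lt_trans (_ : (\int[mu]_(w in setT) (2%:E * ((normsq (reval f (iw w)))%:E + (normsq
  (reval f1 (iw w)))%:E)))%E < +oo)%E.
  apply: ge0_le_integral => //.
  - by move=> w _; rewrite lee_fin ltW.
  - by apply: measurable_funeM; apply: emeasurable_funD.
rewrite ge0_integralZl //; last 2 first.
- by apply: emeasurable_funD.
- by move=> w _; rewrite -EFinD lee_fin addr_ge0 ?normsq_ge0.
rewrite ge0_integralD //; last 2 first.
- by move=> w _; rewrite lee_fin normsq_ge0.
- by move=> w _; rewrite lee_fin normsq_ge0.
rewrite lte_mul_pinfty ?lee_fin //.
apply: lte_add_pinfty fin _; apply: le_lt_trans fin1.
rewrite le_eqVlt; apply/orP; left; apply/eqP.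
by apply: eq_integral => w _; rewrite /= ger0_norm ?normsq_ge0.
Qed.

End LineIntegrals.

(** * Transfer matrices and resolvents *)

Section ResolventAt.
Context {K : fieldType} (s : K).

Definition resolvent_at {n} (A : 'M[K]_n) := invmx (s%:M - A).

Lemma resolvent_at_solves n c (A : 'M[K]_n) (N : 'M[K]_(n, c)) : s%:M - A \in unitmx ->
  s *: (resolvent_at A *m N) = A *m (resolvent_at A *m N) + N.
Proof.
move=> u; have := congr1 (mulmx^~ N) (mulmxV u).
rewrite mul1mx -mulmxA mulmxBl mul_scalar_mx => /eqP.
by rewrite subr_eq [N + _]addrC => /eqP.
Qed.

Lemma resolvent_at_uniq n c (A : 'M[K]_n) (Y N : 'M[K]_(n, c)) : s%:M - A \in unitmx ->
  s *: Y = A *m Y + N -> Y = resolvent_at A *m N.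
Proof.
move=> u h; rewrite (_ : N = (s%:M - A) *m Y).
  by rewrite mulmxA mulVmx // mul1mx.
by rewrite mulmxBl mul_scalar_mx h addrAC subrr add0r.
Qed.

End ResolventAt.

Section TransferMatrices.
Context {R : realType}.
Notation K := (ratfun R).

Lemma lift_mxM a b c (M : 'M[R]_(a, b)) (N : 'M[R]_(b, c)) :
  lift_mx (M *m N) = lift_mx M *m lift_mx N.
Proof. exact: (@map_mxM _ _ (tofr \o polyC)). Qed.

Lemma lift_mxD a b (M N : 'M[R]_(a, b)) : lift_mx (M + N) = lift_mx M + lift_mx N.
Proof. exact: (@map_mxD _ _ (tofr \o polyC)). Qed.

Lemma lift_mxB a b (M N : 'M[R]_(a, b)) : lift_mx (M - N) = lift_mx M - lift_mx N.
Proof. exact: (@map_mxB _ _ (tofr \o polyC)). Qed.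

Lemma lift_mxN a b (M : 'M[R]_(a, b)) : lift_mx (- M) = - lift_mx M.
Proof. exact: (@map_mxN _ _ (tofr \o polyC)). Qed.

Lemma lift_mx0 a b : lift_mx (0 : 'M[R]_(a, b)) = 0.
Proof. exact: (@map_mx0 _ _ (tofr \o polyC)). Qed.

Lemma lift_mx1 a : lift_mx (1%:M : 'M[R]_a) = 1%:M.
Proof. exact: (@map_mx1 _ _ (tofr \o polyC)). Qed.

Lemma lift_mx_tr a b (M : 'M[R]_(a, b)) : lift_mx M^T = (lift_mx M)^T.
Proof. by rewrite /lift_mx map_trmx. Qed.

Lemma rel_degree_sum (b : bool) k (I : finType) (f : I -> K) :
  (forall i, rel_degree b k (f i)) -> rel_degree b k (\sum_i f i).
Proof.
move=> hf; elim/big_ind: _ => [|f1 f2|i _]; [exact: rel_degree0|exact: rel_degreeD|exact: hf].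
Qed.

Lemma reval_sum (I : finType) (f : I -> K) (w : R) : (forall i, stable_frac 0 (f i)) ->
  reval (\sum_i f i) (iw w) = \sum_i reval (f i) (iw w).
Proof.
move=> hf.
suff [_ ->] : stable_frac 0 (\sum_i f i) /\
    reval (\sum_i f i) (iw w) = \sum_i reval (f i) (iw w) by [].
elim/big_rec2: _ => [|i y1 y2 _ [h1 h2]].
  by split; [exact: rel_degree0|exact: reval0].
by split; [exact: rel_degreeD|rewrite revalD // h2].
Qed.

Definition rel_degree_mx (b : bool) (k : nat) {a c} (M : 'M[K]_(a, c)) :=
  forall i j, rel_degree b k (M i j).

Lemma rel_degree_mxD b k a c (M N : 'M[K]_(a, c)) : rel_degree_mx b k M ->
  rel_degree_mx b k N -> rel_degree_mx b k (M + N).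
Proof. by move=> hM hN i j; rewrite mxE; exact: rel_degreeD. Qed.

Lemma rel_degree_mxM b k k' a c e (M : 'M[K]_(a, c)) (N : 'M[K]_(c, e)) :
  rel_degree_mx b k M -> rel_degree_mx b k' N -> rel_degree_mx b (k + k') (M *m N).
Proof.
move=> hM hN i j; rewrite mxE; apply: rel_degree_sum => t; exact: rel_degreeM.
Qed.

Lemma rel_degree_mx_lift b a c (M : 'M[R]_(a, c)) : rel_degree_mx b 0 (lift_mx M).
Proof. by move=> i j; rewrite mxE; exact: rel_degree_const. Qed.

Lemma rel_degree_mx_sub b k a c (M : 'M[K]_(a, c)) : rel_degree_mx b k M -> rel_degree_mx b 0 M.
Proof. by move=> hM i j; exact: rel_degree_sub (hM i j). Qed.

Lemma rel_degree_mx_liftl b k a c e (M : 'M[R]_(a, c)) (N : 'M[K]_(c, e)) :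
  rel_degree_mx b k N -> rel_degree_mx b k (lift_mx M *m N).
Proof. by move=> hN; have := rel_degree_mxM (@rel_degree_mx_lift b _ _ M) hN. Qed.

Lemma rel_degree_mx_liftr b k a c e (M : 'M[K]_(a, c)) (N : 'M[R]_(c, e)) :
  rel_degree_mx b k M -> rel_degree_mx b k (M *m lift_mx N).
Proof. by move=> hM; have := rel_degree_mxM hM (@rel_degree_mx_lift b _ _ N); rewrite addn0. Qed.

Lemma rel_degree_mx1 b a : rel_degree_mx b 0 (1%:M : 'M[K]_a).
Proof. by rewrite -lift_mx1; exact: rel_degree_mx_lift. Qed.

Lemma rel_degree_mxN b k a c (M : 'M[K]_(a, c)) : rel_degree_mx b k M -> rel_degree_mx b k (- M).
Proof.
by move=> hM; rewrite -[- M]mul1mx mulmxN -mulNmx -lift_mx1 -lift_mxN; exact: rel_degree_mx_liftl.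
Qed.

Lemma RHinftyP a c (G : 'M[K]_(a, c)) : RHinfty G <-> rel_degree_mx true 0 G.
Proof. by split=> h i j; apply/stable_fracP; exact: h. Qed.

Lemma size_signed (b : bool) (q : {poly R}) : size ((-1) ^+ b * q) = size q.
Proof. by case: b; rewrite ?expr0 ?expr1 ?mulN1r ?mul1r ?size_polyN. Qed.

(** Each term of the Leibniz formula is a product of m factors of degree at
    most one. *)
Lemma size_det_leq m (M : 'M[{poly R}]_m) :
  (forall i j, (size (M i j) <= 2)%N) -> (size (\det M) <= m.+1)%N.
Proof.
move=> hM; rewrite /determinant; apply: leq_trans (size_sum _ _ _) _.
apply/bigmax_leqP => s _; rewrite size_signed.
apply: leq_trans (size_prod_leq _ _) _; rewrite cardT size_enum_ord.
rewrite leq_subLR addnS ltnS.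
apply: (@leq_trans (\sum_(i < m) 2)%N); first by apply: leq_sum => i _; exact: hM.
by rewrite sum_nat_const card_ord muln2 addnn.
Qed.

Section Resolvent.
Context {n : nat} (A : 'M[R]_n).

Lemma resolvent_charE : svar%:M - lift_mx A = map_mx tofr (char_poly_mx A).
Proof.
by rewrite /char_poly_mx map_mxB map_scalar_mx -map_mx_comp.
Qed.

Lemma resolvent_det : \det (svar%:M - lift_mx A) = tofr (char_poly A).
Proof. by rewrite resolvent_charE det_map_mx. Qed.

Lemma resolvent_unit : svar%:M - lift_mx A \in unitmx.
Proof.
rewrite unitmxE resolvent_det unitfE tofrac_eq0.
exact/monic_neq0/char_poly_monic.
Qed.

Lemma mul_resolvent : (svar%:M - lift_mx A) *m resolvent A = 1%:M.
Proof. exact: mulmxV resolvent_unit. Qed.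

Lemma resolvent_solves c (N : 'M[K]_(n, c)) :
  svar *: (resolvent A *m N) = lift_mx A *m (resolvent A *m N) + N.
Proof. exact (@resolvent_at_solves _ svar _ _ (lift_mx A) N resolvent_unit). Qed.

Lemma resolvent_uniq c (Y N : 'M[K]_(n, c)) :
  svar *: Y = lift_mx A *m Y + N -> Y = resolvent A *m N.
Proof. exact (@resolvent_at_uniq _ svar _ _ (lift_mx A) Y N resolvent_unit). Qed.

(** By Cramer's rule the entries are cofactors over the characteristic
    polynomial, whose roots are the eigenvalues. *)
Lemma resolvent_rel_degree (b : bool) : (b -> Hurwitz A) -> rel_degree_mx b 1 (resolvent A).
Proof.
move=> hA i j; rewrite /resolvent /invmx resolvent_unit mxE resolvent_det resolvent_charE.
rewrite -map_mx_adj mxE.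
exists (\adj (char_poly_mx A) i j), (char_poly A); split.
- by rewrite mulrC.
- split; first exact/monic_neq0/char_poly_monic.
  move=> /hA hu z rz; apply: hu.
  by rewrite eigenvalue_root_char -map_char_poly.
rewrite size_char_poly addn1 ltnS mxE /cofactor.
have n0 : (0 < n)%N by apply: leq_ltn_trans (ltn_ord i).
rewrite -signr_odd size_signed.
rewrite -[X in (_ <= X)%N](prednK n0); apply: size_det_leq => a c; rewrite !mxE.
apply: leq_trans (size_polyD _ _) _; rewrite geq_max size_polyN.
rewrite (leq_trans (size_polyC_leq1 _)) // andbT.
by case: eqP => _; rewrite ?mulr1n ?mulr0n ?size_polyX ?size_poly0.
Qed.

End Resolvent.

Lemma tf_proper k a b (A : 'M[R]_k) (B : 'M[R]_(k, b)) (C : 'M[R]_(a, k))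
  (D : 'M[R]_(a, b)) : proper_mx (tf A B C D).
Proof.
have h : rel_degree_mx false 0 (tf A B C D).
  apply: rel_degree_mxD (rel_degree_mx_lift _ _); apply: rel_degree_mx_liftr;
    apply: rel_degree_mx_liftl.
  by apply: rel_degree_mx_sub; apply: resolvent_rel_degree.
by move=> i j; exact: rel_degree_proper (h i j).
Qed.

Definition freq_resp (w : R) {a c} (M : 'M[K]_(a, c)) : 'M[R[i]]_(a, c) :=
  map_mx (fun f => reval f (iw w)) M.

Lemma freq_respD w a c (M N : 'M[K]_(a, c)) : rel_degree_mx true 0 M -> rel_degree_mx true 0 N ->
  freq_resp w (M + N) = freq_resp w M + freq_resp w N.
Proof. by move=> hM hN; apply/matrixP => i j; rewrite !mxE revalD. Qed.

Lemma freq_respM w a c e (M : 'M[K]_(a, c)) (N : 'M[K]_(c, e)) :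
  rel_degree_mx true 0 M -> rel_degree_mx true 0 N ->
    freq_resp w (M *m N) = freq_resp w M *m freq_resp w N.
Proof.
move=> hM hN; apply/matrixP => i j; rewrite !mxE reval_sum => [|k].
  by apply: eq_bigr => k _; rewrite !mxE revalM.
exact: (rel_degreeM (hM i k) (hN k j)).
Qed.

Lemma freq_resp_lift w a c (M : 'M[R]_(a, c)) : freq_resp w (lift_mx M) = map_mx (real_complex R) M.
Proof. by apply/matrixP => i j; rewrite !mxE reval_const. Qed.

Lemma freq_resp_svar w a c (M : 'M[K]_(a, c)) : rel_degree_mx true 0 M ->
  freq_resp w (svar *: M) = iw w *: freq_resp w M.
Proof. by move=> hM; apply/matrixP => i j; rewrite !mxE; apply: revalsM; exact: hM. Qed.

End TransferMatrices.

(** * Riccati equations and stability *)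

Section Riccati.
Context {R : realType}.
Notation cm := (map_mx (real_complex R)).

Lemma posdef_ge0 k (M : 'M[R]_k) (v : 'cV[R]_k) : posdef M -> 0 <= (v^T *m M *m v) 0 0.
Proof.
move=> [_ hM]; have [->|v0] := eqVneq v 0; last exact/ltW/hM.
by rewrite mulmx0 mxE.
Qed.

Lemma posdef_eq0 k (M : 'M[R]_k) (v : 'cV[R]_k) : posdef M -> (v^T *m M *m v) 0 0 = 0 -> v = 0.
Proof. by move=> [_ hM] h; apply/eqP; apply: contra_eqT h => /hM /gt_eqF ->. Qed.

Lemma posdef_unit k (M : 'M[R]_k) : posdef M -> M \in unitmx.
Proof.
move=> [Ms hM]; rewrite -row_free_unit -kermx_eq0; apply/eqP/row_matrixP => i.
rewrite row0; set v := row i _.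
have vM : v *m M = 0 by apply/sub_kermxP; exact: row_sub.
apply: trmx_inj; rewrite trmx0; apply: (posdef_eq0 (M := M)) => //.
by rewrite trmxK vM mul0mx mxE.
Qed.

Lemma gram_ge0 k l (C : 'M[R]_(l, k)) (v : 'cV[R]_k) : 0 <= (v^T *m (C^T *m C) *m v) 0 0.
Proof.
rewrite mulmxA -trmx_mul -mulmxA mxE; apply: sumr_ge0 => i _.
by rewrite mxE -expr2 sqr_ge0.
Qed.

Lemma gram_eq0 k l (C : 'M[R]_(l, k)) (v : 'cV[R]_k) :
  (v^T *m (C^T *m C) *m v) 0 0 = 0 -> C *m v = 0.
Proof.
rewrite mulmxA -trmx_mul -mulmxA mxE => h; apply/matrixP => i j; rewrite ord1 [RHS]mxE.
have sq k0 : 0 <= (C *m v)^T 0 k0 * (C *m v) k0 0 by rewrite mxE -expr2 sqr_ge0.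
have /eqP : (C *m v)^T 0 i * (C *m v) i 0 = 0 := psumr_eq0P (fun k0 _ => sq k0) h isT.
by rewrite mxE -expr2 sqrf_eq0 => /eqP.
Qed.

(** The Popov-Belevitch-Hautus condition. Unlike the existence of a stabilizing
    feedback, it visibly passes to block triangular systems. *)
Definition hautus {n m} (A : 'M[R]_n) (B : 'M[R]_(n, m)) :=
  forall (z : R[i]) (v : 'rV[R[i]]_n), 0 <= complex.Re z ->
    v *m cm A = z *: v -> v *m cm B = 0 -> v = 0.

Lemma stabilizable_hautus n m (A : 'M[R]_n) (B : 'M[R]_(n, m)) : stabilizable A B -> hautus A B.
Proof.
move=> [L hL] z v z0 vA vB; apply/eqP; apply: contraTT z0 => v0.
rewrite -ltNge; apply: hL; apply/eigenvalueP; exists v => //.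
by rewrite map_mxD map_mxM mulmxDr mulmxA vB mul0mx addr0.
Qed.

(** If v is a left eigenvector killed by B and i is its last nonzero block, then
    by triangularity block i is such a vector for the diagonal pair (A_ii, B_ii).
    The induction on q - i runs from the last block down. *)
Lemma hautus_block q (d e : 'I_q -> nat) (A : 'M[R]_(\sum_i d i))
  (B : 'M[R]_(\sum_i d i, \sum_i e i)) :
  (forall i j : 'I_q, (i < j)%N -> submxblock A i j = 0) ->
  (forall i j : 'I_q, (i < j)%N -> submxblock B i j = 0) ->
  (forall i, hautus (submxblock A i i) (submxblock B i i)) -> hautus A B.
Proof.
move=> hA hB hd z v z0 vA vB.
have vMi (c : 'I_q -> nat) (M : 'M[R]_(\sum_i d i, \sum_i c i)) (i : 'I_q) :
    (forall i j : 'I_q, (i < j)%N -> submxblock M i j = 0) ->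
    (forall k : 'I_q, (i < k)%N -> submxrow v k = 0) ->
    submxrow (v *m cm M) i = submxrow v i *m cm (submxblock M i i).
  move=> hM hv.
  have subE k l : submxblock (cm M) k l = cm (submxblock M k l).
    by apply/matrixP => a b; rewrite !mxE.
  rewrite -{1}[v]submxrowK -{1}[cm M]submxblockK mul_mxrow_mxblock mxrowK.
  rewrite -subE [LHS](bigD1 i) //= [X in _ + X]big1 ?addr0 // => k ki; rewrite subE.
  move: ki; rewrite neq_ltn => /orP[ki|ki].
    by rewrite hM // map_mx0 mulmx0.
  by rewrite hv // mul0mx.
suff h (i : 'I_q) : submxrow v i = 0.
  by rewrite -[v]submxrowK; under eq_mxrow do rewrite h; exact: mxrow0.
have [N le] : exists N, (q - i <= N)%N by exists (q - i)%N.
elim: N i le => [|N IH] i le.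
  by move: le; rewrite leqn0 subn_eq0 leqNgt ltn_ord.
have hv (k : 'I_q) : (i < k)%N -> submxrow v k = 0.
  by move=> ik; apply: IH; move: (ltn_ord i) (ltn_ord k) ik le; lia.
apply: (hd i z _ z0).
  by rewrite -vMi // vA; apply/matrixP => a b; rewrite !mxE.
by rewrite -vMi // vB; apply/matrixP => a b; rewrite !mxE.
Qed.

Lemma eigenvalue_tr (F : fieldType) n (g : 'M[F]_n) z : eigenvalue g^T z = eigenvalue g z.
Proof.
rewrite !eigenvalue_root_char /char_poly -[X in root X _]det_tr; congr (root (\det _) z).
by apply/matrixP => i j; rewrite !mxE eq_sym.
Qed.

Lemma Re_mulmx n m c (M : 'M[R]_(n, m)) (V : 'M[R[i]]_(m, c)) :
  map_mx (@complex.Re R) (cm M *m V) = M *m map_mx (@complex.Re R) V.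
Proof.
apply/matrixP => i j; rewrite !mxE (big_morph _ (@cReD R) (erefl _)).
by apply: eq_bigr => k _; rewrite cReM !mxE /= mul0r subr0.
Qed.

Lemma Im_mulmx n m c (M : 'M[R]_(n, m)) (V : 'M[R[i]]_(m, c)) :
  map_mx (@complex.Im R) (cm M *m V) = M *m map_mx (@complex.Im R) V.
Proof.
apply/matrixP => i j; rewrite !mxE (big_morph _ (@cImD R) (erefl _)).
by apply: eq_bigr => k _; rewrite cImM !mxE /= mul0r addr0.
Qed.

Lemma complex_mx_eq0 n m (V : 'M[R[i]]_(n, m)) :
  map_mx (@complex.Re R) V = 0 -> map_mx (@complex.Im R) V = 0 -> V = 0.
Proof.
move=> /matrixP h1 /matrixP h2; apply/matrixP => i j.
by move: (h1 i j) (h2 i j); rewrite !mxE; case: (V i j) => a b /= -> ->.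
Qed.

Lemma row_lincomb n (p : 'rV[R]_n) (u v : 'cV[R]_n) (x y : R) :
  (p *m (x *: u + y *: v)) 0 0 = x * (p *m u) 0 0 + y * (p *m v) 0 0.
Proof. by rewrite mulmxDr -!scalemxAr mxE [X in X + _]mxE [X in _ + X]mxE. Qed.

Lemma complex_combination_eq0 n (p q : 'cV[R]_n) :
  cm p^T + Complex 0 1 *: cm q^T = 0 -> p = 0 /\ q = 0.
Proof.
move=> /matrixP h; split; apply/matrixP => i j; rewrite ord1 [RHS]mxE;
  have := h 0 i; rewrite !mxE => /eqP; rewrite eq_complex /= => /andP[/eqP h1 /eqP h2].
  by lra.
by lra.
Qed.

(** The Riccati equation is a Lyapunov equation for the closed loop. Tested on
    an eigenvector a + i b with eigenvalue x + i y, it reads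
    2 x (a^T X a + b^T X b) = - (nonnegative terms), so x <= 0. If x = 0, all
    terms vanish: K and C kill a and b, and then X a + i X b is a left
    eigenvector of A for - i y that is killed by B, against [hautus]. *)
Theorem riccati_Hurwitz n m l (A : 'M[R]_n) (B : 'M[R]_(n, m)) (C : 'M[R]_(l, n))
  (W : 'M[R]_m) (X : 'M[R]_n) :
  posdef X -> posdef W -> hautus A B ->
  A^T *m X + X *m A - X *m B *m invmx W *m B^T *m X + C^T *m C = 0 ->
  Hurwitz (A - B *m (invmx W *m B^T *m X)).
Proof.
move=> pX pW hAB ric; have [K KE] : exists K, K = invmx W *m B^T *m X by eexists.
rewrite -KE; set Acl := A - B *m K.
have [Xs _] := pX; have [Ws _] := pW; have Wu := posdef_unit pW.
have WK : W *m K = B^T *m X by rewrite KE !mulmxA mulmxV // mul1mx.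
have KW : K^T *m W = X *m B.
  by rewrite -[W]Ws -trmx_mul WK trmx_mul Xs trmxK.
have ricK : A^T *m X + X *m A + C^T *m C = K^T *m W *m K.
  have -> : K^T *m W *m K = X *m B *m invmx W *m B^T *m X by rewrite KW KE !mulmxA.
  by apply/eqP; rewrite -subr_eq0 addrAC ric.
have XBK : X *m B *m K = K^T *m W *m K by rewrite KW.
have KBX : K^T *m B^T *m X = K^T *m W *m K by rewrite -!mulmxA WK.
have ly : Acl^T *m X + X *m Acl = - (K^T *m W *m K) - C^T *m C.
  rewrite /Acl linearB /= trmx_mul mulmxBl mulmxBr mulmxA XBK KBX addrACA -opprD.
  by rewrite -{1}ricK; apply/eqP; rewrite -subr_eq0; apply/eqP/matrixP => i j; rewrite !mxE; ring.
(* the Lyapunov form of the Riccati equation, as a quadratic form *)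
have lyap (v : 'cV[R]_n) : ((v^T *m X *m (Acl *m v)) 0 0) *+ 2 =
    - ((K *m v)^T *m W *m (K *m v)) 0 0 - (v^T *m (C^T *m C) *m v) 0 0.
  transitivity ((v^T *m (Acl^T *m X + X *m Acl) *m v) 0 0).
    rewrite mulmxDr mulmxDl mulr2n [RHS]mxE; congr (_ + _); last by rewrite !mulmxA.
    rewrite [RHS](_ : _ = (v^T *m (Acl^T *m X) *m v)^T 0 0); last by rewrite [RHS]mxE.
    by rewrite !trmx_mul !trmxK Xs !mulmxA.
  rewrite ly mulmxBr mulmxN mulmxBl mulNmx [LHS]mxE [X in X + _]mxE [X in _ + X]mxE.
  by rewrite trmx_mul !mulmxA.
move=> z.
rewrite -eigenvalue_tr => /eigenvalueP [v vE v0].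
pose a := map_mx (@complex.Re R) v^T; pose b := map_mx (@complex.Im R) v^T.
case: z vE => x y vE /=.
have {}vE : cm Acl *m v^T = Complex x y *: v^T.
  by apply: trmx_inj; rewrite trmx_mul trmxK vE linearZ /= trmxK.
have aE : Acl *m a = x *: a - y *: b.
  by rewrite -Re_mulmx vE; apply/matrixP => i j; rewrite !mxE cReM.
have bE : Acl *m b = x *: b + y *: a.
  by rewrite -Im_mulmx vE; apply/matrixP => i j; rewrite !mxE cImM.
have ab0 : ~ (a = 0 /\ b = 0).
  case=> a0 b0; move/negP: v0; apply; apply/eqP/trmx_inj.
  by rewrite trmx0; apply: complex_mx_eq0.
have sum : x * ((a^T *m X *m a) 0 0 + (b^T *m X *m b) 0 0) *+ 2 =
  - (((K *m a)^T *m W *m (K *m a)) 0 0 + (a^T *m (C^T *m C) *m a) 0 0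
  + ((K *m b)^T *m W *m (K *m b)) 0 0 + (b^T *m (C^T *m C) *m b) 0 0).
  have := lyap a; have := lyap b; rewrite aE bE -scaleNr !row_lincomb.
  have -> : (b^T *m X *m a) 0 0 = (a^T *m X *m b) 0 0.
    rewrite [RHS](_ : _ = (a^T *m X *m b)^T 0 0); last by rewrite [RHS]mxE.
    by rewrite !trmx_mul !trmxK Xs !mulmxA.
  move=> e1 e2; rewrite !mulr2n in e1 e2 *; lra.
have pos : 0 < (a^T *m X *m a) 0 0 + (b^T *m X *m b) 0 0.
  have [pa pb] := (posdef_ge0 a pX, posdef_ge0 b pX).
  rewrite lt_neqAle addr_ge0 // andbT eq_sym; apply/eqP => e; apply: ab0.
  by split; apply: (posdef_eq0 pX); lra.
have [//|x0] := ltP x 0; exfalso.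
have [h1 h2] := (posdef_ge0 (K *m a) pW, posdef_ge0 (K *m b) pW).
have [h3 h4] := (gram_ge0 C a, gram_ge0 C b).
have {}x0 : x = 0.
  apply/eqP; rewrite eq_le x0 andbT leNgt; apply/negP => xp.
  have := mulr_gt0 xp pos; move: sum; rewrite -mulr_natl; lra.
have s0 : ((K *m a)^T *m W *m (K *m a)) 0 0 + (a^T *m (C^T *m C) *m a) 0 0
  + ((K *m b)^T *m W *m (K *m b)) 0 0 + (b^T *m (C^T *m C) *m b) 0 0 = 0.
  by move: sum; rewrite x0 mul0r mul0rn; lra.
have Ka : K *m a = 0 by apply: (posdef_eq0 pW); lra.
have Kb : K *m b = 0 by apply: (posdef_eq0 pW); lra.
have Ca : C *m a = 0 by apply: gram_eq0; lra.
have Cb : C *m b = 0 by apply: gram_eq0; lra.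
(* what remains of the Riccati equation on vectors killed by K and C *)
have AX (v' : 'cV[R]_n) : K *m v' = 0 -> C *m v' = 0 -> A^T *m (X *m v') = - (X *m (Acl *m v')).
  move=> Kv Cv.
  have -> : Acl *m v' = A *m v' by rewrite /Acl mulmxBl -mulmxA Kv mulmx0 subr0.
  have := congr1 (mulmx^~ v') ricK.
  by rewrite !mulmxDl -!mulmxA Cv Kv !mulmx0 addr0 => /eqP; rewrite addr_eq0 => /eqP.
have AXa : A^T *m (X *m a) = y *: (X *m b).
  by rewrite AX // aE x0 scale0r sub0r mulmxN opprK scalemxAr.
have AXb : A^T *m (X *m b) = - (y *: (X *m a)).
  by rewrite AX // bE x0 scale0r add0r scalemxAr.
have BXa : B^T *m (X *m a) = 0 by rewrite mulmxA -WK -mulmxA Ka mulmx0.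
have BXb : B^T *m (X *m b) = 0 by rewrite mulmxA -WK -mulmxA Kb mulmx0.
pose u : 'rV[R[i]]_n := cm (X *m a)^T + Complex 0 1 *: cm (X *m b)^T.
have u0 : u = 0.
  apply: (hAB (Complex 0 (- y))) => //.
    rewrite /u mulmxDl -scalemxAl -!map_mxM /= -[A]trmxK -!trmx_mul AXa AXb.
    apply/matrixP => i j; rewrite !mxE.
    by apply/eqP; rewrite eq_complex /=; apply/andP; split; apply/eqP; ring.
  rewrite /u mulmxDl -scalemxAl -!map_mxM /= -[B]trmxK -!trmx_mul BXa BXb trmx0.
  by rewrite map_mx0 scaler0 addr0.
have [Xa Xb] := complex_combination_eq0 u0.
by move: pos; rewrite -!mulmxA Xa Xb !mulmx0 mxE addr0 ltxx.
Qed.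

End Riccati.

(** * Block calculus with selection matrices *)

Section BlockCalculus.
Context {T : comNzRingType} {q : nat}.
Implicit Types (d r c : 'I_q -> nat) (S : {set 'I_q}).
Local Notation E d k := (@E_blk T q d k).

(** Turning block extraction into multiplication by a selection matrix lets all
    later block arguments be carried out as matrix algebra. *)
Lemma submxrow_E a d (M : 'M[T]_(a, \sum_i d i)) k : submxrow M k = M *m E d k.
Proof.
rewrite -{2}[M]submxrowK mul_mxrow_mxcol (bigD1 k) //= eqxx pid_mx_1 mulmx1.
by rewrite big1 ?addr0 // => i /negPf ->; rewrite mulmx0.
Qed.

Lemma submxcol_E a d (M : 'M[T]_(\sum_i d i, a)) k : submxcol M k = (E d k)^T *m M.
Proof. by apply: trmx_inj; rewrite trmx_mul trmxK -submxrow_E tr_submxcol. Qed.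

Lemma submxblock_E r c (M : 'M[T]_(\sum_i r i, \sum_i c i)) i j :
  submxblock M i j = (E r i)^T *m M *m E c j.
Proof. by rewrite submxblockEv submxrow_E submxcol_E. Qed.

Lemma E_blk_orth d i j : i != j -> (E d i)^T *m E d j = 0.
Proof. by move=> /negPf ij; rewrite -submxcol_E mxcolK ij. Qed.

Lemma E_blk_gram d i : (E d i)^T *m E d i = 1%:M.
Proof. by rewrite -submxcol_E mxcolK eqxx pid_mx_1. Qed.

Lemma mxrow_E a d (M : forall j, 'M[T]_(a, d j)) :
  \mxrow_j M j = \sum_j M j *m (E d j)^T.
Proof.
apply/mxrowP => j; rewrite mxrowK submxrow_E mulmx_suml (bigD1 j) //= -mulmxA.
rewrite E_blk_gram mulmx1 big1 ?addr0 // => k kj.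
by rewrite -mulmxA E_blk_orth ?mulmx0.
Qed.

Lemma E_blk_partition d : \sum_j E d j *m (E d j)^T = 1%:M.
Proof.
rewrite -[RHS]submxrowK mxrow_E; apply: eq_bigr => j _.
by rewrite submxrow_E mul1mx.
Qed.

Lemma mxrow_mul_E a d (M : forall j, 'M[T]_(a, d j)) k : (\mxrow_j M j) *m E d k = M k.
Proof. by rewrite -submxrow_E mxrowK. Qed.

Lemma eq_block_cols a d (M N : 'M[T]_(a, \sum_i d i)) :
  (forall k, M *m E d k = N *m E d k) -> M = N.
Proof. by move=> h; apply/mxrowP => k; rewrite !submxrow_E. Qed.

Lemma bdiag_mul_E r c (M : forall i, 'M[T]_(r i, c i)) k :
  bdiag M *m E c k = E r k *m M k.
Proof.
apply/mxcolP => i; rewrite !submxcol_E !mulmxA -submxblock_E mxblockK.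
have [->|ik] := eqVneq i k; first by rewrite conform_mx_id E_blk_gram mul1mx.
by rewrite E_blk_orth ?mul0mx.
Qed.

Lemma tr_bdiag r c (M : forall i, 'M[T]_(r i, c i)) : (bdiag M)^T = bdiag (fun i => (M i)^T).
Proof.
rewrite /bdiag tr_mxblock; apply/eq_mxblock => i j.
rewrite eq_sym; case: eqVneq => [->|]; by rewrite ?conform_mx_id ?trmx0.
Qed.

End BlockCalculus.

Section Selection.
Context {T : comNzRingType} {q : nat}.
Implicit Types (d r c : 'I_q -> nat) (S : {set 'I_q}).
Local Notation E d k := (@E_blk T q d k).
Local Notation Es d S := (@E_set T q d S).

Lemma E_set_mul_E d S k : Es d S *m E_blk (sdim d S) k = E d (enum_val k).
Proof. exact: (@mxrow_mul_E _ _ _ (sdim d S)). Qed.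

Lemma E_set_gram d S : (Es d S)^T *m Es d S = 1%:M.
Proof.
apply: eq_block_cols => l; rewrite mul1mx -mulmxA E_set_mul_E.
apply: trmx_inj; rewrite trmx_mul trmxK.
apply: eq_block_cols => k; rewrite -mulmxA E_set_mul_E.
have [<-|kl] := eqVneq k l.
  by rewrite [RHS]E_blk_gram; exact (@E_blk_gram T _ d (enum_val k)).
have lk : enum_val l != enum_val k by rewrite (inj_eq enum_val_inj) eq_sym.
by rewrite [RHS]E_blk_orth 1?eq_sym //; exact (E_blk_orth d lk).
Qed.

Lemma E_set_in d S i : i \in S -> Es d S *m (Es d S)^T *m E d i = E d i.
Proof.
move=> iS; rewrite -(enum_rankK_in iS iS) -E_set_mul_E -mulmxA (mulmxA _^T).
by rewrite E_set_gram mul1mx.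
Qed.

Lemma E_set_notin d S i : i \notin S -> (E d i)^T *m Es d S = 0.
Proof.
move=> iS; apply: eq_block_cols => k; rewrite mul0mx -mulmxA E_set_mul_E E_blk_orth //.
by apply: contraNneq iS => ->; exact: enum_valP.
Qed.

(** A matrix whose block rows outside S vanish is fixed by the projector onto
    S. *)
Lemma E_set_support d S a (V : 'M[T]_(\sum_i d i, a)) :
  (forall i, i \notin S -> (E d i)^T *m V = 0) -> Es d S *m ((Es d S)^T *m V) = V.
Proof.
move=> hV; rewrite -[RHS]mul1mx -(E_blk_partition d) mulmx_suml.
rewrite -{1}[V]mul1mx -(E_blk_partition d) mulmx_suml !mulmx_sumr.
apply: eq_bigr => i _; rewrite -!mulmxA.
have [iS|iS] := boolP (i \in S); last by rewrite hV // !mulmx0.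
by rewrite (mulmxA (Es d S)) (mulmxA (Es d S *m _)) E_set_in.
Qed.

Lemma sub_sq_E r c S (M : 'M[T]_(\sum_i r i, \sum_i c i)) :
  sub_sq S M = (Es r S)^T *m M *m Es c S.
Proof.
apply/mxblockP => k l; rewrite mxblockK !submxblock_E.
by rewrite -!mulmxA E_set_mul_E !mulmxA -trmx_mul E_set_mul_E.
Qed.

Lemma sub_cols_E a c S (M : 'M[T]_(a, \sum_i c i)) : sub_cols S M = M *m Es c S.
Proof.
apply/mxrowP => k; rewrite mxrowK !submxrow_E.
by rewrite -mulmxA E_set_mul_E.
Qed.

End Selection.

(** * State-space algebra of the controller *)

Section StateSpaceAlgebra.
Context {K : fieldType} (s : K).

Context {n m nq ne : nat}.
Context (A : 'M[K]_n) (B : 'M[K]_(n, m)) (bA : 'M[K]_nq) (CQ : 'M[K]_(m, nq)).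
Context (R : 'M[K]_(n, nq)) (Pi1 : 'M[K]_(nq, n)) (Pi2 : 'M[K]_(nq, ne)).
Hypothesis RPi1 : R *m Pi1 = 1%:M.
Hypothesis Pi22 : Pi2^T *m Pi2 = 1%:M.
Hypothesis Pi21 : Pi2^T *m Pi1 = 0.
Hypothesis PiPi : Pi1 *m Pi1^T + Pi2 *m Pi2^T = 1%:M.
Hypothesis intertwine : A *m R + B *m CQ = R *m bA.

Context (AP : 'M[K]_ne) (BP : 'M[K]_(ne, n)) (CP : 'M[K]_(n, ne)).
Hypothesis APE : AP = Pi2^T *m bA *m Pi2.
Hypothesis BPE : BP = Pi2^T *m bA *m Pi1.
Hypothesis CPE : CP = R *m Pi2.
Hypothesis uA : s%:M - A \in unitmx.
Hypothesis ubA : s%:M - bA \in unitmx.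
Hypothesis uAP : s%:M - AP \in unitmx.
Hypothesis uAc : s%:M - (AP - BP *m CP) \in unitmx.

Definition ctrl_formula := CQ *m (Pi2 - Pi1 *m CP) *m resolvent_at s (AP - BP *m CP) *m BP + CQ
  *m Pi1.

Let reconstruct : (Pi2 - Pi1 *m CP) *m Pi2^T + Pi1 *m R = 1%:M.
Proof.
have e : R - CP *m Pi2^T = Pi1^T.
  rewrite -[X in X - _]mulmx1 -PiPi mulmxDr !mulmxA RPi1 mul1mx -CPE.
  by rewrite addrK.
by rewrite mulmxBl -(mulmxA Pi1) -addrA [- _ + _]addrC -mulmxBr e addrC.
Qed.

(** Disturbances d enter the plant state and v the measurement. In the stacked
    coordinates q the plant state is R q, the controller state is Pi2^T q, and
    q obeys q' = bold-A q + N; both components are checked by uniqueness of the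
    solution of a resolvent equation. *)
Theorem closed_loop_solution c (d v : 'M[K]_(n, c)) :
  let N := Pi1 *m (d + B *m CQ *m Pi1 *m v - CP *m BP *m v) + Pi2 *m BP *m v in
  let Q := resolvent_at s bA *m N in
  let x := R *m Q + v in
  let u := CQ *m Q + CQ *m Pi1 *m v in
  ctrl_formula *m x = u /\ x = resolvent_at s A *m B *m u + resolvent_at s A *m d + v.
Proof.
move=> N Q x u; set P := Pi2 - Pi1 *m CP.
have sQ : s *: Q = bA *m Q + N by exact: resolvent_at_solves.
have Pi2N : Pi2^T *m N = BP *m v.
  by rewrite mulmxDr -(mulmxA Pi2) !(mulmxA Pi2^T) Pi21 Pi22 mul0mx add0r mul1mx.
have RN : R *m N = d + B *m CQ *m Pi1 *m v.
  by rewrite mulmxDr -(mulmxA Pi2) !(mulmxA R) RPi1 mul1mx -CPE mulmxA subrK.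
have rec p (G : 'M[K]_(p, nq)) : G *m P *m Pi2^T + G *m Pi1 *m R = G.
  by rewrite -!(mulmxA G) -mulmxDr reconstruct mulmx1.
(* the controller dynamics are those of q with Pi1^T q replaced by x - C_Phi Pi2^T q *)
have AcE : AP - BP *m CP = Pi2^T *m bA *m P.
  by rewrite mulmxBr !mulmxA -APE -BPE.
split.
  have eta : Pi2^T *m Q = resolvent_at s (AP - BP *m CP) *m (BP *m x).
    apply: resolvent_at_uniq => //; rewrite scalemxAr sQ mulmxDr Pi2N (mulmxA _ bA).
    rewrite -[in LHS](rec _ (Pi2^T *m bA)) -AcE -BPE /x mulmxDl mulmxDr.
    by rewrite -!mulmxA addrA.
  rewrite /ctrl_formula -/P mulmxDl -(mulmxA _ BP) -(mulmxA (CQ *m P)) -eta /u /x.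
  rewrite [CQ *m Pi1 *m (_ + _)]mulmxDr addrA (mulmxA _ Pi2^T Q) (mulmxA _ R Q).
  by rewrite -mulmxDl rec.
rewrite /x; congr (_ + _); rewrite -mulmxA -mulmxDr; apply: resolvent_at_uniq => //.
rewrite scalemxAr sQ mulmxDr RN (mulmxA R bA) -intertwine mulmxDl /u mulmxDr.
by rewrite !mulmxA -!addrA; congr (_ + (_ + _)); rewrite addrC.
Qed.

(** Z = (s - A_Phi + B_Phi C_Phi)^-1 B_Phi equals (s - A_Phi)^-1 B_Phi Gamma,
    because s Z = A_Phi Z + B_Phi (1 - C_Phi Z) and Gamma = 1 - C_Phi Z. *)
Theorem controller_factorization :
  ctrl_formula = CQ *m (Pi2 *m resolvent_at s AP *m BP + Pi1) *m (1%:M - CP *m resolvent_at s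
    (AP - BP *m CP) *m BP).
Proof.
set Z := resolvent_at s (AP - BP *m CP) *m BP.
have sZ : s *: Z = (AP - BP *m CP) *m Z + BP by exact: resolvent_at_solves.
have ZE : Z = resolvent_at s AP *m (BP *m (1%:M - CP *m Z)).
  apply: resolvent_at_uniq => //; rewrite sZ mulmxBl [BP *m (_ - _)]mulmxBr mulmx1 -(mulmxA BP).
  by rewrite -addrA [- _ + _]addrC.
rewrite /ctrl_formula -!mulmxA -/Z -mulmxDr mulmxBl; congr (CQ *m _).
rewrite mulmxDl -!mulmxA. by rewrite -ZE mulmxBr mulmx1 addrA addrAC.
Qed.

Theorem propagation_differential_inverse :
  (CP *m resolvent_at s AP *m BP + 1%:M) *m (1%:M - CP *m resolvent_at s (AP - BP *m CP) *m BP)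
    = 1%:M.
Proof.
set Z := resolvent_at s (AP - BP *m CP) *m BP.
have sZ : s *: Z = (AP - BP *m CP) *m Z + BP by exact: resolvent_at_solves.
have ZE : Z = resolvent_at s AP *m (BP *m (1%:M - CP *m Z)).
  apply: resolvent_at_uniq => //; rewrite sZ mulmxBl [BP *m (_ - _)]mulmxBr mulmx1 -(mulmxA BP).
  by rewrite -addrA [- _ + _]addrC.
by rewrite -!(mulmxA CP) -/Z mulmxDl -!mulmxA -ZE mul1mx addrC subrK.
Qed.

End StateSpaceAlgebra.

(** * Downsets and the incidence algebra *)

(** The enumeration of a set of ordinals is increasing, which makes submatrices
    of block triangular matrices block triangular. *)
Lemma enum_val_lt p (S : {set 'I_p}) (k l : 'I_#|S|) : (k < l)%N -> (enum_val k < enum_val l)%N.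
Proof.
move=> kl; have x0 := enum_val k.
have srt : sorted (relpre val ltn) (enum S).
  rewrite /enum_mem; apply: sorted_filter; first by move=> a b c; exact: ltn_trans.
  by rewrite -enumT -sorted_map val_enum_ord iota_ltn_sorted.
rewrite !(enum_val_nth x0); apply: (sorted_ltn_nth _ _ srt) => //.
- by move=> a b c; exact: ltn_trans.
- by rewrite inE -cardE.
by rewrite inE -cardE.
Qed.

Section FirstBlock.
Context {T : comNzRingType}.

(** The partial identity used for E_1 only looks at the position of an entry in
    the whole matrix; for the first block this is the position inside the block. *)
Lemma pid_mx_E_blk q (d : 'I_q -> nat) (k0 : 'I_q) : k0 = 0%N :> nat ->
  (pid_mx (d k0) : 'M[T]_(\sum_i d i, d k0)) = E_blk d k0.
Proof.
move=> k00; apply/mxcolP => i; rewrite mxcolK.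
have [e|ik] := eqVneq i k0.
  rewrite {i}e; apply/matrixP => s b.
  rewrite mxE mxE tagnat.rankEsum /= big1 ?add0n ?mxE // => l.
  by rewrite k00.
apply/matrixP => s b; rewrite mxE mxE tagnat.rankEsum /= [RHS]mxE (bigD1 k0) /=; last first.
  by rewrite k00 lt0n; apply: contraNneq ik => i0; apply/eqP/val_inj; rewrite /= k00.
case: eqP => // e; have := ltn_ord b; rewrite -e -addnA.
by rewrite ltnNge leq_addr.
Qed.

Lemma ord_first_rest {V : nmodType} q (k0 : 'I_q) (F : 'I_q -> V) : k0 = 0%N :> nat ->
  \sum_i F i = F k0 + \sum_(k < q.-1) F (succ_ord k).
Proof.
case: q k0 F => [[]//|q] k0 F k00; rewrite big_ord_recl.
congr (F _ + _); first exact: val_inj.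
by apply: eq_bigr => k _; congr F; exact: val_inj.
Qed.

Lemma E_tail_mul_E q (d : 'I_q -> nat) k :
  @E_tail T q d *m E_blk (fun k => d (succ_ord k)) k = E_blk d (succ_ord k).
Proof. exact: (@mxrow_mul_E _ _ _ (fun k => d (succ_ord k))). Qed.

Lemma E_tail_gram q (d : 'I_q -> nat) : (@E_tail T q d)^T *m E_tail d = 1%:M.
Proof.
apply: eq_block_cols => l; rewrite mul1mx -mulmxA E_tail_mul_E.
apply: trmx_inj; rewrite trmx_mul trmxK.
apply: eq_block_cols => k; rewrite -mulmxA E_tail_mul_E.
have [<-|kl] := eqVneq k l.
  by rewrite [RHS]E_blk_gram; exact (@E_blk_gram T _ d (succ_ord k)).
have lk : succ_ord l != succ_ord k.
  by apply: contra kl => /eqP/(congr1 val)/= [] e; apply/eqP/val_inj.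
by rewrite [RHS]E_blk_orth 1?eq_sym //; exact (E_blk_orth d lk).
Qed.

Lemma E_tail_proj q (d : 'I_q -> nat) :
  E_tail d *m (@E_tail T q d)^T = \sum_(k < q.-1) E_blk d (succ_ord k) *m (E_blk d (succ_ord k))^T.
Proof.
rewrite -[X in X *m _]mulmx1 -(E_blk_partition (fun k => d (succ_ord k))).
rewrite mulmx_sumr mulmx_suml; apply: eq_bigr => k _.
by rewrite mulmxA -mulmxA -trmx_mul E_tail_mul_E.
Qed.

Lemma E_first_tail q (d : 'I_q -> nat) (k0 : 'I_q) : k0 = 0%N :> nat ->
  E_blk d k0 *m (@E_blk T q d k0)^T + E_tail d *m (@E_tail T q d)^T = 1%:M.
Proof. by move=> k00; rewrite E_tail_proj -(E_blk_partition d) [RHS](ord_first_rest _ k00). Qed.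

End FirstBlock.

Section BlockDiagonal.
Context {T : comNzRingType} {q : nat}.
Implicit Types (r c e : 'I_q -> nat).

Lemma mul_bdiag r c e (M : forall i, 'M[T]_(r i, c i)) (N : forall i, 'M[T]_(c i, e i)) :
  bdiag M *m bdiag N = bdiag (fun i => M i *m N i).
Proof.
by apply: eq_block_cols => k; rewrite -mulmxA !bdiag_mul_E mulmxA bdiag_mul_E mulmxA.
Qed.

Lemma bdiag1 r : bdiag (fun i => 1%:M : 'M[T]_(r i)) = 1%:M.
Proof. by apply: eq_block_cols => k; rewrite bdiag_mul_E mulmx1 mul1mx. Qed.

Lemma bdiag0 r c : bdiag (fun i => 0 : 'M[T]_(r i, c i)) = 0.
Proof. by apply: eq_block_cols => k; rewrite bdiag_mul_E mulmx0 mul0mx. Qed.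

Lemma bdiagD r c (M N : forall i, 'M[T]_(r i, c i)) :
  bdiag M + bdiag N = bdiag (fun i => M i + N i).
Proof. by apply: eq_block_cols => k; rewrite mulmxDl !bdiag_mul_E mulmxDr. Qed.

Lemma eq_bdiag r c (M N : forall i, 'M[T]_(r i, c i)) : (forall i, M i = N i) -> bdiag M = bdiag N.
Proof. by move=> h; apply: eq_block_cols => k; rewrite !bdiag_mul_E h. Qed.

End BlockDiagonal.

(** The equation between j and the first selected index only holds
    propositionally, and the type of the left-hand side depends on j; stating the
    lemma with an equation to be eliminated avoids a cast. *)
Lemma first_selected (T : comNzRingType) p (d : 'I_p -> nat) (S : {set 'I_p}) (k0 : 'I_#|S|) j :
  k0 = 0%N :> nat -> enum_val k0 = j ->
  (pid_mx (d j) : 'M[T]_(\sum_k sdim d S k, d j)) = (E_set d S)^T *m E_blk d j.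
Proof.
move=> k00; case: j /; rewrite -E_set_mul_E mulmxA E_set_gram mul1mx.
exact (@pid_mx_E_blk T _ (sdim d S) k0 k00).
Qed.

Lemma first_selected_partition (T : comNzRingType) p (d : 'I_p -> nat) (S : {set 'I_p})
    (k0 : 'I_#|S|) j : k0 = 0%N :> nat -> enum_val k0 = j ->
  (pid_mx (d j) : 'M[T]_(\sum_k sdim d S k, d j)) *m (pid_mx (d j))^T +
  E_tail (sdim d S) *m (E_tail (sdim d S))^T = 1%:M.
Proof.
move=> k00; case: j /; rewrite -(E_first_tail (sdim d S) k00); congr (_ + _).
by have := @pid_mx_E_blk T _ (sdim d S) k0 k00; rewrite /= => ->.
Qed.

Section Incidence.
Context {T : comNzRingType} {p : nat} (ple : rel 'I_p).
Hypothesis ple_order : partial_order ple.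
Implicit Types (r c e d : 'I_p -> nat).
Local Notation dn := (down ple).
Local Notation E d k := (@E_blk T p d k).
Local Notation Es d j := (@E_set T p d (dn j)).

Lemma mem_down j i : (i \in dn j) = ple j i.
Proof. by rewrite inE. Qed.

Lemma down_refl j : j \in dn j.
Proof. by rewrite mem_down; have [h _ _] := ple_order; exact: h. Qed.

Lemma E_set_down d j : Es d j *m (Es d j)^T *m E d j = E d j.
Proof. exact/E_set_in/down_refl. Qed.

Lemma incidence_E r c (M : 'M[T]_(\sum_i r i, \sum_i c i)) :
  incidence ple M <-> forall i j, i \notin dn j -> (E r i)^T *m M *m E c j = 0.
Proof.
by split=> h i j; have := h i j; rewrite submxblock_E ?mem_down.
Qed.

Lemma incidence_col r c (M : 'M[T]_(\sum_i r i, \sum_i c i)) j : incidence ple M ->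
  M *m E c j = Es r j *m ((Es r j)^T *m (M *m E c j)).
Proof.
move=> /incidence_E hM; symmetry; apply: E_set_support => i ij.
by rewrite mulmxA hM.
Qed.

Lemma col_incidence r c (M : 'M[T]_(\sum_i r i, \sum_i c i)) :
  (forall j, exists V, M *m E c j = Es r j *m V) -> incidence ple M.
Proof.
move=> h; apply/incidence_E => i j ij; have [V hV] := h j.
by rewrite -mulmxA hV mulmxA E_set_notin // mul0mx.
Qed.

(** By transitivity every element above which j lies has its downset inside that of j,
    so M maps vectors supported below j to such vectors. *)
Lemma incidence_down r c (M : 'M[T]_(\sum_i r i, \sum_i c i)) j : incidence ple M ->
  M *m Es c j = Es r j *m ((Es r j)^T *m M *m Es c j).
Proof.
move=> /incidence_E hM; rewrite -(mulmxA _ M); symmetry; apply: E_set_support => i ij.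
apply: eq_block_cols => k; rewrite mul0mx -!mulmxA E_set_mul_E mulmxA hM //.
apply: contra ij; rewrite !mem_down.
have := enum_valP k; rewrite mem_down; have [_ _ tr] := ple_order; exact: tr.
Qed.

Lemma incidence_mul r c e (M : 'M[T]_(\sum_i r i, \sum_i c i)) (N :
  'M[T]_(\sum_i c i, \sum_i e i)) :
  incidence ple M -> incidence ple N -> incidence ple (M *m N).
Proof.
move=> hM hN; apply: col_incidence => j.
exists ((Es r j)^T *m M *m Es c j *m ((Es c j)^T *m (N *m E e j))).
by rewrite -mulmxA {1}(incidence_col _ hN) (mulmxA M) (incidence_down _ hM) -!mulmxA.
Qed.

Lemma incidence_sub r c (M N : 'M[T]_(\sum_i r i, \sum_i c i)) :
  incidence ple M -> incidence ple N -> incidence ple (M - N).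
Proof.
move=> /incidence_E hM /incidence_E hN; apply/incidence_E => i j ij.
by rewrite mulmxBr mulmxBl hM // hN // subr0.
Qed.

Lemma incidence_opp r c (M : 'M[T]_(\sum_i r i, \sum_i c i)) :
  incidence ple M -> incidence ple (- M).
Proof.
move=> /incidence_E hM; apply/incidence_E => i j ij.
by rewrite mulmxN mulNmx hM // oppr0.
Qed.

Lemma incidence_scalar d (a : T) : incidence ple (a%:M : 'M[T]_(\sum_i d i)).
Proof.
apply/incidence_E => i j ij; rewrite mul_mx_scalar -scalemxAl E_blk_orth ?scaler0 //.
by apply: contraNneq ij => ->; exact: down_refl.
Qed.

(** M acts on vectors supported below j through m = E^T M E, and E^T N E is a
    left inverse of m, hence a right inverse; so N maps such vectors to such
    vectors. *)
Lemma incidence_inv d (M N : 'M[T]_(\sum_i d i)) : M *m N = 1%:M ->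
  incidence ple M -> incidence ple N.
Proof.
move=> MN hM; have NM := mulmx1C MN; apply: col_incidence => j.
set m := (Es d j)^T *m M *m Es d j.
have ME : M *m Es d j = Es d j *m m by exact: incidence_down.
have m1 : ((Es d j)^T *m N *m Es d j) *m m = 1%:M.
  by rewrite -(mulmxA _ (Es d j)) -ME -!mulmxA (mulmxA N) NM mul1mx E_set_gram.
have NE : N *m Es d j = Es d j *m ((Es d j)^T *m N *m Es d j).
  transitivity (N *m Es d j *m (m *m ((Es d j)^T *m N *m Es d j))).
    by rewrite (mulmx1C m1) mulmx1.
  by rewrite (mulmxA _ m) -(mulmxA N) -ME (mulmxA N) NM mul1mx.
exists ((Es d j)^T *m N *m Es d j *m ((Es d j)^T *m E d j)).
by rewrite mulmxA -NE -!mulmxA (mulmxA (Es d j)) E_set_down.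
Qed.

Lemma bdiag_incidence r c (M : 'M[T]_(\sum_i r i, \sum_i c i)) : is_bdiag M -> incidence ple M.
Proof.
move=> h i j ij; apply: h; apply: contraNneq ij => ->.
by rewrite -mem_down down_refl.
Qed.

Hypothesis ple_index : linear_extension_indexed ple.

(** Reflexivity puts j in its downset, and the linear extension makes it the
    smallest element. *)
Lemma down_first j : exists2 k0 : 'I_#|dn j|, k0 = 0%N :> nat & enum_val k0 = j.
Proof.
have ij := down_refl j; exists (enum_rank_in ij j); last exact: enum_rankK_in.
set k := enum_rank_in ij j; have ek : enum_val k = j by exact: enum_rankK_in.
apply/eqP; rewrite -leqn0 leqNgt; apply/negP => k0.
have l0 : (0 < #|dn j|)%N by apply: leq_ltn_trans (ltn_ord k).
have := @enum_val_lt _ _ (Ordinal l0) k k0; rewrite ek.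
have := enum_valP (Ordinal l0); rewrite mem_down => /ple_index.
by rewrite leqNgt => /negPf ->.
Qed.

Lemma first_block d j : (pid_mx (d j) : 'M[T]_(\sum_k sdim d (dn j) k, d j)) = (Es d j)^T *m E d j.
Proof. by have [k0 k00 ej] := down_first j; exact: first_selected k00 ej. Qed.

Lemma first_tail_partition d j :
  (pid_mx (d j) : 'M[T]_(\sum_k sdim d (dn j) k, d j)) *m (pid_mx (d j))^T +
  E_tail (sdim d (dn j)) *m (E_tail (sdim d (dn j)))^T = 1%:M.
Proof. by have [k0 k00 ej] := down_first j; exact: first_selected_partition k00 ej. Qed.

Lemma first_gram d j :
  (pid_mx (d j) : 'M[T]_(\sum_k sdim d (dn j) k, d j))^T *m pid_mx (d j) = 1%:M.
Proof. by rewrite first_block trmx_mul trmxK -mulmxA (mulmxA (Es d j)) E_set_down E_blk_gram. Qed.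

Lemma E_set_first d j : Es d j *m pid_mx (d j) = E d j.
Proof. by rewrite first_block mulmxA E_set_down. Qed.

Lemma tail_first d j : (E_tail (sdim d (dn j)))^T *m
   (pid_mx (d j) : 'M[T]_(\sum_k sdim d (dn j) k, d j)) = 0.
Proof.
set G := E_tail _; set f := pid_mx _.
have := congr1 (fun M => G^T *m (M *m f)) (first_tail_partition d j).
rewrite mul1mx mulmxDl -!mulmxA mulmxDr first_gram mulmx1.
rewrite [G^T *m (G *m _)]mulmxA E_tail_gram mul1mx => /eqP.
by rewrite addrC -subr_eq0 addrK => /eqP.
Qed.

End Incidence.

(** * Closed loop of the controller realization *)

Lemma right_inverse_invmx (K : fieldType) n (M N : 'M[K]_n) : M *m N = 1%:M -> invmx M = N.
Proof. by move=> h; have [u _] := mulmx1_unit h; rewrite -[LHS]mulmx1 -h mulKmx. Qed.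

Lemma invmx_solve (K : fieldType) n c (M : 'M[K]_n) (Y V : 'M[K]_(n, c)) :
  M \in unitmx -> M *m Y = V -> invmx M *m V = Y.
Proof. by move=> u <-; rewrite mulKmx. Qed.

Section Realization.
Context {R : realType}.
Notation L := lift_mx.

(** Both sides solve the same resolvent equation. *)
Lemma resolvent_intertwine a b (M : 'M[R]_a) (M' : 'M[R]_b) (G : 'M[R]_(a, b)) :
  M *m G = G *m M' -> resolvent M *m L G = L G *m resolvent M'.
Proof.
move=> h; symmetry; apply: resolvent_uniq; rewrite scalemxAr.
have := @resolvent_solves R _ M' _ 1%:M; rewrite mulmx1 => ->.
by rewrite mulmxDr mulmx1 !mulmxA -!lift_mxM h.
Qed.

Context {n m nq ne : nat}.
Context (A : 'M[R]_n) (B : 'M[R]_(n, m)) (bA : 'M[R]_nq) (CQ : 'M[R]_(m, nq)).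
Context (Rm : 'M[R]_(n, nq)) (Pi1 : 'M[R]_(nq, n)) (Pi2 : 'M[R]_(nq, ne)).
Context (AP : 'M[R]_ne) (BP : 'M[R]_(ne, n)) (CP : 'M[R]_(n, ne)).
Hypothesis RPi1 : Rm *m Pi1 = 1%:M.
Hypothesis Pi22 : Pi2^T *m Pi2 = 1%:M.
Hypothesis Pi21 : Pi2^T *m Pi1 = 0.
Hypothesis PiPi : Pi1 *m Pi1^T + Pi2 *m Pi2^T = 1%:M.
Hypothesis intertwine : A *m Rm + B *m CQ = Rm *m bA.
Hypothesis APE : AP = Pi2^T *m bA *m Pi2.
Hypothesis BPE : BP = Pi2^T *m bA *m Pi1.
Hypothesis CPE : CP = Rm *m Pi2.

Definition ctrl_tf := tf (AP - BP *m CP) BP (CQ *m (Pi2 - Pi1 *m CP)) (CQ *m Pi1).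
Definition diff_tf := tf (AP - BP *m CP) BP (- CP) 1%:M.
Definition prop_tf := tf AP BP CP 1%:M.
(** The transfer matrix from Gamma x to the stacked state q. Phi is R times it,
    and K_Phi is - C_Q times it. *)
Definition prop_lift := L Pi2 *m resolvent AP *m L BP + L Pi1.

Lemma ctrl_tf_formula : ctrl_tf = ctrl_formula svar (L CQ) (L Pi1) (L Pi2) (L AP) (L BP) (L CP).
Proof. by rewrite /ctrl_tf /tf /ctrl_formula /resolvent !(lift_mxM, lift_mxB). Qed.

Lemma diff_tfE : diff_tf = 1%:M - L CP *m resolvent_at svar (L AP - L BP *m L CP) *m L BP.
Proof.
by rewrite /diff_tf /tf /resolvent !(lift_mxM, lift_mxB, lift_mx1, lift_mxN) !mulNmx addrC.
Qed.

Lemma ctrl_tf_factor : ctrl_tf = L CQ *m prop_lift *m diff_tf.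
Proof.
by rewrite ctrl_tf_formula diff_tfE; apply: controller_factorization;
  rewrite -?lift_mxM -?lift_mxB ?resolvent_unit.
Qed.

Lemma prop_tf_lift : prop_tf = L Rm *m prop_lift.
Proof. by rewrite /prop_tf /tf /prop_lift mulmxDr -(lift_mxM Rm Pi1) RPi1 !mulmxA -lift_mxM
  -CPE. Qed.

Lemma prop_tf_diff_tf : prop_tf *m diff_tf = 1%:M.
Proof.
rewrite /prop_tf /tf lift_mx1 diff_tfE; apply: propagation_differential_inverse;
 by rewrite -?lift_mxM -?lift_mxB resolvent_unit.
Qed.

Lemma ctrl_tf_solution c (d v : 'M[R]_(n, c)) :
  let N := Pi1 *m (d + B *m CQ *m Pi1 *m v - CP *m BP *m v) + Pi2 *m BP *m v in
  let Q := resolvent bA *m L N in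
  let x := L Rm *m Q + L v in
  let u := L CQ *m Q + L (CQ *m Pi1 *m v) in
  ctrl_tf *m x = u /\ x = resolvent A *m L B *m u + resolvent A *m L d + L v.
Proof.
move=> N Q x u; rewrite ctrl_tf_formula /x /u /Q.
have -> : L N = L Pi1 *m (L d + L B *m L CQ *m L Pi1 *m L v - L CP *m L BP *m L v) + L Pi2 *m L
  BP *m L v.
  by rewrite /N lift_mxD !lift_mxM lift_mxB lift_mxD !lift_mxM.
rewrite !(lift_mxM _ v) (lift_mxM CQ).
have h1 : L Rm *m L Pi1 = 1%:M by rewrite -lift_mxM RPi1 lift_mx1.
have h2 : (L Pi2)^T *m L Pi2 = 1%:M by rewrite -lift_mx_tr -lift_mxM Pi22 lift_mx1.
have h3 : (L Pi2)^T *m L Pi1 = 0 by rewrite -lift_mx_tr -lift_mxM Pi21 lift_mx0.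
have h4 : L Pi1 *m (L Pi1)^T + L Pi2 *m (L Pi2)^T = 1%:M.
  by rewrite -!lift_mx_tr -!lift_mxM -lift_mxD PiPi lift_mx1.
have h5 : L A *m L Rm + L B *m L CQ = L Rm *m L bA.
  by rewrite -!lift_mxM -lift_mxD intertwine.
have h6 : L AP = (L Pi2)^T *m L bA *m L Pi2 by rewrite -lift_mx_tr -!lift_mxM APE.
have h7 : L BP = (L Pi2)^T *m L bA *m L Pi1 by rewrite -lift_mx_tr -!lift_mxM BPE.
have h8 : L CP = L Rm *m L Pi2 by rewrite -lift_mxM CPE.
have uc : svar%:M - (L AP - L BP *m L CP) \in unitmx.
  by rewrite -lift_mxM -lift_mxB resolvent_unit.
exact (closed_loop_solution h1 h2 h3 h4 h5 h6 h7 h8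
  (resolvent_unit A) (resolvent_unit bA) uc (L d) (L v)).
Qed.

Definition dist_to_state := L Rm *m resolvent bA *m L Pi1.
Definition dist_to_input := L CQ *m resolvent bA *m L Pi1.

Lemma ctrl_tf_disturbance : ctrl_tf *m dist_to_state = dist_to_input /\ dist_to_state =
  resolvent A *m L B *m dist_to_input + resolvent A.
Proof.
have := ctrl_tf_solution 1%:M 0; rewrite !mulmx0 !lift_mx0 !addr0 subr0 mulmx1 lift_mx1 mulmx1.
by rewrite /dist_to_state /dist_to_input -(mulmxA (L Rm)) -(mulmxA (L CQ)) !addr0.
Qed.

Definition noise_input := Pi1 *m (B *m CQ *m Pi1 - CP *m BP) + Pi2 *m BP.
Definition noise_to_state := L Rm *m resolvent bA *m L noise_input + 1%:M.
Definition noise_to_input := L CQ *m resolvent bA *m L noise_input + L (CQ *m Pi1).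

Lemma ctrl_tf_noise : ctrl_tf *m noise_to_state = noise_to_input /\ noise_to_state =
  resolvent A *m L B *m noise_to_input + 1%:M.
Proof.
have := ctrl_tf_solution 0 1%:M; rewrite !mulmx1 add0r lift_mx0 lift_mx1 mulmx0 /= addr0.
by rewrite /noise_to_state /noise_to_input /noise_input -(mulmxA (L Rm)) -(mulmxA (L CQ)).
Qed.

Notation P22 := (resolvent A *m L B).

Lemma ctrl_tf_sens_unit : 1%:M - P22 *m ctrl_tf \in unitmx.
Proof.
have [h1 h2] := ctrl_tf_noise.
have e : (1%:M - P22 *m ctrl_tf) *m noise_to_state = 1%:M.
  by rewrite mulmxBl mul1mx -(mulmxA P22) h1 {1}h2 addrC addKr.
exact (proj1 (mulmx1_unit e)).
Qed.

(** The sensitivity is exhibited as an explicit inverse, which also proves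
    well-posedness. *)
Lemma ctrl_tf_sens : invmx (1%:M - P22 *m ctrl_tf) = noise_to_state.
Proof.
have [h1 h2] := ctrl_tf_noise.
have e : (1%:M - P22 *m ctrl_tf) *m noise_to_state = 1%:M.
  by rewrite mulmxBl mul1mx -(mulmxA P22) h1 {1}h2 addrC addKr.
exact: right_inverse_invmx e.
Qed.

Lemma ctrl_tf_sens_resolvent : noise_to_state *m resolvent A = dist_to_state.
Proof.
have [h1 h2] := ctrl_tf_disturbance.
have e : (1%:M - P22 *m ctrl_tf) *m dist_to_state = resolvent A.
  by rewrite mulmxBl mul1mx -(mulmxA P22) h1 {1}h2 addrC addKr.
by rewrite -ctrl_tf_sens; exact: invmx_solve ctrl_tf_sens_unit e.
Qed.

Context {l r : nat} (C : 'M[R]_(l, n)) (D : 'M[R]_(l, m)) (F : 'M[R]_(n, r)).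

Notation P11 := (L C *m resolvent A *m L F).
Notation P12 := (L C *m resolvent A *m L B + L D).
Notation P21 := (resolvent A *m L F).

Lemma P12_mul c (M : 'M[ratfun R]_(m, c)) : P12 *m M = L C *m (P22 *m M) + L D *m M.
Proof. by rewrite mulmxDl -(mulmxA (L C)) -(mulmxA (L C)). Qed.

Lemma ctrl_tf_closed_loop :
  P11 + P12 *m ctrl_tf *m invmx (1%:M - P22 *m ctrl_tf) *m P21 =
    L C *m (dist_to_state *m L F) + L D *m (dist_to_input *m L F).
Proof.
have [h1 h2] := ctrl_tf_disturbance.
rewrite ctrl_tf_sens -(mulmxA _ noise_to_state) (mulmxA noise_to_state) ctrl_tf_sens_resolvent
  -(mulmxA P12) (mulmxA ctrl_tf) h1.
rewrite P12_mul addrA -(mulmxA (L C)) -mulmxDr; congr (_ *m _ + _).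
by rewrite [in RHS]h2 mulmxDl addrC (mulmxA P22).
Qed.

(** All nine transfer matrices are built from constant matrices and the four
    responses to plant disturbances and measurement noise, each of which is
    driven by the resolvent of bold-A. *)
Theorem ctrl_tf_internally_stable (sens := invmx (1%:M - P22 *m ctrl_tf)) :
  rel_degree_mx true 1 (resolvent bA) ->
  [/\ 1%:M - P22 *m ctrl_tf \in unitmx,
      [/\ RHinfty (P11 + P12 *m ctrl_tf *m sens *m P21),
          RHinfty (P12 *m (1%:M + ctrl_tf *m sens *m P22))
        & RHinfty (P12 *m ctrl_tf *m sens)],
      [/\ RHinfty (ctrl_tf *m sens *m P21),
          RHinfty (1%:M + ctrl_tf *m sens *m P22)
        & RHinfty (ctrl_tf *m sens)]
    & [/\ RHinfty (sens *m P21),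
          RHinfty (sens *m P22)
        & RHinfty sens]].
Proof.
move=> hb.
have [h1 h2] := ctrl_tf_disturbance; have [h3 h4] := ctrl_tf_noise.
have sP c (G : 'M[ratfun R]_(n, c)) : sens *m (resolvent A *m G) = dist_to_state *m G.
  by rewrite /sens ctrl_tf_sens mulmxA ctrl_tf_sens_resolvent.
have ksP c (G : 'M[ratfun R]_(n, c)) : ctrl_tf *m sens *m (resolvent A *m G) = dist_to_input *m G.
  by rewrite -(mulmxA ctrl_tf) sP mulmxA h1.
have kS : ctrl_tf *m sens = noise_to_input by rewrite /sens ctrl_tf_sens.
have dTx : rel_degree_mx true 0 dist_to_state
  by apply/rel_degree_mx_liftr/rel_degree_mx_liftl/rel_degree_mx_sub/hb.
have dTu : rel_degree_mx true 0 dist_to_input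
  by apply/rel_degree_mx_liftr/rel_degree_mx_liftl/rel_degree_mx_sub/hb.
have dSx : rel_degree_mx true 0 noise_to_state.
  by apply: rel_degree_mxD; [apply/rel_degree_mx_liftr/rel_degree_mx_liftl/rel_degree_mx_sub/hb|exact: rel_degree_mx1].
have dSu : rel_degree_mx true 0 noise_to_input.
  by apply: rel_degree_mxD; [apply/rel_degree_mx_liftr/rel_degree_mx_liftl/rel_degree_mx_sub/hb|exact: rel_degree_mx_lift].
have dTuB : rel_degree_mx true 0 (1%:M + dist_to_input *m L B).
  by apply: rel_degree_mxD; [exact: rel_degree_mx1|exact: rel_degree_mx_liftr].
split; first exact: ctrl_tf_sens_unit.
- split; apply/RHinftyP.
  + rewrite ctrl_tf_closed_loop; apply: rel_degree_mxD; apply: rel_degree_mx_liftl;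
    exact: rel_degree_mx_liftr.
  + rewrite ksP P12_mul; apply: rel_degree_mxD; apply: rel_degree_mx_liftl => //.
    have -> : P22 *m (1%:M + dist_to_input *m L B) = dist_to_state *m L B.
      by rewrite [in RHS]h2 mulmxDr mulmx1 mulmxDl addrC (mulmxA P22).
    exact: rel_degree_mx_liftr.
  rewrite -(mulmxA P12) kS P12_mul; apply: rel_degree_mxD; apply: rel_degree_mx_liftl => //.
  have -> : P22 *m noise_to_input = noise_to_state - 1%:M by rewrite h4 addrK.
  by apply: rel_degree_mxD => //; apply/rel_degree_mxN/rel_degree_mx1.
- split; apply/RHinftyP; rewrite ?ksP ?kS //; exact: rel_degree_mx_liftr.
by split; apply/RHinftyP; rewrite ?sP;
  [exact: rel_degree_mx_liftr|exact: rel_degree_mx_liftr|rewrite /sens ctrl_tf_sens].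
Qed.

End Realization.

(** * The controller of a poset-causal system *)

Lemma lift_E_blk (R : realType) q (d : 'I_q -> nat) k : lift_mx (E_blk d k : 'M[R]__) = E_blk d k.
Proof.
apply/mxcolP => i; rewrite mxcolK; apply/matrixP => a b.
transitivity (FracField.tofrac (submxcol (E_blk d k : 'M[R]__) i a b)%:P); first by rewrite !mxE.
rewrite mxcolK; case: eqP => _; rewrite !mxE ?polyC0 ?tofrac0 //.
by case: (_ && _); rewrite ?polyC1 ?tofrac1 ?polyC0 ?tofrac0.
Qed.

Lemma lift_E_set (R : realType) q (d : 'I_q -> nat) S : lift_mx (E_set d S : 'M[R]__) = E_set d S.
Proof.
apply: eq_block_cols => k; rewrite E_set_mul_E -lift_E_blk -lift_mxM E_set_mul_E.
exact: lift_E_blk.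
Qed.

Lemma lift_incidence (R : realType) p (ple : rel 'I_p) (r c : 'I_p -> nat)
  (M : 'M[R]_(\sum_i r i, \sum_i c i)) : incidence ple M -> incidence ple (lift_mx M).
Proof.
move=> h i j ij; rewrite -(lift_mx0 (R := R)) -(h i j ij).
by apply/matrixP => a b; rewrite !mxE.
Qed.

Lemma rel_degree_mx_sum (R : realType) b k (I : finType) a c (M : I -> 'M[ratfun R]_(a, c)) :
  (forall i, rel_degree_mx b k (M i)) -> rel_degree_mx b k (\sum_i M i).
Proof.
by move=> h i j; rewrite summxE; apply: rel_degree_sum => t; exact: h.
Qed.

Lemma lift_mx_sum (R : realType) (I : finType) a c (M : I -> 'M[R]_(a, c)) :
  lift_mx (\sum_i M i) = \sum_i lift_mx (M i).
Proof. by rewrite (big_morph _ (@lift_mxD R a c) (@lift_mx0 R a c)). Qed.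

Section Controller.
Context {R : realType} {p : nat} {ple : rel 'I_p}.
Hypothesis ple_order : partial_order ple.
Hypothesis ple_index : linear_extension_indexed ple.
Context {n m : 'I_p -> nat}.
Context (A : 'M[R]_(\sum_i n i)) (B : 'M[R]_(\sum_i n i, \sum_i m i)).
Hypothesis A_causal : incidence ple A.
Hypothesis B_causal : incidence ple B.
Context {l : nat} (D : 'M[R]_(l, \sum_i m i)).
Notation dn := (down ple).
Context (X : forall j, 'M[R]_(\sum_k sdim n (dn j) k)).

Notation N j := (\sum_k sdim n (dn j) k)%N.
Notation Nt j := (\sum_(k < #|dn j|.-1) sdim n (dn j) (succ_ord k))%N.
Notation Es d j := (E_set d (dn j)).
Notation Pi1 := (@Pi1 R p ple n).
Notation Pi2 := (@Pi2 R p ple n).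
Notation Rmx d := (@Rmx R p ple d).
Notation Kg := (Kgain B D X).
Notation Acl j := (A_ ple A j - B_ ple B j *m Kg j).
Notation bA := (bigA A B D X).
Notation CQ := (C_Q B D X).
Notation AP := (A_Phi A B D X).
Notation BP := (B_Phi A B D X).
Notation CP := (@C_Phi R p ple n).
Notation iota j := (E_blk (fun j => N j) j).
Notation kappa j := (E_blk (fun j => Nt j) j).
Notation E1 j := (pid_mx (n j) : 'M[R]_(N j, n j)).
Notation Et j := (E_tail (sdim n (dn j)) : 'M[R]_(N j, Nt j)).

Lemma bigA_E j : bA *m iota j = iota j *m (Acl j).
Proof. exact: (@bdiag_mul_E R p _ _ (fun j => Acl j)). Qed.

Lemma Pi1_E j : Pi1 *m E_blk n j = iota j *m E1 j.
Proof. exact: (@bdiag_mul_E R p _ n (fun j => E1 j)). Qed.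

Lemma Pi2_E j : Pi2 *m kappa j = iota j *m Et j.
Proof. exact: (@bdiag_mul_E R p _ _ (fun j => Et j)). Qed.

Lemma Rmx_E d j : Rmx d *m E_blk (fun j => \sum_k sdim d (dn j) k)%N j = Es d j.
Proof. exact: (@mxrow_mul_E R p _ (fun j => \sum_k sdim d (dn j) k)%N). Qed.

Lemma bigK_E j : bigK B D X *m iota j = E_blk (fun j => \sum_k sdim m (dn j) k)%N j *m Kg j.
Proof. exact: (@bdiag_mul_E R p _ _ (fun j => Kg j)). Qed.

Lemma CQ_E j : CQ *m iota j = - (Es m j *m Kg j).
Proof. by rewrite /C_Q mulNmx mulNmx -mulmxA bigK_E mulmxA Rmx_E. Qed.

Lemma R_Pi1 : Rmx n *m Pi1 = 1%:M.
Proof.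
apply: eq_block_cols => j.
by rewrite -mulmxA Pi1_E mulmxA Rmx_E mul1mx E_set_first.
Qed.

Lemma Pi2_gram : Pi2^T *m Pi2 = 1%:M.
Proof.
rewrite /Defs.Pi2 tr_bdiag mul_bdiag -bdiag1; apply: eq_bdiag => j; exact: E_tail_gram.
Qed.

Lemma Pi2_Pi1 : Pi2^T *m Pi1 = 0.
Proof.
rewrite /Defs.Pi2 tr_bdiag mul_bdiag -bdiag0; apply: eq_bdiag => j; exact: tail_first.
Qed.

Lemma Pi_partition : Pi1 *m Pi1^T + Pi2 *m Pi2^T = 1%:M.
Proof.
rewrite /Defs.Pi1 /Defs.Pi2 !tr_bdiag !mul_bdiag bdiagD -bdiag1.
by apply: eq_bdiag => j; exact: first_tail_partition.
Qed.

(** Because A and B are causal, they act on the blocks below j through A_j and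
    B_j. *)
Lemma R_intertwine : A *m Rmx n + B *m CQ = Rmx n *m bA.
Proof.
apply: eq_block_cols => j.
rewrite mulmxDl -(mulmxA A) -(mulmxA B) -(mulmxA (Rmx n)) CQ_E bigA_E Rmx_E mulmxN (mulmxA B)
  (mulmxA (Rmx n)) Rmx_E.
rewrite (incidence_down ple_order _ A_causal) (incidence_down ple_order _ B_causal).
by rewrite -(mulmxA (Es n j) _ (Kg j)) -mulmxBr /A_ /B_ !sub_sq_E.
Qed.

Notation L := lift_mx.
Notation prop_lift := (prop_lift Pi1 Pi2 AP BP).

Lemma AP_E j : AP *m kappa j = kappa j *m ((Et j)^T *m (Acl j) *m Et j).
Proof.
rewrite /A_Phi -(mulmxA _ Pi2) Pi2_E -(mulmxA _ bA) (mulmxA bA) bigA_E (mulmxA _ (iota j *m _)).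
rewrite (mulmxA Pi2^T) (_ : Pi2^T *m iota j = kappa j *m (Et j)^T); last first.
  by rewrite /Defs.Pi2 tr_bdiag bdiag_mul_E.
by rewrite -!(mulmxA (kappa j)).
Qed.

Lemma BP_E j : BP *m E_blk n j = kappa j *m ((Et j)^T *m (Acl j) *m E1 j).
Proof.
rewrite /B_Phi -(mulmxA _ Pi1) Pi1_E -(mulmxA _ bA) (mulmxA bA) bigA_E (mulmxA _ (iota j *m _)).
rewrite (mulmxA Pi2^T) (_ : Pi2^T *m iota j = kappa j *m (Et j)^T); last first.
  by rewrite /Defs.Pi2 tr_bdiag bdiag_mul_E.
by rewrite -!(mulmxA (kappa j)).
Qed.

(** A_Phi, B_Phi, Pi1 and Pi2 are block diagonal, so the stacked states do not
    interact. *)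
Lemma prop_lift_E j : exists y, prop_lift *m L (E_blk n j) = L (iota j) *m y.
Proof.
exists (L (Et j) *m resolvent ((Et j)^T *m (Acl j) *m Et j) *m L ((Et j)^T *m (Acl j) *m E1 j) +
  L (E1 j)).
rewrite /prop_lift mulmxDl mulmxDr; congr (_ + _); last first.
  by rewrite -!lift_mxM Pi1_E.
rewrite -(mulmxA _ (L BP)) -(lift_mxM BP) BP_E (lift_mxM (kappa j)) -(mulmxA (L Pi2)).
rewrite (mulmxA (resolvent AP)) (resolvent_intertwine (AP_E j)) -(mulmxA (L (kappa j))).
rewrite (mulmxA (L Pi2)) -(lift_mxM Pi2) Pi2_E (lift_mxM (iota j)).
by rewrite -!(mulmxA (L (iota j))) -(mulmxA (L (Et j))).
Qed.

Lemma Phi_prop_lift : Phi A B D X = L (Rmx n) *m prop_lift.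
Proof. exact: (@prop_tf_lift R _ _ _ (Rmx n) Pi1 Pi2 AP BP CP R_Pi1). Qed.

Lemma Phi_Gamma : Phi A B D X *m Gamma A B D X = 1%:M.
Proof. exact: (@prop_tf_diff_tf R _ _ AP BP CP). Qed.

(** Column j of Phi is E_(down j) y for the j-th diagonal block y of
    [prop_lift], and the zero-padded gain undoes this selection. *)
Lemma K_Phi_prop_lift : K_Phi A B D X = - (L CQ *m prop_lift).
Proof.
apply: eq_block_cols => j; rewrite mxrow_mul_E submxrow_E Phi_prop_lift -!lift_E_blk.
have [y hy] := prop_lift_E j.
rewrite mulNmx -(mulmxA (L CQ)) -(mulmxA (L (Rmx n))) hy.
rewrite (mulmxA (L CQ)) (mulmxA (L (Rmx n))) -!lift_mxM CQ_E Rmx_E lift_mxN mulNmx opprK.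
rewrite mulmxA -lift_mxM; congr (L _ *m y).
by rewrite /Khat /zero_pad -(mulmxA _ _ (Es n j)) E_set_gram mulmx1.
Qed.

Lemma Kstar_factor : Kstar A B D X = - (K_Phi A B D X *m Gamma A B D X).
Proof.
rewrite K_Phi_prop_lift mulNmx opprK.
exact: (@ctrl_tf_factor R _ _ _ _ CQ Pi1 Pi2 AP BP CP).
Qed.

Lemma Phi_incidence : incidence ple (Phi A B D X).
Proof.
apply: (col_incidence) => j; have [y hy] := prop_lift_E j; exists y.
rewrite Phi_prop_lift -lift_E_blk -(mulmxA (L (Rmx n))) hy mulmxA -lift_mxM Rmx_E.
by rewrite lift_E_set.
Qed.

Lemma K_Phi_incidence : incidence ple (K_Phi A B D X).
Proof.
apply: col_incidence => j; have [y hy] := prop_lift_E j; exists (L (Kg j) *m y).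
rewrite K_Phi_prop_lift -lift_E_blk mulNmx -(mulmxA (L CQ)) hy (mulmxA (L CQ)) -(lift_mxM CQ) CQ_E.
by rewrite lift_mxN mulNmx opprK (lift_mxM (Es m j)) lift_E_set mulmxA.
Qed.

Lemma Kstar_incidence : incidence ple (Kstar A B D X).
Proof.
rewrite Kstar_factor; apply: incidence_opp; apply: incidence_mul => //.
  exact: K_Phi_incidence.
exact: incidence_inv Phi_Gamma Phi_incidence.
Qed.

Context (C : 'M[R]_(l, \sum_i n i)).
Hypothesis DD_pos : posdef (D^T *m D).
Hypothesis AB_stab : forall i, stabilizable (submxblock A i i) (submxblock B i i).
Hypothesis X_riccati : forall j, riccati_sol A B C D (X j).

Lemma DD_pos_sub j : posdef ((D_ ple D j)^T *m D_ ple D j).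
Proof.
have [_ hD] := DD_pos; split; first by rewrite trmx_mul trmxK.
move=> v v0; rewrite /D_ sub_cols_E.
have := hD (Es m j *m v); rewrite !trmx_mul !mulmxA; apply.
apply: contra v0 => /eqP e; apply/eqP.
by rewrite -[v]mul1mx -(E_set_gram m (dn j)) -mulmxA e mulmx0.
Qed.

Lemma hautus_sub j : hautus (A_ ple A j) (B_ ple B j).
Proof.
apply: hautus_block => [k k' lt|k k' lt|k]; rewrite ?mxblockK.
- apply: A_causal; apply/negP => /ple_index; rewrite leqNgt; apply/negP/negPn.
  exact: enum_val_lt.
- apply: B_causal; apply/negP => /ple_index; rewrite leqNgt; apply/negP/negPn.
  exact: enum_val_lt.
exact/stabilizable_hautus/AB_stab.
Qed.

Lemma Acl_Hurwitz j : Hurwitz (Acl j).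
Proof.
have [Xp ric] := X_riccati j.
exact: (riccati_Hurwitz Xp (DD_pos_sub j) (@hautus_sub j) ric).
Qed.

Lemma resolvent_bigA_E j : resolvent bA *m L (iota j) = L (iota j) *m resolvent (Acl j).
Proof. exact/resolvent_intertwine/bigA_E. Qed.

(** Obtained block by block from the resolvents of the blocks of bold-A. *)
Lemma resolvent_bigA_deg : rel_degree_mx true 1 (resolvent bA).
Proof.
rewrite -[resolvent bA]mulmx1 -lift_mx1 -(E_blk_partition (fun j => N j)).
rewrite lift_mx_sum mulmx_sumr; apply: rel_degree_mx_sum => j.
rewrite lift_mxM (mulmxA (resolvent bA)) resolvent_bigA_E.
apply/rel_degree_mx_liftr/rel_degree_mx_liftl/resolvent_rel_degree => _; exact: (@Acl_Hurwitz j).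
Qed.

End Controller.

(** * Orthogonality of the optimal output *)

(** The vector h plays the role of the conjugate of the optimal trajectory, for
    which s becomes - s on the imaginary axis; the terms in s then cancel and the
    Riccati equation removes all terms except the one containing F. *)
Lemma riccati_cross_term (K : fieldType) (s : K) n m l c (A : 'M[K]_n) (B : 'M[K]_(n, m))
  (C : 'M[K]_(l, n)) (D : 'M[K]_(l, m)) (X : 'M[K]_n) (G : 'M[K]_(m, n)) (F : 'M[K]_(n, c))
  (h : 'M[K]_(c, n)) (d : 'M[K]_(n, c)) (e : 'M[K]_(m, c)) :
  C^T *m D = 0 -> D^T *m D *m G = B^T *m X -> X^T = X ->
  A^T *m X + X *m A - G^T *m (B^T *m X) + C^T *m C = 0 ->
  (- s) *: h = h *m (A - B *m G)^T + F^T ->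
  s *: d = A *m d + B *m e ->
  h *m (C - D *m G)^T *m (C *m d + D *m e) = F^T *m X *m d.
Proof.
move=> CD WG Xs ric hE dE.
have DC : D^T *m C = 0 by rewrite -[C]trmxK -trmx_mul CD trmx0.
have GW : G^T *m (D^T *m D) = X *m B.
  by rewrite -[X]Xs -[B]trmxK -trmx_mul -WG !trmx_mul trmxK.
have -> : h *m (C - D *m G)^T *m (C *m d + D *m e) = h *m (C^T *m C) *m d - h *m (X *m B) *m e.
  rewrite -GW linearB /= trmx_mul mulmxBr mulmxDr !mulmxBl.
  rewrite -!mulmxA (mulmxA C^T D) CD (mulmxA D^T C) DC !mul0mx !mulmx0 subr0 sub0r.
  by [].
have CC : C^T *m C = G^T *m (B^T *m X) - A^T *m X - X *m A.
  apply/eqP; rewrite -subr_eq0; apply/eqP; rewrite -[RHS]ric.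
  by apply/matrixP => i j; rewrite !mxE; ring.
have hA : h *m A^T = (- s) *: h - F^T + h *m G^T *m B^T.
  rewrite hE linearB /= trmx_mul mulmxBr mulmxA.
  by apply/matrixP => i j; rewrite !mxE; ring.
have Ad : A *m d = s *: d - B *m e by rewrite dE addrK.
rewrite CC mulmxBr mulmxBr !mulmxBl.
have -> : h *m (A^T *m X) *m d = (- s) *: (h *m X *m d) - F^T *m X *m d + h *m (G^T *m (B^T *m
  X)) *m d.
  by rewrite (mulmxA h A^T) hA mulmxDl mulmxBl mulmxDl mulmxBl -!scalemxAl -!mulmxA.
have -> : h *m (X *m A) *m d = s *: (h *m X *m d) - h *m (X *m B) *m e.
  by rewrite -!mulmxA Ad !mulmxBr -!scalemxAr.
rewrite scaleNr; set a := _ *: _; set b := F^T *m _ *m _; set c0 := h *m _ *m _;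
  set f := h *m _ *m _.
by apply/matrixP => i j; rewrite !mxE; ring.
Qed.

Section Energy.
Context {R : realType}.
Notation C := R[i].
Notation cm := (map_mx (real_complex R)).

Definition energy {a b} (M : 'M[C]_(a, b)) : R := \sum_i \sum_j normsq (M i j).

Definition herm {a b} (M : 'M[C]_(a, b)) : 'M[C]_(b, a) := map_mx (@conjc R) M^T.

Lemma hermM a b c (M : 'M[C]_(a, b)) (N : 'M[C]_(b, c)) : herm (M *m N) = herm N *m herm M.
Proof. by rewrite /herm trmx_mul map_mxM. Qed.

Lemma herm_cm a b (M : 'M[R]_(a, b)) : herm (cm M) = (cm M)^T.
Proof. by apply/matrixP => i j; rewrite !mxE /= oppr0. Qed.

Lemma hermD a b (M N : 'M[C]_(a, b)) : herm (M + N) = herm M + herm N.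
Proof. by rewrite /herm linearD map_mxD. Qed.

Lemma hermZ a b z (M : 'M[C]_(a, b)) : herm (z *: M) = conjc z *: herm M.
Proof. by apply/matrixP => i j; rewrite !mxE rmorphM. Qed.

(** The difference of the two sides is the energy of M' - M. *)
Lemma energy_convex a b (M M' : 'M[C]_(a, b)) :
  energy M + 2 * complex.Re (\tr (herm M *m (M' - M))) <= energy M'.
Proof.
have -> : complex.Re (\tr (herm M *m (M' - M))) =
    \sum_i \sum_j complex.Re (conjc (M i j) * (M' i j - M i j)).
  rewrite exchange_big /mxtrace (big_morph _ (@cReD R) (erefl _)) /=.
  apply: eq_bigr => j _; rewrite mxE (big_morph _ (@cReD R) (erefl _)) /=.
  by apply: eq_bigr => i _; rewrite !mxE.
rewrite /energy mulr_sumr -big_split /=; apply: ler_sum => i _.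
rewrite mulr_sumr -big_split /=; apply: ler_sum => j _.
case: (M i j) (M' i j) => [x y] [x' y']; rewrite /normsq /=.
have := sqr_ge0 (x' - x); have := sqr_ge0 (y' - y); nra.
Qed.

Lemma tr_herm_blocks a q (r : 'I_q -> nat) (Z V : 'M[C]_(a, \sum_i r i)) :
  \tr (herm Z *m V) = \sum_j \tr (herm (Z *m cm (E_blk r j)) *m (V *m cm (E_blk r j))).
Proof.
have e : \sum_j cm (E_blk r j) *m (cm (E_blk r j))^T = 1%:M :> 'M[C]_(\sum_i r i).
  rewrite -(map_mx1 (real_complex R)) -(E_blk_partition r) raddf_sum.
  by apply: eq_bigr => j _; rewrite map_trmx -map_mxM.
rewrite -[herm Z *m V]mulmx1 -e mulmx_sumr raddf_sum /=; apply: eq_bigr => j _.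
by rewrite hermM herm_cm mulmxA mxtrace_mulC !mulmxA.
Qed.

Lemma conjc_iw w : conjc (iw w : C) = - iw w.
Proof. by apply/eqP; rewrite eq_complex /= oppr0 !eqxx. Qed.

Lemma frequency_cross_term w n m l c (A : 'M[R]_n) (B : 'M[R]_(n, m))
  (Co : 'M[R]_(l, n)) (D : 'M[R]_(l, m)) (X : 'M[R]_n) (G : 'M[R]_(m, n)) (F : 'M[R]_(n, c))
  (q d : 'M[C]_(n, c)) (e : 'M[C]_(m, c)) :
  Co^T *m D = 0 -> D^T *m D *m G = B^T *m X -> X^T = X ->
  A^T *m X + X *m A - G^T *m (B^T *m X) + Co^T *m Co = 0 ->
  iw w *: q = cm (A - B *m G) *m q + cm F ->
  iw w *: d = cm A *m d + cm B *m e ->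
  herm (cm (Co - D *m G) *m q) *m (cm Co *m d + cm D *m e) = cm (F^T *m X) *m d.
Proof.
move=> CD WG Xs ric qE dE.
have hE : (- iw w) *: herm q = herm q *m (cm A - cm B *m cm G)^T + (cm F)^T.
  have := congr1 herm qE; rewrite hermZ hermD hermM !herm_cm conjc_iw => ->.
  by rewrite map_mxB map_mxM.
rewrite hermM herm_cm map_mxB !map_mxM -map_trmx.
apply: (riccati_cross_term _ _ _ _ hE dE).
- by rewrite map_trmx -map_mxM CD map_mx0.
- by rewrite !map_trmx -!map_mxM WG.
- by rewrite map_trmx Xs.
by rewrite !map_trmx -!map_mxM -map_mxD -map_mxB -map_mxD ric map_mx0.
Qed.

Lemma freq_resp_trace w a (M : 'M[ratfun R]_a) : rel_degree_mx true 0 M ->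
  reval (\tr M) (iw w) = \tr (freq_resp w M).
Proof.
by move=> hM; rewrite /mxtrace reval_sum //; apply: eq_bigr => i _; rewrite mxE.
Qed.

Lemma rel_degree_trace b k a (M : 'M[ratfun R]_a) : rel_degree_mx b k M -> rel_degree b k (\tr M).
Proof. by move=> hM; apply: rel_degree_sum => i; exact: hM. Qed.

End Energy.

(** * Comparison of H2 norms *)

Section Comparison.
Import numFieldNormedType.Exports.
Local Open Scope classical_set_scope.
Local Open Scope ring_scope.
Context {R : realType}.
Notation mu := (@lebesgue_measure R).
Notation L := lift_mx.

Lemma continuous_bigsum (I : Type) (s : seq I) (f : I -> R -> R) :
  (forall i, continuous (f i)) -> continuous (fun w => \sum_(i <- s) f i w).
Proof.
move=> cf; elim: s => [|i s IH].
  by under eq_fun do rewrite big_nil; move=> w; exact: cvg_cst.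
under eq_fun do rewrite big_cons.
by move=> w; exact: (cvgD (cf i w) (IH w)).
Qed.

Lemma integrable_bigsum (I : Type) (s : seq I) (f : I -> R -> R) :
  (forall i, mu.-integrable setT (EFin \o f i)) ->
  mu.-integrable setT (EFin \o (fun w => \sum_(i <- s) f i w)).
Proof.
move=> cf; elim: s => [|i s IH].
  rewrite (_ : _ \o _ = (fun=> 0%E)); first exact: integrable0.
  by apply/funext => w; rewrite /= big_nil.
have := integrableD measurableT (cf i) IH; congr (mu.-integrable setT _).
by apply/funext => w; rewrite /= big_cons EFinD.
Qed.

Lemma energy_freq_respE a b (Z : 'M[ratfun R]_(a, b)) w :
  energy (freq_resp w Z) = \sum_i \sum_j normsq (reval (Z i j) (iw w)).
Proof. by apply: eq_bigr => i _; apply: eq_bigr => j _; rewrite mxE. Qed.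

Lemma continuous_energy a b (Z : 'M[ratfun R]_(a, b)) : rel_degree_mx true 0 Z ->
  continuous (fun w => energy (freq_resp w Z)).
Proof.
move=> hZ; under eq_fun do rewrite energy_freq_respE.
apply: continuous_bigsum => i; apply: continuous_bigsum => j.
exact: continuous_normsq_reval.
Qed.

Lemma integrable_energy a b (Z : 'M[ratfun R]_(a, b)) : rel_degree_mx true 1 Z ->
  mu.-integrable setT (EFin \o (fun w => energy (freq_resp w Z))).
Proof.
move=> hZ; under eq_fun do rewrite /= energy_freq_respE.
apply: integrable_bigsum => i; apply: integrable_bigsum => j.
exact: integrable_normsq_reval.
Qed.

Lemma entry_le_energy a b (M : 'M[R[i]]_(a, b)) i j : normsq (M i j) <= energy M.
Proof.
rewrite /energy (bigD1 i) //= (bigD1 j) //= -addrA lerDl addr_ge0 //.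
  by apply: sumr_ge0 => k _; exact: normsq_ge0.
by apply: sumr_ge0 => k _; apply: sumr_ge0 => k' _; exact: normsq_ge0.
Qed.

Lemma finite_energy_rel_degree a b (Z : 'M[ratfun R]_(a, b)) : rel_degree_mx true 0 Z ->
  (\int[mu]_(w in setT) (energy (freq_resp w Z))%:E < +oo)%E -> rel_degree_mx true 1 Z.
Proof.
move=> hZ fin i j; apply: finite_energy_strictly_proper (hZ i j) _.
apply: le_lt_trans fin; apply: ge0_le_integral => //.
- by move=> w _; rewrite lee_fin normsq_ge0.
- exact: continuous_EFin_measurable (continuous_normsq_reval (hZ i j)).
- exact: continuous_EFin_measurable (continuous_energy hZ).
by move=> w _; rewrite lee_fin; have := entry_le_energy (freq_resp w Z) i j; rewrite mxE.
Qed.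

Lemma H2norm_sqE a b (Z : 'M[ratfun R]_(a, b)) :
  H2norm_sq Z = (((2 * pi)^-1)%:E * \int[mu]_(w in setT) (energy (freq_resp w Z))%:E)%E.
Proof.
by rewrite /H2norm_sq; congr (_ * _)%E; apply: eq_integral => w _; rewrite energy_freq_respE.
Qed.

(** If Z' has infinite norm there is nothing to prove. Otherwise Z' is strictly
    proper, so the orthogonality hypothesis applies and the cross term of
    [energy_convex] integrates to 0. *)
Theorem H2_compare a b (Z Z' : 'M[ratfun R]_(a, b)) :
  rel_degree_mx true 1 Z -> rel_degree_mx true 0 Z' ->
  (rel_degree_mx true 1 Z' -> exists g, [/\ rel_degree true 1 g, rel_degree true 1 (svar * g) &
     forall w, reval g (iw w) = \tr (herm (freq_resp w Z) *m (freq_resp w Z' - freq_resp w Z))]) ->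
  (H2norm_sq Z <= H2norm_sq Z')%E.
Proof.
move=> hZ hZ' ortho; rewrite !H2norm_sqE.
apply: lee_wpmul2l; first by rewrite lee_fin invr_ge0 mulr_ge0 // pi_ge0.
have [inf|fin] := eqVneq (\int[mu]_(w in setT) (energy (freq_resp w Z'))%:E)%E +oo%E.
  by rewrite inf leey.
have {}fin : (\int[mu]_(w in setT) (energy (freq_resp w Z'))%:E < +oo)%E by rewrite ltey.
have hZ1 := finite_energy_rel_degree hZ' fin.
have [g [g1 g2 gE]] := ortho hZ1.
have [intg int0] := integral_Re_reval_eq0 g1 g2.
have intZ := integrable_energy hZ; have intZ' := integrable_energy hZ1.
have int2 := integrableZl measurableT 2 intg.
have -> : (\int[mu]_(w in setT) (energy (freq_resp w Z))%:E =
   \int[mu]_(w in setT) ((energy (freq_resp w Z))%:E + 2%:E * (complex.Re (reval g (iw w)))%:E))%E.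
  rewrite integralD // integralZl // int0 mule0 adde0 //.
apply: le_integral => //; first exact: integrableD.
move=> w _; rewrite -EFinM -EFinD lee_fin gE; exact: energy_convex.
Qed.

End Comparison.

(** * Optimality *)

(** f = (s f + f) / (s + 1), and 1 / (s + 1) has relative degree one. *)
Lemma rel_degree_integrate (R : realType) k (f : ratfun R) :
  rel_degree true k f -> rel_degree true k (svar * f) -> rel_degree true k.+1 f.
Proof.
move=> hf hsf.
have h1 : 'X + 1 != 0 :> {poly R} by rewrite -polyC1 monic_neq0 ?monicXaddC.
have hs : rel_degree true 1 ((tofr ('X + 1))^-1 : ratfun R).
  exists 1, ('X + 1); split.
  - by rewrite tofrac1 mul1r.
  - split=> // _ z; rewrite /to_cpoly rmorphD /= map_polyX rmorph1 /root !hornerE addr_eq0.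
    by move=> /eqP -> /=; rewrite ltrN10.
  by rewrite -polyC1 size_XaddC size_polyC oner_eq0.
have -> : f = (svar * f + f) * (tofr ('X + 1))^-1.
  rewrite -{3}[f]mul1r -mulrDl tofracD tofrac1 -/svar mulrAC divff ?mul1r //.
  by rewrite -tofrac1 -tofracD tofrac_eq0.
by rewrite -addn1; apply: rel_degreeM hs; exact: rel_degreeD.
Qed.

Lemma subrACA (V : zmodType) (a b c e : V) : a + b - (c - e) = a - c + (b + e).
Proof. by rewrite opprB (addrC e) addrACA. Qed.

Section AnyLoop.
Context {R : realType}.
Notation L := lift_mx.
Context {n m r l : nat} (A : 'M[R]_n) (B : 'M[R]_(n, m)) (C : 'M[R]_(l, n)) (D : 'M[R]_(l, m))
  (F : 'M[R]_(n, r)) (Kc : 'M[ratfun R]_(m, n)).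
Notation P22 := (resolvent A *m L B).
Hypothesis wp : 1%:M - P22 *m Kc \in unitmx.
Context (sens : 'M[ratfun R]_n) (x : 'M[ratfun R]_(n, r)) (u : 'M[ratfun R]_(m, r)).
Hypothesis sensE : sens = invmx (1%:M - P22 *m Kc).
Hypothesis xE : x = sens *m (resolvent A *m L F).
Hypothesis uE : u = Kc *m x.

Lemma loop_state : x = resolvent A *m (L B *m u + L F).
Proof.
have : (1%:M - P22 *m Kc) *m x = resolvent A *m L F by rewrite xE sensE mulKVmx.
rewrite mulmxBl mul1mx -(mulmxA P22) -uE => /eqP; rewrite subr_eq addrC => /eqP e.
by rewrite {1}e mulmxDr (mulmxA (resolvent A)).
Qed.

Lemma loop_dynamics : svar *: x = L A *m x + (L B *m u + L F).
Proof. by rewrite loop_state; exact: resolvent_solves. Qed.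

Lemma loop_output :
  L C *m resolvent A *m L F + (L C *m resolvent A *m L B + L D) *m Kc *m sens *m (resolvent A *m
    L F)
  = L C *m x + L D *m u.
Proof.
rewrite -(mulmxA _ sens) -xE -(mulmxA _ Kc) -uE mulmxDl addrA; congr (_ + _).
rewrite -(mulmxA (L C) (resolvent A) (L F)) -(mulmxA (L C) (resolvent A) (L B)).
rewrite -(mulmxA (L C) _ u) -mulmxDr; congr (_ *m _).
by rewrite [RHS]loop_state mulmxDr addrC (mulmxA _ (L B)).
Qed.

End AnyLoop.

Section Optimality.
Context {R : realType} {p : nat} {ple : rel 'I_p}.
Hypothesis ple_order : partial_order ple.
Hypothesis ple_index : linear_extension_indexed ple.
Context {n m r : 'I_p -> nat} {l : nat}.
Context (A : 'M[R]_(\sum_i n i)) (B : 'M[R]_(\sum_i n i, \sum_i m i)).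
Context (C : 'M[R]_(l, \sum_i n i)) (D : 'M[R]_(l, \sum_i m i)).
Context (F : 'M[R]_(\sum_i n i, \sum_i r i)).
Hypothesis A_causal : incidence ple A.
Hypothesis B_causal : incidence ple B.
Hypothesis CD0 : C^T *m D = 0.
Hypothesis DD_pos : posdef (D^T *m D).
Hypothesis F_diag : is_bdiag F.
Hypothesis AB_stab : forall i, stabilizable (submxblock A i i) (submxblock B i i).
Context (X : forall j, 'M[R]_(\sum_k sdim n (down ple j) k)).
Hypothesis X_riccati : forall j, riccati_sol A B C D (X j).

Notation L := lift_mx.
Notation dn := (down ple).
Notation N j := (\sum_k sdim n (dn j) k)%N.
Notation Es d j := (E_set d (dn j)).
Notation Kg := (Kgain B D X).
Notation Acl j := (A_ ple A j - B_ ple B j *m Kg j).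
Notation Pi1 := (@Pi1 R p ple n).
Notation Pi2 := (@Pi2 R p ple n).
Notation Rmx d := (@Rmx R p ple d).
Notation bA := (bigA A B D X).
Notation CQ := (C_Q B D X).
Notation AP := (A_Phi A B D X).
Notation BP := (B_Phi A B D X).
Notation CP := (@C_Phi R p ple n).
Notation Ks := (Kstar A B D X).
Notation iota j := (E_blk (fun j => N j) j).
Notation dist_to_state := (dist_to_state bA (Rmx n) Pi1).
Notation dist_to_input := (dist_to_input bA CQ Pi1).

(** The disturbance entering the subsystem of the downset of j. *)
Definition F_sub j : 'M[R]_(N j, r j) := (Es n j)^T *m (F *m E_blk r j).

(** F is block diagonal. *)
Lemma F_col j : F *m E_blk r j = E_blk n j *m ((E_blk n j)^T *m (F *m E_blk r j)).
Proof.
rewrite -[LHS]mul1mx -(E_blk_partition n) mulmx_suml [LHS](bigD1 j) //= -!mulmxA.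
rewrite [X in _ + X]big1 ?addr0 // => i ij.
by rewrite -!mulmxA (mulmxA _ F) -submxblock_E F_diag // mulmx0.
Qed.

(** The response of the subsystem below j to its own disturbance under its own
    Riccati gain; it is block column j of the optimal state. *)
Definition opt_state_sub j := resolvent (Acl j) *m L (F_sub j).

Lemma resolvent_Pi1_F j :
  resolvent bA *m L Pi1 *m L F *m L (E_blk r j) = L (iota j) *m opt_state_sub j.
Proof.
rewrite -!(mulmxA (resolvent bA)) -!lift_mxM.
have -> : Pi1 *m F *m E_blk r j = iota j *m F_sub j.
  rewrite -(mulmxA Pi1) {1}F_col (mulmxA Pi1) Pi1_E -(mulmxA (iota j)) /F_sub.
  by rewrite (first_block ple_order ple_index) -(mulmxA _ (E_blk n j)) -F_col.
by rewrite lift_mxM mulmxA (resolvent_intertwine (bigA_E A B D X j)) -mulmxA.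
Qed.

Lemma opt_state_col j : dist_to_state *m L F *m L (E_blk r j) = L (Es n j) *m opt_state_sub j.
Proof.
rewrite /dist_to_state -!(mulmxA (L (Rmx n))) -(mulmxA (resolvent bA *m L Pi1)).
rewrite (mulmxA (resolvent bA *m L Pi1)) resolvent_Pi1_F mulmxA -lift_mxM.
by rewrite (Rmx_E (R := R) (ple := ple)).
Qed.

Lemma opt_input_col j : dist_to_input *m L F *m L (E_blk r j) =
  - (L (Es m j *m Kg j) *m opt_state_sub j).
Proof.
rewrite /dist_to_input -!(mulmxA (L CQ)) -(mulmxA (resolvent bA *m L Pi1)).
rewrite (mulmxA (resolvent bA *m L Pi1)) resolvent_Pi1_F mulmxA -lift_mxM.
by rewrite CQ_E lift_mxN mulNmx.
Qed.

Lemma opt_state_sub_dynamics j : svar *: opt_state_sub j =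
  L (Acl j) *m opt_state_sub j + L (F_sub j).
Proof. exact: resolvent_solves. Qed.

Lemma opt_state_sub_deg j : rel_degree_mx true 1 (opt_state_sub j).
Proof.
apply/rel_degree_mx_liftr/resolvent_rel_degree => _.
exact: (Acl_Hurwitz ple_index A_causal B_causal DD_pos AB_stab X_riccati).
Qed.

Lemma Kstar_closed_loop : closed_loop A B C D F Ks =
  L C *m (dist_to_state *m L F) + L D *m (dist_to_input *m L F).
Proof.
exact (ctrl_tf_closed_loop (R_Pi1 ple_order ple_index) Pi2_gram (Pi2_Pi1 ple_order ple_index)
  (Pi_partition ple_order ple_index) (R_intertwine ple_order A_causal B_causal D X)
  erefl erefl erefl C D F).
Qed.

Lemma bigA_resolvent_deg : rel_degree_mx true 1 (resolvent bA).
Proof.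
exact: (resolvent_bigA_deg ple_index A_causal B_causal DD_pos AB_stab X_riccati).
Qed.

Lemma Kstar_admissible : admissible ple A B C D F Ks.
Proof.
split.
- exact: (Kstar_incidence ple_order ple_index).
- exact: tf_proper.
exact (ctrl_tf_internally_stable (R_Pi1 ple_order ple_index) Pi2_gram (Pi2_Pi1 ple_order ple_index)
  (Pi_partition ple_order ple_index) (R_intertwine ple_order A_causal B_causal D X)
  erefl erefl erefl C D F bigA_resolvent_deg).
Qed.

Lemma Kstar_closed_loop_deg : rel_degree_mx true 1 (closed_loop A B C D F Ks).
Proof.
rewrite Kstar_closed_loop; have h := bigA_resolvent_deg.
by apply: rel_degree_mxD; apply: rel_degree_mx_liftl; apply: rel_degree_mx_liftr;
  apply: rel_degree_mx_liftr; apply: rel_degree_mx_liftl.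
Qed.

Lemma CD_sub j : (C_ ple C j)^T *m D_ ple D j = 0.
Proof.
by rewrite /C_ /D_ !sub_cols_E trmx_mul -(mulmxA _ C^T) (mulmxA C^T) CD0 mul0mx mulmx0.
Qed.

Lemma Kgain_normal j : (D_ ple D j)^T *m D_ ple D j *m Kg j = (B_ ple B j)^T *m X j.
Proof.
have u := posdef_unit (DD_pos_sub (ple := ple) DD_pos j).
by rewrite /Kgain -(mulmxA (invmx _)) mulKVmx.
Qed.

Lemma riccati_gain j : (A_ ple A j)^T *m X j + X j *m A_ ple A j
  - (Kg j)^T *m ((B_ ple B j)^T *m X j) + (C_ ple C j)^T *m C_ ple C j = 0.
Proof.
have [[Xs _] ric] := X_riccati j; rewrite -[RHS]ric; congr (_ - _ + _).
have [Ws _] := DD_pos_sub (ple := ple) DD_pos j.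
by rewrite /Kgain !trmx_mul trmxK Xs trmx_inv Ws !mulmxA.
Qed.

Lemma Kstar_output_col j :
  closed_loop A B C D F Ks *m L (E_blk r j) =
    L (C_ ple C j - D_ ple D j *m Kg j) *m opt_state_sub j.
Proof.
rewrite Kstar_closed_loop mulmxDl -!(mulmxA (L C)) -!(mulmxA (L D)) opt_state_col opt_input_col.
rewrite mulmxN (mulmxA (L C)) (mulmxA (L D)) -!lift_mxM -mulmxBl -lift_mxB.
by rewrite /C_ /D_ !sub_cols_E -(mulmxA D).
Qed.

Notation cm := (map_mx (real_complex R)).

Section Competitor.
Context (K' : 'M[ratfun R]_(\sum_i m i, \sum_i n i)).
Hypothesis K'_adm : admissible ple A B C D F K'.
Notation sens' := (sens A B K').
Context (x : 'M[ratfun R]_(\sum_i n i, \sum_i r i)) (u : 'M[ratfun R]_(\sum_i m i, \sum_i r i)).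
Hypothesis xE : x = sens' *m P21 A F.
Hypothesis uE : u = K' *m x.

Lemma plant_incidence : incidence ple (resolvent A).
Proof.
apply: (incidence_inv ple_order (mul_resolvent A)); apply: incidence_sub.
  exact: incidence_scalar.
exact: lift_incidence.
Qed.

(** The sensitivity of a causal controller is the inverse of a causal matrix. *)
Lemma x_incidence : incidence ple x.
Proof.
have [inc _ [wp _ _ _]] := K'_adm.
have hF : incidence ple (L F) by apply/lift_incidence/bdiag_incidence.
rewrite xE; apply: incidence_mul => //; last by apply: incidence_mul => //; exact: plant_incidence.
apply: (incidence_inv ple_order (mulmxV wp)); apply: incidence_sub.
  exact: incidence_scalar.
apply: incidence_mul inc => //; apply: incidence_mul => //; first exact: plant_incidence.
exact: lift_incidence.
Qed.

Lemma u_incidence : incidence ple u.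
Proof.
have [inc _ _] := K'_adm; rewrite uE; apply: incidence_mul => //; exact: x_incidence.
Qed.

Lemma x_deg0 : rel_degree_mx true 0 x.
Proof. by rewrite xE; have [_ _ [_ _ _ [/RHinftyP]]] := K'_adm. Qed.

Lemma u_deg0 : rel_degree_mx true 0 u.
Proof.
rewrite uE xE mulmxA; have [_ _ [_ _ [h _ _] _]] := K'_adm; exact/RHinftyP.
Qed.

Lemma x_dynamics : svar *: x = L A *m x + (L B *m u + L F).
Proof. by have [_ _ [wp _ _ _]] := K'_adm; exact: (loop_dynamics wp erefl xE uE). Qed.

Lemma z_output : closed_loop A B C D F K' = L C *m x + L D *m u.
Proof. by have [_ _ [wp _ _ _]] := K'_adm; exact: (loop_output C D wp erefl xE uE). Qed.

Definition x_sub j := L (Es n j)^T *m (x *m L (E_blk r j)).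
Definition u_sub j := L (Es m j)^T *m (u *m L (E_blk r j)).
Definition state_gap j := x_sub j - opt_state_sub j.
(** The deviation of the competing input from the optimal input - K_j h_j. *)
Definition input_gap j := u_sub j + L (Kg j) *m opt_state_sub j.

Lemma x_col j : x *m L (E_blk r j) = L (Es n j) *m x_sub j.
Proof.
rewrite /x_sub lift_E_blk {1}(incidence_col j x_incidence) lift_mx_tr lift_E_set.
by [].
Qed.

Lemma u_col j : u *m L (E_blk r j) = L (Es m j) *m u_sub j.
Proof.
rewrite /u_sub lift_E_blk {1}(incidence_col j u_incidence) lift_mx_tr lift_E_set.
by [].
Qed.

Lemma x_sub_dynamics j :
  svar *: x_sub j = L (A_ ple A j) *m x_sub j + L (B_ ple B j) *m u_sub j + L (F_sub j).
Proof.
rewrite {1}/x_sub scalemxAr scalemxAl x_dynamics.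
rewrite !mulmxDl -!(mulmxA _ _ (L (E_blk r j))) x_col u_col !mulmxDr addrA.
rewrite (mulmxA (L A)) (mulmxA (L B)) !(mulmxA (L (Es n j)^T)).
by rewrite -!lift_mxM /A_ /B_ !sub_sq_E /F_sub -!(mulmxA (Es n j)^T).
Qed.

Lemma state_gap_dynamics j : svar *: state_gap j =
  L (A_ ple A j) *m state_gap j + L (B_ ple B j) *m input_gap j.
Proof.
rewrite /state_gap /input_gap scalerBr x_sub_dynamics opt_state_sub_dynamics lift_mxB lift_mxM.
rewrite mulmxBr mulmxDr mulmxBl -(mulmxA (L (B_ ple B j)) (L _)).
by rewrite opprD addrACA subrr addr0 subrACA.
Qed.

Lemma output_gap_col j :
  (closed_loop A B C D F K' - closed_loop A B C D F Ks) *m L (E_blk r j) =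
  L (C_ ple C j) *m state_gap j + L (D_ ple D j) *m input_gap j.
Proof.
move: (Kstar_output_col j) z_output.
move: (closed_loop A B C D F Ks) (closed_loop A B C D F K') => zs z' zsE ->.
rewrite mulmxBl zsE mulmxDl -(mulmxA (L C)) -(mulmxA (L D)) x_col u_col.
rewrite (mulmxA (L C)) (mulmxA (L D)) -!lift_mxM /C_ /D_ -!sub_cols_E /state_gap /input_gap
  lift_mxB lift_mxM.
rewrite mulmxBr mulmxDr mulmxBl -(mulmxA _ (L (Kg j))).
exact: subrACA.
Qed.

(** C^T D = 0 makes the input a constant multiple of the output. *)
Lemma u_deg1 : rel_degree_mx true 1 (closed_loop A B C D F K') -> rel_degree_mx true 1 u.
Proof.
move: z_output; move: (closed_loop A B C D F K') => z' zE hz.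
have -> : u = L (invmx (D^T *m D) *m D^T) *m z'.
  rewrite zE mulmxDr !mulmxA -!lift_mxM -!(mulmxA (invmx _)) mulVmx ?posdef_unit //.
  rewrite (_ : D^T *m C = 0) ?mulmx0 ?lift_mx0 ?mul0mx ?lift_mx1 ?mul1mx ?add0r //.
  by rewrite -[C]trmxK -trmx_mul CD0 trmx0.
exact: rel_degree_mx_liftl.
Qed.

(** A may be unstable, so that stability of (s - A)^-1 (B u + F) is not visible
    factor by factor; instead x is stable and s x = A x + B u + F is proper. *)
Lemma x_deg1 : rel_degree_mx true 1 x.
Proof.
move=> i j; apply: rel_degree_integrate; first exact: x_deg0.
have -> : svar * x i j = (svar *: x) i j by rewrite [RHS]mxE.
rewrite x_dynamics; move: i j.
apply: rel_degree_mxD; first by apply/rel_degree_mx_liftl/x_deg0.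
by apply: rel_degree_mxD; [apply/rel_degree_mx_liftl/u_deg0|exact: rel_degree_mx_lift].
Qed.

Lemma state_gap_deg1 j : rel_degree_mx true 1 (state_gap j).
Proof.
apply: rel_degree_mxD; last exact/rel_degree_mxN/opt_state_sub_deg.
by apply/rel_degree_mx_liftl/rel_degree_mx_liftr/x_deg1.
Qed.

Lemma input_gap_deg1 j : rel_degree_mx true 1 (closed_loop A B C D F K') ->
  rel_degree_mx true 1 (input_gap j).
Proof.
move=> hz; apply: rel_degree_mxD; last exact/rel_degree_mx_liftl/opt_state_sub_deg.
by apply/rel_degree_mx_liftl/rel_degree_mx_liftr/u_deg1.
Qed.

Definition cross_term := \sum_j \tr (L ((F_sub j)^T *m X j) *m state_gap j).

Lemma cross_term_deg1 : rel_degree true 1 cross_term.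
Proof.
apply: rel_degree_sum => j.
by apply/rel_degree_trace/rel_degree_mx_liftl/state_gap_deg1.
Qed.

(** F drops out of the dynamics of the difference of two trajectories. *)
Lemma cross_term_deg2 : rel_degree_mx true 1 (closed_loop A B C D F K') ->
  rel_degree true 1 (svar * cross_term).
Proof.
move=> hz; rewrite /cross_term mulr_sumr; apply: rel_degree_sum => j.
rewrite -mxtraceZ; apply/rel_degree_trace; rewrite scalemxAr state_gap_dynamics.
apply: rel_degree_mx_liftl; apply: rel_degree_mxD; apply: rel_degree_mx_liftl;
  [exact: state_gap_deg1|exact: input_gap_deg1].
Qed.

Lemma cross_term_eval w : rel_degree_mx true 1 (closed_loop A B C D F K') ->
  reval cross_term (iw w) =
  \tr (herm (freq_resp w (closed_loop A B C D F Ks)) *m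
       (freq_resp w (closed_loop A B C D F K') - freq_resp w (closed_loop A B C D F Ks))).
Proof.
move=> hz.
have hdx j : rel_degree_mx true 0 (state_gap j) by apply: rel_degree_mx_sub; exact: state_gap_deg1.
have hdu j : rel_degree_mx true 0 (input_gap j) by apply: rel_degree_mx_sub; exact: input_gap_deg1.
have hh j : rel_degree_mx true 0 (opt_state_sub j) by apply: rel_degree_mx_sub;
  exact: opt_state_sub_deg.
move: Kstar_output_col output_gap_col (rel_degree_mx_sub Kstar_closed_loop_deg)
  (rel_degree_mx_sub hz).
move: (closed_loop A B C D F Ks) (closed_loop A B C D F K') => zs z' zsE gapE hzs hz'.
have hgap : rel_degree_mx true 0 (z' - zs) by apply: rel_degree_mxD => //; exact: rel_degree_mxN.
have -> : freq_resp w z' - freq_resp w zs = freq_resp w (z' - zs).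
  by rewrite -{1}(subrK zs z') freq_respD // addrK.
rewrite tr_herm_blocks /cross_term reval_sum; last first.
  by move=> j; apply/rel_degree_trace/rel_degree_mx_liftl.
apply: eq_bigr => j _; rewrite freq_resp_trace; last exact: rel_degree_mx_liftl.
congr (\tr _).
have dl a b (M : 'M[R]_(a, b)) := @rel_degree_mx_lift R true a b M.
rewrite -(freq_resp_lift w) -(freq_respM w hzs (dl _ _ _)) -(freq_respM w hgap (dl _ _ _)) zsE gapE.
rewrite freq_respD; [|exact: rel_degree_mx_liftl..].
rewrite !(freq_respM w (dl _ _ _)) // !freq_resp_lift.
have [[Xs _] _] := X_riccati j.
symmetry; apply: (frequency_cross_term (w := w) (CD_sub j) (Kgain_normal j) Xs (riccati_gain j)).
  have dAh : rel_degree_mx true 0 (L (Acl j) *m opt_state_sub j) by exact: rel_degree_mx_liftl.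
  have := congr1 (freq_resp w) (opt_state_sub_dynamics j).
  by rewrite (freq_resp_svar w (hh j)) (freq_respD w dAh (dl _ _ _)) (freq_respM w (dl _ _ _)
    (hh j)) !freq_resp_lift.
have dA : rel_degree_mx true 0 (L (A_ ple A j) *m state_gap j) by exact: rel_degree_mx_liftl.
have dB : rel_degree_mx true 0 (L (B_ ple B j) *m input_gap j) by exact: rel_degree_mx_liftl.
have := congr1 (freq_resp w) (state_gap_dynamics j).
rewrite (freq_resp_svar w (hdx j)) (freq_respD w dA dB) (freq_respM w (dl _ _ _) (hdx j)).
by rewrite (freq_respM w (dl _ _ _) (hdu j)) !freq_resp_lift.
Qed.

End Competitor.

Theorem Kstar_optimal : H2_optimal ple A B C D F Ks.
Proof.
split; first exact: Kstar_admissible.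
move=> K' adm; apply: H2_compare.
- exact: Kstar_closed_loop_deg.
- by have [_ _ [_ [/RHinftyP]]] := adm.
move=> hz.
pose x := sens A B K' *m P21 A F.
exists (cross_term x); split.
- exact: (cross_term_deg1 adm erefl erefl).
- exact: (cross_term_deg2 adm erefl erefl).
by move=> w; rewrite (cross_term_eval adm erefl erefl).
Qed.

End Optimality.

Theorem theorem4 (R : realType) (p : nat) (ple : rel 'I_p)
  (ple_order : partial_order ple)
  (ple_index : linear_extension_indexed ple)
  (n m r : 'I_p -> nat) (l : nat)
  (A : 'M[R]_(\sum_i n i)) (B : 'M[R]_(\sum_i n i, \sum_i m i))
  (C : 'M[R]_(l, \sum_i n i)) (D : 'M[R]_(l, \sum_i m i))
  (F : 'M[R]_(\sum_i n i, \sum_i r i))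
  (A_causal : incidence ple A) (B_causal : incidence ple B)
  (CD0 : C^T *m D = 0) (DD_pos : posdef (D^T *m D))
  (F_diag : is_bdiag F) (F_rank : \rank F = (\sum_i r i)%N)
  (AB_stab : forall i, stabilizable (submxblock A i i) (submxblock B i i))
  (X : forall j, 'M[R]_(\sum_k sdim n (down ple j) k))
  (X_riccati : forall j, riccati_sol A B C D (X j)) :
  [/\ H2_optimal ple A B C D F (Kstar A B D X),
      Kstar A B D X = - (K_Phi A B D X *m Gamma A B D X)
    & forall (x : 'cV[ratfun R]_(\sum_i n i)) (u : 'cV[ratfun R]_(\sum_i m i)),
        u = Kstar A B D X *m x ->
        u = - (K_Phi A B D X *m Gamma A B D X *m x) /\
        u = - \sum_j lift_mx (Khat B D X j) *m submxrow (Phi A B D X) j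
                       *m submxcol (Gamma A B D X *m x) j].
Proof.
have factor := Kstar_factor ple_order ple_index A B D X.
split; first exact: Kstar_optimal.
  exact: factor.
move=> x u ->; rewrite factor mulNmx; split=> //; congr (- _).
rewrite -(mulmxA (K_Phi A B D X)) {1}/K_Phi -{1}[Gamma A B D X *m x]submxcolK.
exact: mul_mxrow_mxcol.
Qed.
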